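(* Let $\boldsymbol{W}$ be standard planar Brownian motion started at the origin, $\mathbb{D}$ the open unit disk in $\mathbb{R}^2$ and $\tau_{\mathbb{D}}=\inf\{t\ge0:\boldsymbol{W}_t\notin\mathbb{D}\}$. Let $\mathcal{H}^\star_{\tau_{\mathbb{D}}}$ be the star hull of the trace $\boldsymbol{W}_{[0,\tau_{\mathbb{D}}]}=\{\boldsymbol{W}_t:0\le t\le\tau_{\mathbb{D}}\}$. Then $$\mathbb{E}\big[\operatorname{Area}(\mathcal{H}^\star_{\tau_{\mathbb{D}}})\big]=\pi-\frac{8}{3}\approx 0.474925 .$$
   Context: The star hull of a set $\mathcal{A}\subset\mathbb{R}^2$ (with respect to the origin) is $\{\rho\boldsymbol{x}:0\le\rho\le1,\ \boldsymbol{x}\in\mathcal{A}\}$. $\operatorname{Area}$ denotes two-dimensional Lebesgue measure. *)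

(* Defs.v *)
From HB Require Import structures.
From mathcomp Require Import all_boot all_order all_algebra.
From mathcomp Require Import all_classical all_reals all_analysis.
Set Implicit Arguments. Unset Strict Implicit. Unset Printing Implicit Defensive.
Import Order.TTheory GRing.Theory Num.Theory.
Import numFieldNormedType.Exports.
Local Open Scope classical_set_scope.
Local Open Scope ring_scope.

Definition leb2 {R : realType} := ((@lebesgue_measure R) \x (@lebesgue_measure R))%E.

Definition Area {R : realType} (A : set (R * R)) : \bar R := leb2 A.

Definition gauss2 {R : realType} (s : R) (x : R * R) : R :=
  expR (- (x.1 ^+ 2 + x.2 ^+ 2) / (s *+ 2)) / (pi *+ 2 * s).

(* Standard planar Brownian motion started at the origin, on the probability
   space (T, P): W t is the position at time t >= 0.  Paths are continuous on
   [0, +oo), W 0 = 0, each W t is a random variable, and for all times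
   0 = t_0 < t_1 < ... < t_n the increments W t_(i+1) - W t_i are independent
   centred Gaussians with covariance (t_(i+1) - t_i) Id (joint law of the
   increments = product of these Gaussian laws). *)
Definition is_planar_BM {R : realType} {d : measure_display} {T : measurableType d}
  (P : probability T R) (W : R -> T -> R * R) : Prop :=
  [/\ forall w, W 0 w = (0, 0),
      forall t, 0 <= t -> measurable_fun setT (W t),
      forall w, {within `[0, +oo[, continuous (fun t => W t w)} &
      forall (n : nat) (t : nat -> R) (A : nat -> set (R * R)),
        t 0%N = 0 -> (forall i, (i < n)%N -> t i < t i.+1) ->
        (forall i, measurable (A i)) ->
        P [set w | forall i, (i < n)%N ->
                     ((W (t i.+1) w).1 - (W (t i) w).1,
                      (W (t i.+1) w).2 - (W (t i) w).2) \in A i]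
        = (\prod_(i < n) \int[leb2]_(x in A i) (gauss2 (t i.+1 - t i) x)%:E)%E].

Definition unit_disk {R : realType} : set (R * R) :=
  [set x | x.1 ^+ 2 + x.2 ^+ 2 < 1].

(* First exit time of the path from the unit disk (in \bar R; +oo if never). *)
Definition exit_time {R : realType} {T : Type} (W : R -> T -> R * R) (w : T) : \bar R :=
  ereal_inf [set t%:E | t in [set t : R | 0 <= t /\ ~ unit_disk (W t w)]].

Definition trace_until_exit {R : realType} {T : Type} (W : R -> T -> R * R) (w : T)
  : set (R * R) :=
  [set W t w | t in [set t : R | 0 <= t /\ (t%:E <= exit_time W w)%E]].

Definition star_hull {R : realType} (A : set (R * R)) : set (R * R) :=
  [set p | exists rho x, [/\ 0 <= rho <= 1, A x & p = (rho * x.1, rho * x.2)]].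

(* Main.v *)
(* By Tonelli the expected area is the integral over x in the disk of
   P(x in the hull).  For 0 < |x| < 1, x belongs to the hull iff the path hits the
   radial slit from x to the circle before leaving the disk; this probability is
   the harmonic measure at 0 of the slit [|x|, 1] in the slit disk, which a
   conformal map (Koebe function, square root, Moebius map) shows to be
   1 - (4 / pi) atan (sqrt |x|).  Integrating over level sets, which are disks of
   radius tan((1 - t) pi / 4)^2, gives the integral over 0 < t < 1 of
   pi tan((1 - t) pi / 4)^4, that is pi - 8/3.

   Optional stopping is done for the Gaussian walk (W_(kh))_k instead of W.  The
   Gaussian law is invariant under multiplication by i, and the average of
   z + i^k y over k kills the first two Taylor coefficients of a holomorphic
   function, so a step changes the expected value of the harmonic function by
   O(h^(3/2)), and O(1/h) steps by o(1), uniformly away from the boundary.  The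
   walk follows the continuous path to its first boundary point as h -> 0.  Upper
   bounds for the probabilities of hitting and of missing the slit, both obtained
   by Fatou's lemma, add up to 1, which gives equality. *)

From HB Require Import structures.
From mathcomp Require Import all_boot all_order all_algebra.
From mathcomp Require Import all_classical all_reals all_analysis.
From mathcomp Require Import measurable_realfun complex ring lra.
Require Import Defs.
Set Implicit Arguments. Unset Strict Implicit. Unset Printing Implicit Defensive.
Import Order.TTheory GRing.Theory Num.Theory.
Import numFieldNormedType.Exports.
Local Open Scope classical_set_scope.
Local Open Scope ring_scope.

(** * Complex second-order expansions *)

(** The harmonic measure has no limit at the corner where slit and circle meet, and its formula says
    nothing at zeros of [slitD]. This is why only one-sided estimates are sought: one nonnegative
    function is close to 1 near the slit, another near the rest of the circle, so walks that end
    elsewhere or are not stopped in time only add to the expectation and may be dropped from an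
    upper bound. The walk is stopped on leaving the set where |z| <= 2 and [slitD] is at least 1/(n
    + 1). Taylor constants are uniform there for fixed n only, so the mesh goes to 0 before n goes
    to infinity, and Fatou's lemma is used once for each limit. Gaussian steps are unbounded and may
    jump over the boundary; hence the four-point estimate is stated for every displacement, large
    ones being absorbed by the boundedness of the argument. The normalisation of the Gaussian
    density is never computed: it is read off from the total mass of the law of [W]. Measurability
    of the hull, given by an uncountable union over times, is recovered jointly in path and point
    inside the open disk, at the cost of at most one point of the circle. *)

Notation cRe := complex.Re.
Notation cIm := complex.Im.
Notation nrm := Normc.normc.

Section Jets.
Context {R : realType}.
Implicit Types (K : set R[i]) (F A B : R[i] -> R[i]).

Lemma nrm_ge0 (x : R[i]) : 0 <= nrm x.
Proof. by case: x => a b /=; exact: sqrtr_ge0. Qed.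

Lemma nrmD (x y : R[i]) : nrm (x + y) <= nrm x + nrm y.
Proof. exact: le_normcD. Qed.

Lemma nrmN (x : R[i]) : nrm (- x) = nrm x.
Proof. exact: normcN. Qed.

Lemma nrmM (x y : R[i]) : nrm (x * y) = nrm x * nrm y.
Proof. exact: Normc.normcM. Qed.

Lemma nrmV (x : R[i]) : nrm x^-1 = (nrm x)^-1.
Proof. exact: Normc.normcV. Qed.

Lemma nrmX (x : R[i]) n : nrm (x ^+ n) = nrm x ^+ n.
Proof.
elim: n => [|n ih]; first by rewrite !expr0 Normc.normc1.
by rewrite !exprS nrmM ih.
Qed.

Lemma nrm_gt0 (x : R[i]) : (0 < nrm x) = (x != 0).
Proof.
rewrite lt_neqAle nrm_ge0 andbT; apply/idP/idP.
  by apply: contra => /eqP ->; rewrite Normc.normc0.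
by apply: contra; rewrite eq_sym => /eqP/Normc.eq0_normc ->.
Qed.

Lemma nrmB (x y : R[i]) : nrm x - nrm y <= nrm (x + y).
Proof.
have := nrmD (x + y) (- y); rewrite addrK nrmN => h.
by rewrite lerBlDr.
Qed.

Lemma normRe_le_nrm (x : R[i]) : `|cRe x| <= nrm x.
Proof.
by case: x => a b /=; rewrite -sqrtr_sqr ler_wsqrtr// lerDl sqr_ge0.
Qed.

Lemma normIm_le_nrm (x : R[i]) : `|cIm x| <= nrm x.
Proof.
by case: x => a b /=; rewrite -sqrtr_sqr ler_wsqrtr// lerDr sqr_ge0.
Qed.

(** [I] restricts base point and displacement together; one constant serves all admissible pairs, so
    the error can be summed along the walk. *)
Definition bigO (I : R[i] -> R[i] -> Prop) (k : nat) (f : R[i] -> R[i] -> R[i]) :=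
  exists2 c, 0 <= c & forall z y, I z y -> nrm (f z y) <= c * nrm y ^+ k.

Definition near0 K (d : R) (z y : R[i]) := K z /\ nrm y <= d.

Lemma bigO_sub I I' k f : (forall z y, I' z y -> I z y) -> bigO I k f -> bigO I' k f.
Proof. by move=> sub [c c0 h]; exists c => // z y /sub; exact: h. Qed.

Lemma eq_bigO I k f g : (forall z y, I z y -> f z y = g z y) -> bigO I k f -> bigO I k g.
Proof. by move=> e [c c0 h]; exists c => // z y i; rewrite -e// h. Qed.

Lemma bigOD I k f g : bigO I k f -> bigO I k g -> bigO I k (fun z y => f z y + g z y).
Proof.
move=> [c c0 h] [c' c0' h']; exists (c + c'); first exact: addr_ge0.
by move=> z y i; rewrite (le_trans (nrmD _ _))// mulrDl lerD ?h ?h'.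
Qed.

Lemma bigON I k f : bigO I k f -> bigO I k (fun z y => - f z y).
Proof. by move=> [c c0 h]; exists c => // z y i; rewrite nrmN h. Qed.

Lemma bigOB I k f g : bigO I k f -> bigO I k g -> bigO I k (fun z y => f z y - g z y).
Proof. by move=> h h'; apply: bigOD => //; exact: bigON. Qed.

Lemma bigOM I j k f g : bigO I j f -> bigO I k g ->
  bigO I (j + k) (fun z y => f z y * g z y).
Proof.
move=> [c c0 h] [c' c0' h']; exists (c * c'); first exact: mulr_ge0.
move=> z y i; rewrite nrmM exprD mulrACA ler_pM ?nrm_ge0 ?h ?h'//.
Qed.

Lemma bigO_cst I a : bigO I 0 (fun _ _ => a).
Proof. by exists (nrm a); rewrite ?nrm_ge0// => z y _; rewrite expr0 mulr1. Qed.

Lemma bigO_y I : bigO I 1 (fun _ y => y).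
Proof. by exists 1 => // z y _; rewrite expr1 mul1r. Qed.

Lemma bigO_eq0 I k f : (forall z y, f z y = 0) -> bigO I k f.
Proof. by move=> f0; exists 0 => // z y _; rewrite f0 Normc.normc0 mul0r. Qed.

Lemma bigO_leq K d j k f : d <= 1 -> (k <= j)%N ->
  bigO (near0 K d) j f -> bigO (near0 K d) k f.
Proof.
move=> d1 kj [c c0 h]; exists c => // z y i; rewrite (le_trans (h _ _ i))//.
apply: ler_wpM2l => //; apply: ler_wiXn2l => //; first exact: nrm_ge0.
exact: le_trans (proj2 i) d1.
Qed.

Lemma bigO_lt1 K d f e : 0 < d -> 0 < e -> bigO (near0 K d) 1 f ->
  exists2 d', 0 < d' <= d & forall z y, near0 K d' z y -> nrm (f z y) <= e.
Proof.
move=> d0 e0 [c c0 h]; have c1 : 0 < c + 1 by rewrite ltr_wpDl.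
exists (Num.min d (e / (c + 1))).
  by rewrite lt_min d0 divr_gt0//= ge_min lexx.
move=> z y [Kz]; rewrite le_min => /andP[yd ye].
rewrite (le_trans (h _ _ (conj Kz yd)))// expr1.
rewrite (@le_trans _ _ ((c + 1) * nrm y))//.
  by rewrite ler_wpM2r ?nrm_ge0// lerDl.
by rewrite mulrC -ler_pdivlMr.
Qed.

(* [A] and [B] are the first two Taylor coefficients; everything is uniform over [K]. *)
Definition jet_on K (d : R) F := exists A B,
  [/\ bigO (near0 K d) 0 (fun z _ => F z), bigO (near0 K d) 0 (fun z _ => A z),
      bigO (near0 K d) 0 (fun z _ => B z) &
      bigO (near0 K d) 3 (fun z y => F (z + y) - F z - A z * y - B z * y ^+ 2)].

Definition jet K F := exists2 d, 0 < d <= 1 & jet_on K d F.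

Lemma near0_sub K d d' : d' <= d -> forall z y, near0 K d' z y -> near0 K d z y.
Proof. by move=> dd z y [Kz yd]; split => //; exact: le_trans dd. Qed.

Lemma jet_on_sub K d d' F : d' <= d -> jet_on K d F -> jet_on K d' F.
Proof.
move=> dd [A [B [h1 h2 h3 h4]]].
by exists A, B; split; [move: h1|move: h2|move: h3|move: h4];
  apply: bigO_sub; exact: near0_sub.
Qed.

Lemma jet_on_diff K d F : d <= 1 -> jet_on K d F ->
  bigO (near0 K d) 1 (fun z y => F (z + y) - F z).
Proof.
move=> d1 [A [B [h1 h2 h3 h4]]].
have hA : bigO (near0 K d) 1 (fun z y => A z * y) := bigOM h2 (bigO_y _).
have hB : bigO (near0 K d) 1 (fun z y => B z * y ^+ 2).
  apply: (@bigO_leq _ _ (0 + (1 + 1))) => //.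
  exact: (bigOM h3 (bigOM (bigO_y _) (bigO_y _))).
have h := bigOD (bigOD (bigO_leq d1 (isT : (1 <= 3)%N) h4) hA) hB.
by apply: eq_bigO h => z y _; ring.
Qed.

Lemma jet_cst K a : jet K (fun=> a).
Proof.
exists 1; first by rewrite ltr01 lexx.
exists (fun=> 0), (fun=> 0); split; try exact: bigO_cst.
by apply: bigO_eq0 => z y; ring.
Qed.

Lemma jet_id K b : (forall z, K z -> nrm z <= b) -> jet K id.
Proof.
move=> hb; exists 1; first by rewrite ltr01 lexx.
exists (fun=> 1), (fun=> 0); split; try exact: bigO_cst.
  exists `|b| => // z y [Kz _]; rewrite expr0 mulr1.
  by rewrite (le_trans (hb _ Kz))// ler_norm.
by apply: bigO_eq0 => z y; ring.
Qed.

Lemma jet_common K F G : jet K F -> jet K G ->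
  exists2 d, 0 < d <= 1 & jet_on K d F /\ jet_on K d G.
Proof.
move=> [d /andP[d0 d1] hF] [d' /andP[d0' d1'] hG].
exists (Num.min d d'); first by rewrite lt_min d0 d0'/= ge_min d1.
by split; [apply: jet_on_sub hF|apply: jet_on_sub hG];
  rewrite ge_min lexx ?orbT.
Qed.

Lemma jetD K F G : jet K F -> jet K G -> jet K (fun z => F z + G z).
Proof.
move=> jF jG; have [d dd [[A [B [h1 h2 h3 h4]]] [A' [B' [k1 k2 k3 k4]]]]] :=
  jet_common jF jG.
exists d => //; exists (fun z => A z + A' z), (fun z => B z + B' z).
split; [exact: bigOD h1 k1|exact: bigOD h2 k2|exact: bigOD h3 k3|].
by apply: eq_bigO (bigOD h4 k4) => z y _; ring.
Qed.

Lemma jetM K F G : jet K F -> jet K G -> jet K (fun z => F z * G z).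
Proof.
move=> jF jG; have [d /andP[d0 d1] [jF' jG']] := jet_common jF jG.
move: (jF') (jG') => [A [B [h1 h2 h3 h4]]] [A' [B' [k1 k2 k3 k4]]].
exists d; first by rewrite d0.
exists (fun z => A z * G z + F z * A' z),
  (fun z => A z * A' z + F z * B' z + B z * G z).
split; first exact: (bigOM h1 k1).
- by apply: bigOD; [exact: (bigOM h2 k1)|exact: (bigOM h1 k2)].
- apply: bigOD; [apply: bigOD|]; [exact: (bigOM h2 k2)|exact: (bigOM h1 k3)|].
  exact: (bigOM h3 k1).
- have y1 := bigO_y (near0 K d).
  have dG := jet_on_diff d1 jG'.
  have t1 := bigOM h4 (bigO_leq d1 (leq0n 1) dG).
  have t2 := bigOM h4 k1.
  have t3 := bigOM h1 k4.
  have t4 := bigOM (bigOM h3 (bigOM y1 y1)) dG.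
  have t5 := bigOM (bigOM h2 y1) (bigOM k3 (bigOM y1 y1)).
  have t6 := bigO_leq d1 (isT : (3 <= 4)%N) (bigOM (bigOM h2 y1) k4).
  apply: eq_bigO (bigOD (bigOD (bigOD (bigOD (bigOD t1 t2) t3) t4) t5) t6).
  by move=> z y _; ring.
Qed.

Lemma jetN K F : jet K F -> jet K (fun z => - F z).
Proof.
move=> jF; have := jetM (jet_cst K (-1)) jF.
by congr jet; apply/funext => z; rewrite mulN1r.
Qed.

Lemma jetB K F G : jet K F -> jet K G -> jet K (fun z => F z - G z).
Proof. by move=> jF jG; exact: jetD jF (jetN jG). Qed.

(** Writing F(z + y) = F(z) (1 + a + b + c) with a, b, c of orders 1, 2, 3, the candidate expansion
    is (1 - a - b + a^2) / F(z). [d] is shrunk so that |F(z + y)| >= m / 2. *)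
Lemma jetV K F m : 0 < m -> (forall z, K z -> m <= nrm (F z)) ->
  jet K F -> jet K (fun z => (F z)^-1).
Proof.
move=> m0 hm [d0 /andP[d00 d01] jF].
have m20 : 0 < m / 2 by rewrite divr_gt0.
have [d /andP[dp dd0] hd] := bigO_lt1 d00 m20 (jet_on_diff d01 jF).
have d1 : d <= 1 := le_trans dd0 d01.
have Fy z y : near0 K d z y -> m / 2 <= nrm (F (z + y)).
  move=> i; have := hd _ _ i; have := hm _ (proj1 i).
  have := nrmB (F z) (F (z + y) - F z).
  by rewrite [F z + _]addrC subrK; lra.
have {}jF := jet_on_sub dd0 jF.
move: (jF) => [A [B [h1 h2 h3 h4]]].
have v1 : bigO (near0 K d) 0 (fun z _ => (F z)^-1).
  exists m^-1; first by rewrite invr_ge0 ltW.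
  move=> z y [Kz _]; rewrite expr0 mulr1 nrmV lef_pV2 ?hm// posrE//.
  exact: lt_le_trans (hm _ Kz).
have v2 : bigO (near0 K d) 0 (fun z y => (F (z + y))^-1).
  exists (m / 2)^-1; first by rewrite invr_ge0 ltW.
  move=> z y i; rewrite expr0 mulr1 nrmV lef_pV2 ?Fy// posrE//.
  exact: lt_le_trans (Fy _ _ i).
have y1 := bigO_y (near0 K d).
have nz z y : near0 K d z y -> (F z != 0) && (F (z + y) != 0).
  move=> i; rewrite -!nrm_gt0 (lt_le_trans m20 (Fy _ _ i)) andbT.
  by apply: lt_le_trans m0 (hm _ _); case: i.
pose a z y := A z * y / F z; pose b z y := B z * y ^+ 2 / F z.
pose c z y := (F (z + y) - F z - A z * y - B z * y ^+ 2) / F z.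
have ha : bigO (near0 K d) 1 a := bigOM (bigOM h2 y1) v1.
have hb : bigO (near0 K d) 2 b := bigOM (bigOM h3 (bigOM y1 y1)) v1.
have hc : bigO (near0 K d) 3 c := bigOM h4 v1.
exists d; first by rewrite dp.
exists (fun z => - A z / F z ^+ 2), (fun z => A z ^+ 2 / F z ^+ 3 - B z / F z ^+ 2).
split => //.
- apply: eq_bigO (bigON (bigOM h2 (bigOM v1 v1))) => z y i /=.
  by have /andP[? ?] := nz _ _ i; field.
- apply: eq_bigO (bigOB (bigOM (bigOM h2 h2) (bigOM v1 (bigOM v1 v1)))
     (bigOM h3 (bigOM v1 v1))) => z y i /=.
  by have /andP[? ?] := nz _ _ i; field.
- have a0 := bigO_leq d1 (leq0n 1) ha.
  have b0 := bigO_leq d1 (leq0n 2) hb.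
  (* These are the terms of 1 - (1 + a + b + c)(1 - a - b + a^2) = 2ab - a^3 - a^2 b + b^2 - c(1 - a
     - b + a^2), all of order at least 3. *)
  have t1 := bigOM ha (bigOM ha ha).
  have t2 := bigOM ha hb.
  have t3 := bigO_leq d1 (isT : (3 <= 4)%N) (bigOM ha t2).
  have t4 := bigO_leq d1 (isT : (3 <= 4)%N) (bigOM hb hb).
  have t5 := bigOM hc (bigOD (bigOB (bigOB (bigO_cst _ 1) a0) b0) (bigOM a0 a0)).
  apply: eq_bigO (bigOM v2 (bigON (bigOD (bigOD (bigOB (bigOD t1 t3) t4)
     (bigOD (bigON t2) (bigON t2))) t5))) => z y i.
  rewrite /a /b /c.
  by have /andP[? ?] := nz _ _ i; field; apply/andP.
Qed.

(** No regularity of the branch is assumed. Both real parts are nonnegative and that of G(z) is at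
    least m, so G(z + y) + G(z) is invertible and G(z + y) - G(z) = (F(z + y) - F(z)) / (G(z + y) +
    G(z)) is O(y); feeding this back raises the order. The sign condition is global because z + y
    may leave [K]. *)
Lemma jet_sqrt K F G m : 0 < m -> (forall z, K z -> m <= cRe (G z)) ->
  (forall z, 0 <= cRe (G z)) -> (forall z, G z ^+ 2 = F z) ->
  jet K F -> jet K G.
Proof.
move=> m0 hm hG sqG [d /andP[dp d1] jF].
move: (jF) => [A [B [h1 h2 h3 h4]]].
have sumge z y : near0 K d z y -> m <= nrm (G (z + y) + G z).
  move=> [Kz _]; apply: le_trans (normRe_le_nrm _).
  apply: le_trans (ler_norm _).
  have := hm _ Kz; have := hG (z + y).
  case: (G (z + y)) => p q; case: (G z) => p' q' /=; lra.
have Gge z : K z -> m <= nrm (G z).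
  move=> Kz; apply: le_trans (normRe_le_nrm _); apply: le_trans (ler_norm _).
  exact: hm.
have G0 : bigO (near0 K d) 0 (fun z _ => G z).
  move: h1 => [c c0 h]; exists (c + 1); first by rewrite addr_ge0.
  move=> z y i; have := h z y i; rewrite expr0 !mulr1 -sqG nrmX.
  move: (nrm (G z)) (nrm_ge0 (G z)) => g g0 hh; nra.
have v1 : bigO (near0 K d) 0 (fun z _ => (G z)^-1).
  exists m^-1; first by rewrite invr_ge0 ltW.
  move=> z y [Kz _]; rewrite expr0 mulr1 nrmV lef_pV2 ?Gge// posrE//.
  exact: lt_le_trans (Gge _ Kz).
have vs : bigO (near0 K d) 0 (fun z y => (G (z + y) + G z)^-1).
  exists m^-1; first by rewrite invr_ge0 ltW.
  move=> z y i; rewrite expr0 mulr1 nrmV lef_pV2 ?sumge// posrE//.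
  exact: lt_le_trans (sumge _ _ i).
have y1 := bigO_y (near0 K d).
have nz z y : near0 K d z y -> (G z != 0) /\ (G (z + y) + G z != 0).
  move=> i; split; rewrite -nrm_gt0; apply: lt_le_trans m0 _.
    by apply: Gge; case: i.
  exact: sumge.
have D1 : bigO (near0 K d) 1 (fun z y => G (z + y) - G z).
  apply: eq_bigO (bigOM (jet_on_diff d1 jF) vs) => z y i /=.
  by rewrite -!sqG; have [_ ?] := nz _ _ i; field.
pose r z y := F (z + y) - F z - A z * y - B z * y ^+ 2.
(* 2 G(z) d = F(z+y) - F(z) - d^2 with d = G(z+y) - G(z) *)
have D2 : bigO (near0 K d) 2 (fun z y => G (z + y) - G z - A z * y / (2 * G z)).
  have r2 := bigO_leq d1 (isT : (2 <= 3)%N) h4.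
  apply: eq_bigO (bigOM (bigOM (bigOB (bigOD r2 (bigOM h3 (bigOM y1 y1)))
    (bigOM D1 D1)) v1) (bigO_cst _ (2^-1))) => z y i /=.
  by rewrite -!sqG; have [? _] := nz _ _ i; field.
exists d; first by rewrite dp.
exists (fun z => A z / (2 * G z)), (fun z => B z / (2 * G z) - A z ^+ 2 / (8 * G z ^+ 3)).
split => //.
- apply: eq_bigO (bigOM (bigOM h2 v1) (bigO_cst _ (2^-1))) => z y i /=.
  by have [? _] := nz _ _ i; field.
- apply: eq_bigO (bigOB (bigOM (bigOM h3 v1) (bigO_cst _ (2^-1)))
    (bigOM (bigOM (bigOM h2 h2) (bigOM v1 (bigOM v1 v1))) (bigO_cst _ (8^-1)))) => z y i /=.
  by have [? _] := nz _ _ i; field.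
- have hA := bigOM (bigOM h2 y1) (bigOM v1 (bigO_cst _ (2^-1))).
  have t := bigOM D2 (bigOD D1 hA).
  apply: eq_bigO (bigOM (bigOM (bigOB h4 t) v1) (bigO_cst _ (2^-1))) => z y i /=.
  by rewrite -!sqG; have [? _] := nz _ _ i; field.
Qed.

End Jets.

(** * Four-point sums of the argument of a holomorphic function *)

Section Arg.
Context {R : realType}.
Implicit Types (K : set R[i]) (F A B : R[i] -> R[i]).

Lemma atan_cubic (t : R) : `|atan t - t| <= `|t| ^+ 3.
Proof.
wlog t0 : t / 0 <= t.
  move=> wl; have [|t0] := leP 0 t; first exact: wl.
  have := wl (- t); rewrite atanN -opprD !normrN; apply.
  by rewrite oppr_ge0 ltW.
have /(MVT_segment t0) : forall x : R, x \in `]0, t[ ->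
    is_derive x 1 atan (1 + x ^+ 2)^-1.
  by move=> x _; exact: is_derive1_atan.
case.
  by apply: continuous_subspaceT => x; exact: continuous_atan.
move=> c; rewrite in_itv/= => /andP[c0 ct]; rewrite atan0 !subr0 => ->.
have e : (1 + c ^+ 2)^-1 * t - t = - (t * c ^+ 2 / (1 + c ^+ 2)).
  by field; rewrite gt_eqF// ltr_wpDr ?sqr_ge0.
rewrite e normrN [`|t|]ger0_norm// ger0_norm.
  rewrite ler_pdivrMr ?ltr_wpDr ?sqr_ge0//.
  have : c ^+ 2 <= t ^+ 2 by rewrite ler_sqr// nnegrE.
  have := sqr_ge0 c; have t3 : 0 <= t ^+ 3 by rewrite exprn_ge0.
  have -> : t ^+ 3 * (1 + c ^+ 2) = t * t ^+ 2 + t ^+ 3 * c ^+ 2 by ring.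
  move: (c ^+ 2) (t ^+ 2) (t ^+ 3) t3 => u v w; nra.
by rewrite divr_ge0 ?mulr_ge0 ?addr_ge0 ?sqr_ge0.
Qed.

Lemma sin_atan_cos (x : R) : sin (atan x) = x * cos (atan x).
Proof.
have c0 : 0 < cos (atan x).
  by apply: cos_gt0_pihalf; rewrite atan_gtNpi2 atan_ltpi2.
have : tan (atan x) = x := atanK x.
by rewrite /tan => /(congr1 ( *%R^~ (cos (atan x)))); rewrite divfK// gt_eqF.
Qed.

Lemma cos_atan_gt0 (x : R) : 0 < cos (atan x).
Proof. by apply: cos_gt0_pihalf; rewrite atan_gtNpi2 atan_ltpi2. Qed.

Lemma cos_gt0_lt_pihalf (x : R) : - pi < x < pi -> 0 < cos x -> - (pi / 2) < x < pi / 2.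
Proof.
wlog x0 : x / 0 <= x.
  move=> wl; have [|x0] := leP 0 x; first exact: wl.
  move=> h c; have := wl (- x); rewrite cosN; case/(_ _ _ _)/andP => //.
  - by rewrite oppr_ge0 ltW.
  - by rewrite ltrN2 ltrNl andbC.
  - by move=> h1 h2; rewrite ltrNl h2/= -ltrN2.
move=> /andP[_ xpi] c; have p0 := pi_gt0 R; apply/andP; split; first lra.
rewrite -ltr_cos ?cos_pihalf ?in_itv/=//; apply/andP; lra.
Qed.

(** The difference of two arctangents lies in (-pi, pi) and its cosine is positive here, so it lies
    in (-pi/2, pi/2), where [atan] inverts [tan]. *)
Lemma atan_argM (p q s t : R) : 0 < p -> 0 < s -> 0 < s * p - t * q ->
  atan ((s * q + t * p) / (s * p - t * q)) - atan (q / p) = atan (t / s).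
Proof.
move=> p0 s0 h; set X' := _ / (_ - _); set X := q / p.
set th := _ - _.
have cc : cos th = cos (atan X') * cos (atan X) * (1 + X * X').
  by rewrite /th cosB !sin_atan_cos; ring.
have ss : sin th = cos (atan X') * cos (atan X) * (X' - X).
  by rewrite /th sinB !sin_atan_cos; ring.
have p2 : 0 < p ^+ 2 + q ^+ 2 by rewrite ltr_wpDr ?sqr_ge0 ?exprn_gt0.
have XX : 1 + X * X' = s * (p ^+ 2 + q ^+ 2) / (p * (s * p - t * q)).
  by rewrite /X /X'; field; rewrite !gt_eqF.
have XB : X' - X = t * (p ^+ 2 + q ^+ 2) / (p * (s * p - t * q)).
  by rewrite /X /X'; field; rewrite !gt_eqF.
have c1 := cos_atan_gt0 X; have c2 := cos_atan_gt0 X'.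
have cth : 0 < cos th.
  rewrite cc XX; apply: mulr_gt0; first exact: mulr_gt0.
  by rewrite divr_gt0 ?mulr_gt0.
have thI : - (pi / 2) < th < pi / 2.
  apply: cos_gt0_lt_pihalf => //.
  have := atan_gtNpi2 X; have := atan_gtNpi2 X'.
  have := atan_ltpi2 X; have := atan_ltpi2 X'.
  rewrite -/th /th; move: (atan X) (atan X') => a b *; apply/andP; lra.
rewrite -(@tanK _ th) ?in_itv//; congr atan.
rewrite /tan ss cc XX XB; field.
by rewrite !gt_eqF.
Qed.

(** The principal argument on the right half-plane, the only region where it is used as such. *)
Definition argr (F : R[i]) := atan (cIm F / cRe F).

Lemma argrM (F G : R[i]) : 0 < cRe F -> 0 < cRe G -> 0 < cRe (F * G) ->
  argr (F * G) - argr G = argr F.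
Proof. by case: F => s t; case: G => p q /= s0 p0 h; exact: atan_argM. Qed.

(** Im(x - x^2 / 2) is the imaginary part of the logarithm truncated after second order. With x = a
    + i b and t = b / (1 + a), the errors are at most 8 |x|^3 for atan t - t and 2 |x|^3 for t - (b
    - a b). *)
Lemma argr1D_approx (x : R[i]) : nrm x <= 2^-1 ->
  `|argr (1 + x) - cIm (x - x ^+ 2 / 2)| <= 12 * nrm x ^+ 3.
Proof.
move=> x2; have hr := normRe_le_nrm x; have hi := normIm_le_nrm x.
have n0 := nrm_ge0 x.
have -> : cIm (x - x ^+ 2 / 2) = cIm x - cRe x * cIm x.
  have -> : x ^+ 2 / 2 = x ^+ 2 * (2^-1)%:C%C by rewrite fmorphV/= rmorph_nat.
  by case: x {x2 hr hi n0} => a b; rewrite expr2; simpc => /=; field.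
have -> : argr (1 + x) = atan (cIm x / (1 + cRe x)).
  by case: x {x2 hr hi n0} => a b; rewrite /argr /= add0r.
move: (cRe x) (cIm x) (nrm x) hr hi n0 x2 => a b n ha hb n0 n2.
have a1 : 2^-1 <= 1 + a by move: ha; rewrite ler_norml => /andP[? _]; lra.
have a0 : 0 < 1 + a by lra.
set t := b / (1 + a).
have tb : `|t| <= 2 * n.
  rewrite /t normrM normfV (gtr0_norm a0) ler_pdivrMr//.
  by rewrite (le_trans hb)//; nra.
have t3 : `|t| ^+ 3 <= 8 * n ^+ 3.
  rewrite (_ : 8 * n ^+ 3 = (2 * n) ^+ 3); last by ring.
  by rewrite lerXn2r// nnegrE mulr_ge0.
have e : t - (b - a * b) = b * a ^+ 2 / (1 + a) by rewrite /t; field; rewrite gt_eqF.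
have t4 : `|t - (b - a * b)| <= 2 * n ^+ 3.
  rewrite e normrM normfV (gtr0_norm a0) ler_pdivrMr// normrM normrX.
  have : `|b| * `|a| ^+ 2 <= n * n ^+ 2.
    by rewrite ler_pM ?normr_ge0 ?exprn_ge0// lerXn2r// nnegrE.
  rewrite -exprS; have := exprn_ge0 3 n0.
  move: (`|b| * _) (n ^+ 3) => u v; nra.
have -> : atan t - (b - a * b) = (atan t - t) + (t - (b - a * b)) by ring.
rewrite (le_trans (ler_normD _ _))//.
have := le_trans (atan_cubic t) t3; have := exprn_ge0 3 n0; lra.
Qed.

(* The four points z + i^k y: averaging over them annihilates the first- and
   second-order terms of a complex Taylor expansion. *)
Definition sum4 (g : R[i] -> R) (z y : R[i]) :=
  g (z + y) + g (z + 'i%C * y) + g (z - y) + g (z - 'i%C * y).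

(** By multiplicativity g(z + y) - g(z) is the argument of 1 + x with x = F(z + y) / F(z) - 1, that
    is, Im(P y + Q y^2) up to O(|y|^3), and this sums to 0 over y, i y, -y, -i y. Off the right
    half-plane [g] is only bounded, which leaves its value free at zeros of [slitD]. *)
Lemma jet_argr_sum4 K F m (g : R[i] -> R) : 0 < m ->
  (forall z, K z -> m <= cRe (F z)) -> jet K F ->
  (forall z, `|g z| <= pi / 2) -> (forall z, 0 < cRe (F z) -> g z = argr (F z)) ->
  exists2 C, 0 <= C & forall z y, K z ->
    `|sum4 g z y - 4 * g z| <= C * nrm y ^+ 3.
Proof.
move=> + + + gb gF; move=> m0 hm [d0 /andP[d00 d01] jF0].
have nge z : K z -> m <= nrm (F z).
  move=> Kz; apply: le_trans (normRe_le_nrm _); apply: le_trans (ler_norm _).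
  exact: hm.
have m20 : 0 < m / 2 by lra.
have [d /andP[dp dd0] hd] := bigO_lt1 d00 m20 (jet_on_diff d01 jF0).
have d1 : d <= 1 := le_trans dd0 d01.
have jF := jet_on_sub dd0 jF0.
have RFy z y : near0 K d z y -> m / 2 <= cRe (F (z + y)).
  move=> i; have := hd _ _ i; have := hm _ (proj1 i).
  have := normRe_le_nrm (F (z + y) - F z).
  case: (F (z + y)) => p q; case: (F z) => p' q' /= + h1 /(le_trans _) h2.
  by move=> /h2; rewrite ler_norml => /andP[? _]; lra.
move: (jF) => [A [B [h1 h2 h3 h4]]].
have v1 : bigO (near0 K d) 0 (fun z _ => (F z)^-1).
  exists m^-1; first by rewrite invr_ge0 ltW.
  move=> z y [Kz _]; rewrite expr0 mulr1 nrmV lef_pV2 ?nge// posrE//.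
  exact: lt_le_trans (nge _ Kz).
pose x z y := F (z + y) / F z - 1.
have nz z : K z -> F z != 0.
  by move=> Kz; rewrite -nrm_gt0 (lt_le_trans m0)// nge.
have x1 : bigO (near0 K d) 1 x.
  apply: eq_bigO (bigOM (jet_on_diff d1 jF) v1) => z y [Kz _] /=.
  by rewrite mulrBl divff ?nz.
have h20 : (0 : R) < 2^-1 by [].
have [e /andP[ep ed] hx] := bigO_lt1 dp h20 x1.
pose P z := A z / F z; pose Q z := B z / F z - (A z / F z) ^+ 2 / 2.
have xx : bigO (near0 K d) 3 (fun z y => x z y - x z y ^+ 2 / 2 - P z * y - Q z * y ^+ 2).
  have y1 := bigO_y (near0 K d).
  have hA := bigOM (bigOM h2 y1) v1.
  have x2 : bigO (near0 K d) 2 (fun z y => x z y - P z * y).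
    have r2 := bigO_leq d1 (isT : (2 <= 3)%N) h4.
    apply: eq_bigO (bigOM (bigOD r2 (bigOM h3 (bigOM y1 y1))) v1) => z y [Kz _] /=.
    by rewrite /x /P; field; exact: nz.
  have t := bigOM (bigOM x2 (bigOD x1 hA)) (bigO_cst _ (2^-1)).
  apply: eq_bigO (bigOB (bigOM h4 v1) t) => z y [Kz _] /=.
  by rewrite /x /P /Q; field; exact: nz.
have [cx cx0 hcx] := x1; have [cr cr0 hcr] := xx.
pose C1 := 12 * cx ^+ 3 + cr.
have C10 : 0 <= C1 by rewrite addr_ge0// mulr_ge0// exprn_ge0.
have key z y : near0 K e z y ->
  `|g (z + y) - g z - cIm (P z * y + Q z * y ^+ 2)| <= C1 * nrm y ^+ 3.
  move=> i; have id := near0_sub ed i; have [Kz ye] := i.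
  have xs := hx _ _ i.
  have F1 : F (z + y) = (1 + x z y) * F z by rewrite /x addrCA subrr addr0 divfK// nz.
  have r1 : 0 < cRe (1 + x z y).
    have := normRe_le_nrm (x z y); move: xs; case: (x z y) => a b /= hn /le_trans.
    by move=> /(_ _ hn); rewrite ler_norml => /andP[? _]; lra.
  have r2 : 0 < cRe (F z) := lt_le_trans m0 (hm _ Kz).
  have r3 : 0 < cRe ((1 + x z y) * F z).
    by rewrite -F1; apply: lt_le_trans (RFy _ _ id).
  rewrite (gF (z + y)) ?F1// (gF z)// argrM//.
  have -> : P z * y + Q z * y ^+ 2 = (x z y - x z y ^+ 2 / 2)
      - (x z y - x z y ^+ 2 / 2 - P z * y - Q z * y ^+ 2) by ring.
  rewrite raddfB/= opprB addrCA addrC.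
  rewrite (le_trans (ler_normD _ _))// /C1 [leRHS]mulrDl lerD//.
    rewrite (le_trans (argr1D_approx xs))// -mulrA ler_pM2l//.
    by rewrite -exprMn lerXn2r ?nnegrE ?mulr_ge0 ?nrm_ge0// -[nrm y]expr1 hcx.
  by rewrite (le_trans (normIm_le_nrm _))// hcr.
(* The first term serves |y| <= e; beyond, the left side is at most 8 (pi / 2) = 4 pi by the bound
   on [g]. *)
pose C2 := 4 * C1 + 4 * pi / e ^+ 3.
have pi0 := pi_ge0 R.
have e3 : 0 < e ^+ 3 by rewrite exprn_gt0.
have C3 : 0 <= 4 * pi / e ^+ 3 by rewrite divr_ge0 ?mulr_ge0// ltW.
exists C2; first by rewrite addr_ge0// mulr_ge0.
move=> z y Kz; have y30 : 0 <= nrm y ^+ 3 by rewrite exprn_ge0// nrm_ge0.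
rewrite /sum4.
have ni : nrm ('i%C * y) = nrm y.
  by rewrite nrmM /= expr0n expr1n/= add0r sqrtr1 mul1r.
have [ye|ye] := leP (nrm y) e; last first.
  have b : `|g (z + y) + g (z + 'i%C * y) + g (z - y) + g (z - 'i%C * y) - 4 * g z| <= 4 * pi.
    move: (gb (z + y)) (gb (z + 'i%C * y)) (gb (z - y)) (gb (z - 'i%C * y)) (gb z).
    by rewrite !ler_norml => /andP[? ?] /andP[? ?] /andP[? ?] /andP[? ?] /andP[? ?];
       apply/andP; lra.
  rewrite (le_trans b)// /C2 [leRHS]mulrDl ler_wpDl//.
    by rewrite mulr_ge0// mulr_ge0.
  rewrite (mulrAC (4 * pi)) ler_pdivlMr// ler_wpM2l ?mulr_ge0// lerXn2r ?nnegrE//.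
  - exact: ltW.
  - exact: nrm_ge0.
  - exact: ltW.
have k1 := key z y (conj Kz ye).
have k2 := key z ('i%C * y) (conj Kz (eq_ind_r (fun t => t <= e) ye ni)).
have k3 := key z (- y) (conj Kz (eq_ind_r (fun t => t <= e) ye (nrmN y))).
have k4 : `|g (z - 'i%C * y) - g z - cIm (P z * - ('i%C * y) + Q z * (- ('i%C * y)) ^+ 2)| <= C1 * nrm (- ('i%C * y)) ^+ 3.
  by apply: key; split => //; rewrite nrmN ni.
rewrite nrmN ni in k4; rewrite ni in k2; rewrite nrmN in k3.
have s0 : cIm (P z * y + Q z * y ^+ 2) +
  cIm (P z * ('i%C * y) + Q z * ('i%C * y) ^+ 2) + cIm (P z * - y + Q z * (- y) ^+ 2) +
  cIm (P z * - ('i%C * y) + Q z * (- ('i%C * y)) ^+ 2) = 0.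
  rewrite -!raddfD/= (_ : _ + _ = 0) ?raddf0//.
  have i2 : ('i%C : R[i]) ^+ 2 = -1 := sqr_i R.
  by rewrite !sqrrN !exprMn i2; ring.
rewrite (@le_trans _ _ (4 * C1 * nrm y ^+ 3))//; last first.
  by rewrite ler_wpM2r// lerDl.
move: s0 k1 k2 k3 k4; move: (cIm _) (cIm _) (cIm _) (cIm _) => i1 i2 i3 i4 s0.
rewrite -!mulrA !ler_norml => /andP[? ?] /andP[? ?] /andP[? ?] /andP[? ?].
by apply/andP; lra.
Qed.

End Arg.

(** * The harmonic measure of the slit *)

Section SlitDisk.
Context {R : realType} (r : R).
Hypothesis r01 : 0 < r < 1.
Implicit Types z : R[i].

(* [w] below satisfies w^2 = r / (1 + r)^2 - z / (1 + z)^2 and, by the Koebe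
   function, maps the unit disk slit along [r, 1) onto the right half-plane: the
   slit goes to |w| <= a and the circle to |w| >= a on the imaginary axis.  The
   Moebius map [F] sends these to the two halves of the imaginary axis, so that
   1/2 + arg F / pi is the harmonic measure of the slit.  [slitD] and [slitN] are
   positive multiples of Re w and |w|^2 - a^2, free of the singularity at
   z = - 1; at [slitD] = 0 the value of [slit_harm] is junk. *)
Definition slitQ z : R[i] := (r%:C%C - z) * (1 - r%:C%C * z).
Definition slitP z : R[i] := slitQ z * (1 + z^*%C) ^+ 2.
Definition slitD z : R := Num.sqrt ((nrm (slitP z) + cRe (slitP z)) / 2).
Definition slitN z : R := nrm (slitQ z) - (1 - r) ^+ 2 / 4 * nrm (1 + z) ^+ 2.
Definition slit_harm z : R := 2^-1 - atan (slitN z / ((1 - r) * slitD z)) / pi.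

Let w z := sqrtc (slitQ z / ((1 + r)%:C%C * (1 + z)) ^+ 2).
Let a := (1 - r) / (2 * (1 + r)).
Let F z := (a%:C%C - 'i%C * w z) / (w z - 'i%C * a%:C%C).

Let r0 : 0 < r. Proof. by case/andP: r01. Qed.
Let r1 : 0 < 1 - r. Proof. by case/andP: r01 => _ ?; rewrite subr_gt0. Qed.
Let r1p : 0 < 1 + r. Proof. by move: r0; lra. Qed.
Let a0 : 0 < a. Proof. by rewrite divr_gt0// mulr_gt0. Qed.

Lemma nrm_real (x : R) : nrm x%:C%C = `|x|.
Proof. by rewrite /= expr0n addr0 sqrtr_sqr. Qed.

Lemma nrm_sqr (z : R[i]) : nrm z ^+ 2 = cRe z ^+ 2 + cIm z ^+ 2.
Proof. by case: z => x y /=; rewrite sqr_sqrtr// addr_ge0 ?sqr_ge0. Qed.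

Lemma mulcJ (z : R[i]) : z * z^*%C = (nrm z ^+ 2)%:C%C.
Proof.
by rewrite nrm_sqr; case: z => x y; simpc => /=; congr Complex; ring.
Qed.

Lemma nrmJ (z : R[i]) : nrm z^*%C = nrm z.
Proof. by case: z => x y /=; rewrite sqrrN. Qed.

Lemma sqrtc_Re (z : R[i]) : cRe (sqrtc z) = Num.sqrt ((nrm z + cRe z) / 2).
Proof. by case: z. Qed.

Lemma slit_wRe_ge0 z : 0 <= cRe (w z).
Proof. by rewrite /w sqrtc_Re sqrtr_ge0. Qed.

Lemma nrm_Re_scale (k : R) (z : R[i]) : 0 <= k ->
  nrm (k%:C%C * z) + cRe (k%:C%C * z) = k * (nrm z + cRe z).
Proof.
by move=> k0; rewrite nrmM nrm_real ger0_norm//; case: z => x y /=; ring.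
Qed.

(** The radicand of [w] is k^2 [slitP z] with k > 0, because 1 / (1 + z) is conj(1 + z) / |1 + z|^2;
    the real part of the root scales by k. *)
Lemma slit_wRe z : 1 + z != 0 ->
  cRe (w z) = slitD z / ((1 + r) * nrm (1 + z) ^+ 2).
Proof.
move=> z1; have n0 : 0 < nrm (1 + z) by rewrite nrm_gt0.
pose k := ((1 + r) * nrm (1 + z) ^+ 2)^-1.
have k0 : 0 < k by rewrite invr_gt0 mulr_gt0// exprn_gt0.
have e : slitQ z / ((1 + r)%:C%C * (1 + z)) ^+ 2 = (k ^+ 2)%:C%C * slitP z.
  have -> : slitP z = slitQ z * ((nrm (1 + z) ^+ 2)%:C%C / (1 + z)) ^+ 2.
    rewrite /slitP -mulcJ; congr (_ * _ ^+ 2).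
    rewrite mulrAC divff// mul1r rmorphD rmorph1 //.
  rewrite /k rmorphXn/= fmorphV/= !rmorphM/=.
  field; rewrite -!nrm_gt0 nrm_real gtr0_norm// n0/=.
  by rewrite sqrtr_gt0 ltr_pwDl ?exprn_gt0// sqr_ge0.
rewrite /w e sqrtc_Re nrm_Re_scale ?sqr_ge0// -mulrA sqrtrM ?sqr_ge0//.
by rewrite sqrtr_sqr gtr0_norm// mulrC.
Qed.

Lemma slit_w_sqr z : nrm (w z) ^+ 2 = nrm (slitQ z) / ((1 + r) * nrm (1 + z)) ^+ 2.
Proof.
by rewrite -nrmX /w sqr_sqrtc nrmM nrmV nrmX nrmM nrm_real gtr0_norm.
Qed.

(** (a - i w) conj(w - i a) = 2 a Re w - i (|w|^2 - a^2): [F] maps the right half-plane to itself,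
    and the sign of its imaginary part tells |w| < a from |w| > a. *)
Lemma slit_F_Re z : cRe (F z) = 2 * a * cRe (w z) / nrm (w z - 'i%C * a%:C%C) ^+ 2.
Proof.
rewrite nrm_sqr /F; case: (w z) => s t; simpc => /=.
by ring.
Qed.

Lemma slit_F_Im z : cIm (F z) = - (nrm (w z) ^+ 2 - a ^+ 2) / nrm (w z - 'i%C * a%:C%C) ^+ 2.
Proof.
rewrite !nrm_sqr /F; case: (w z) => s t; simpc => /=.
by ring.
Qed.

Lemma slit_den z : 0 < cRe (w z) -> 0 < nrm (w z - 'i%C * a%:C%C).
Proof.
move=> s0; rewrite nrm_gt0; apply: contraTneq s0.
by case: (w z) => s t; simpc; move=> [-> _]; rewrite ltxx.
Qed.

Lemma slit_F_gt0 z : (0 < cRe (F z)) = (0 < cRe (w z)).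
Proof.
apply/idP/idP => [|s0].
  rewrite !lt0r slit_wRe_ge0 andbT => /andP[+ _]; apply: contraNneq => s0.
  by rewrite slit_F_Re s0 mulr0 mul0r.
have p2 : 0 < 2 * a by rewrite mulr_gt0.
rewrite slit_F_Re; apply: divr_gt0; first exact: mulr_gt0.
by rewrite exprn_gt0// slit_den.
Qed.

(** Turns a lower bound on [slitD] into one on the distance to -1, the pole of the Koebe
    function. *)
Lemma slitD_bound z : nrm z <= 2 -> slitD z <= 3 * nrm (1 + z).
Proof.
move=> z2; have nz := nrm_ge0 z; have [r0' r1'] := (ltW r0, ltW r1).
have n1 : nrm (1 + z) <= 3 by have := nrmD 1 z; rewrite Normc.normc1; lra.
have b1 : nrm (r%:C%C - z) <= 3.
  have := nrmD r%:C%C (- z); rewrite nrmN nrm_real ger0_norm//.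
  move: r1; lra.
have b2 : nrm (1 - r%:C%C * z) <= 3.
  have := nrmD 1 (- (r%:C%C * z)); rewrite nrmN nrmM nrm_real ger0_norm// Normc.normc1.
  move: r1; nra.
have n0 := nrm_ge0 (1 + z).
have P9 : nrm (slitP z) <= (3 * nrm (1 + z)) ^+ 2.
  rewrite /slitP /slitQ !(nrmM, nrmX).
  have -> : 1 + z^*%C = (1 + z)^*%C by rewrite rmorphD rmorph1.
  rewrite nrmJ exprMn ler_wpM2r ?exprn_ge0//.
  rewrite (_ : 3 ^+ 2 = 3 * 3); last by ring.
  by rewrite ler_pM ?nrm_ge0.
rewrite /slitD -[leRHS]ger0_norm ?mulr_ge0// -sqrtr_sqr ler_wsqrtr//.
have := normRe_le_nrm (slitP z); rewrite ler_norml => /andP[_ h].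
lra.
Qed.

(** Im F / Re F is -(|w|^2 - a^2) / (2 a Re w), where the positive factors hidden in [slitN] and
    [slitD] cancel. *)
Lemma slit_harm_argr z : 0 < slitD z -> nrm (1 + z) != 0 ->
  argr (F z) = (slit_harm z - 2^-1) * pi.
Proof.
move=> D0 n0.
have z1 : 1 + z != 0 by rewrite -nrm_gt0 lt0r n0 nrm_ge0.
have np : 0 < nrm (1 + z) by rewrite nrm_gt0.
have s0 : 0 < cRe (w z) by rewrite slit_wRe// divr_gt0// mulr_gt0// exprn_gt0.
rewrite /slit_harm addrAC subrr add0r mulNr divfK ?gt_eqF ?pi_gt0// -atanN.
rewrite /argr slit_F_Re slit_F_Im slit_w_sqr slit_wRe//; congr atan.
have den := slit_den s0.
rewrite /slitN; move: (nrm (_ - _)) den => v den; rewrite /a; field.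
by rewrite !gt_eqF// exprn_gt0.
Qed.

Lemma slitD_ge0 z : 0 <= slitD z. Proof. exact: sqrtr_ge0. Qed.

Lemma slit_wD z : 0 < cRe (w z) -> 0 < slitD z /\ nrm (1 + z) != 0.
Proof.
have [z1|z1] := eqVneq (1 + z) 0.
  by rewrite /w z1 mulr0 expr0n invr0 mulr0 sqrtc0 ltxx.
have n0 : 0 < nrm (1 + z) by rewrite nrm_gt0.
rewrite slit_wRe// pmulr_lgt0; first by rewrite gt_eqF.
by rewrite invr_gt0 mulr_gt0// exprn_gt0.
Qed.

(** On [K] all denominators met on the way from z to [F] are bounded away from 0, as is Re w, so the
    expansion passes through quotient, square root and Moebius map, and Re F keeps a positive lower
    bound. *)
Lemma slit_sum4 (g : R[i] -> R) (e : R) : 0 < e ->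
  (forall z, `|g z| <= pi / 2) ->
  (forall z, 0 < slitD z -> g z = (slit_harm z - 2^-1) * pi) ->
  exists2 C, 0 <= C & forall z y, nrm z <= 2 -> e <= slitD z ->
    `|sum4 g z y - 4 * g z| <= C * nrm y ^+ 3.
Proof.
move=> e0 gb gD; pose K : set R[i] := [set z | nrm z <= 2 /\ e <= slitD z].
have Kn z : K z -> e / 3 <= nrm (1 + z).
  by move=> [/slitD_bound h1 h2]; rewrite ler_pdivrMr// mulrC (le_trans h2).
have e30 : 0 < e / 3 by rewrite divr_gt0.
have z1 z : K z -> 1 + z != 0.
  by move=> /Kn h; rewrite -nrm_gt0 (lt_le_trans e30).
(* 18 is a bound for (1 + r) |1 + z|^2, as r < 1 and |1 + z| <= 3. *)
have Kw z : K z -> e / 18 <= cRe (w z).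
  move=> Kz; have h := Kn _ Kz; rewrite slit_wRe ?z1//.
  have n0 : 0 < nrm (1 + z) by rewrite nrm_gt0 z1.
  case: Kz => z2 De; rewrite ler_pdivlMr ?mulr_gt0 ?exprn_gt0//.
  apply: le_trans De; rewrite mulrAC ler_pdivrMr// ler_wpM2l//; first exact: ltW.
  have n3 : nrm (1 + z) <= 3 by have := nrmD 1 z; rewrite Normc.normc1; lra.
  have r12 : 1 + r <= 2 by move: r1; lra.
  have : nrm (1 + z) ^+ 2 <= 9 by rewrite (_ : 9 = 3 ^+ 2) ?lerXn2r ?nnegrE ?nrm_ge0//; ring.
  have := sqr_ge0 (nrm (1 + z)); move: r1p; nra.
have e180 : 0 < e / 18 by rewrite divr_gt0.
have jid : jet K id by apply: (@jet_id _ _ 2) => z [].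
have jQ : jet K slitQ.
  apply: jetM; first exact: jetB (jet_cst _ _) jid.
  exact: jetB (jet_cst _ _) (jetM (jet_cst _ _) jid).
have jden : jet K (fun z => ((1 + r)%:C%C * (1 + z)) ^+ 2).
  have j1 : jet K (fun z => (1 + r)%:C%C * (1 + z)).
    by apply: jetM; [exact: jet_cst|apply: jetD => //; exact: jet_cst].
  exact: (jetM j1 j1).
have jq : jet K (fun z => slitQ z / ((1 + r)%:C%C * (1 + z)) ^+ 2).
  apply: jetM => //; apply: (@jetV _ _ _ ((e / 3) ^+ 2)) => //.
    by rewrite exprn_gt0.
  move=> z Kz; rewrite nrmX lerXn2r ?nnegrE ?nrm_ge0 1?ltW//.
  rewrite nrmM nrm_real gtr0_norm//.
  have := Kn _ Kz; move: r0; nra.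
have jw : jet K w.
  apply: (@jet_sqrt _ _ _ _ _ e180 Kw _ _ jq) => z; first exact: slit_wRe_ge0.
  by rewrite /w sqr_sqrtc.
have jwa : jet K (fun z => w z - 'i%C * a%:C%C) by apply: jetB => //; exact: jet_cst.
have jF : jet K F.
  apply: jetM.
    apply: jetB; first exact: jet_cst.
    by apply: jetM => //; exact: jet_cst.
  apply: (@jetV _ _ _ (e / 18)) => // z Kz.
  apply: le_trans (Kw _ Kz) _; apply: le_trans (ler_norm _) _.
  apply: le_trans (normRe_le_nrm _).
  by case: (w z) => s t; simpc => /=.
have [c c0 hc] : exists2 c, 0 < c & forall z, K z -> nrm (w z - 'i%C * a%:C%C) <= c.
  case: jwa => d /andP[d0 _] [A [B [[c c0 hc] _ _ _]]].
  exists (c + 1); first by rewrite ltr_wpDl.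
  move=> z Kz; have := hc z 0 (conj Kz _); rewrite expr0 mulr1 Normc.normc0.
  by move=> /(_ (ltW d0)); lra.
have p2 : 0 < 2 * a by rewrite mulr_gt0.
have m0 : 0 < 2 * a * (e / 18) / c ^+ 2.
  by apply: divr_gt0; rewrite ?exprn_gt0//; exact: mulr_gt0.
have KF z : K z -> 2 * a * (e / 18) / c ^+ 2 <= cRe (F z).
  move=> Kz; rewrite slit_F_Re.
  have s0 := lt_le_trans e180 (Kw _ Kz); have dp := slit_den s0.
  rewrite ler_pM//.
  - by rewrite ltW//; exact: mulr_gt0.
  - by rewrite invr_ge0 exprn_ge0// ltW.
  - by rewrite ler_wpM2l ?Kw// ltW.
  - rewrite lef_pV2 ?posrE ?exprn_gt0// lerXn2r ?nnegrE ?hc//; exact: ltW.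
have gF z : 0 < cRe (F z) -> g z = argr (F z).
  rewrite slit_F_gt0 => /slit_wD[D0 n0].
  by rewrite slit_harm_argr// gD.
have [C C0 hC] := jet_argr_sum4 m0 KF jF gb gF.
by exists C => // z y z2 ze; apply: hC.
Qed.

End SlitDisk.

(** * Boundary behaviour of the harmonic measure and its value at the origin *)

Section SlitBoundary.
Context {R : realType} (r : R).
Hypothesis r01 : 0 < r < 1.
Implicit Types z : R[i].

(** The imaginary part factors through Im z and 1 - |z|^2, so [slitP] is real only on the real axis
    and on the unit circle. *)
Lemma slitP_coord z : let x := cRe z in let n := cRe z ^+ 2 + cIm z ^+ 2 in
  slitP r z = Complex (r * (1 + 2 * x + n) ^+ 2 - (1 + r) ^+ 2 * (x * (1 + n) + 2 * n))
    (- (1 + r) ^+ 2 * cIm z * (1 - n)).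
Proof.
case: z => x y /=; rewrite /slitP /slitQ; apply/eqP; rewrite eq_complex.
by rewrite !expr2; simpc; rewrite /=; apply/andP; split; apply/eqP; ring.
Qed.

Lemma nrm_addRe_eq0 z : cIm z = 0 -> cRe z <= 0 -> nrm z + cRe z = 0.
Proof.
case: z => x y /= -> x0; rewrite expr0n addr0 sqrtr_sqr ler0_norm//.
by rewrite addNr.
Qed.

Lemma nrm_addRe_eq0P z : nrm z + cRe z = 0 -> cIm z = 0 /\ cRe z <= 0.
Proof.
case: z => x y /= h; have x0 : x <= 0.
  by have := sqrtr_ge0 (x ^+ 2 + y ^+ 2); lra.
split => //; apply/eqP; rewrite -sqrf_eq0.
have : Num.sqrt (x ^+ 2 + y ^+ 2) ^+ 2 = (- x) ^+ 2 by congr (_ ^+ 2); lra.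
by rewrite sqr_sqrtr ?addr_ge0 ?sqr_ge0// => e; apply/eqP; move: e; rewrite sqrrN; lra.
Qed.

(** A principal square root has zero real part exactly when the number under it lies on the closed
    negative half-line. *)
Lemma slitD_eq0 z : (slitD r z = 0) <-> (cIm (slitP r z) = 0 /\ cRe (slitP r z) <= 0).
Proof.
rewrite /slitD; split; last first.
  by move=> [h1 h2]; rewrite nrm_addRe_eq0// mul0r sqrtr0.
move=> /eqP; rewrite sqrtr_eq0 => h; apply: nrm_addRe_eq0P; apply/eqP.
rewrite eq_le; apply/andP; split; first by lra.
have := normRe_le_nrm (slitP r z); rewrite ler_norml => /andP[? _]; lra.
Qed.

Lemma nrm_lt1 z : nrm z < 1 -> cRe z ^+ 2 + cIm z ^+ 2 < 1.
Proof. by move=> h; rewrite -nrm_sqr expr_lt1 ?nrm_ge0. Qed.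

(** On the real diameter [slitP] is (r - x)(1 - r x)(1 + x)^2, positive for -1 < x < r. *)
Lemma slitD_eq0_in z : nrm z < 1 -> slitD r z = 0 -> cIm z = 0 /\ r <= cRe z.
Proof.
have /andP[r0 r1] := r01.
move=> /nrm_lt1 z1 /slitD_eq0; rewrite slitP_coord /=.
move: (cRe z) (cIm z) z1 => x y n1 [h1 h2].
have y0 : y = 0.
  move/eqP: h1; rewrite mulf_eq0 (gt_eqF (_ : 0 < 1 - _)) ?subr_gt0// orbF.
  rewrite mulf_eq0 oppr_eq0 sqrf_eq0 gt_eqF ?addr_gt0//= => /eqP//.
split => //; rewrite leNgt; apply/negP => xr.
move: h2 n1; rewrite y0 expr0n /= addr0 => h2 n1.
have x1 : -1 < x by rewrite ltNge; apply/negP => ?; nra.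
have : 0 < (r - x) * (1 - r * x) * (1 + x) ^+ 2.
  rewrite mulr_gt0 ?exprn_gt0//; last by lra.
  by rewrite mulr_gt0 ?subr_gt0//; nra.
suff : (r - x) * (1 - r * x) * (1 + x) ^+ 2 <= 0 by lra.
by apply: le_trans h2; rewrite le_eqVlt; apply/orP; left; apply/eqP; ring.
Qed.

Lemma slitD_circle z : nrm z = 1 -> slitD r z = 0.
Proof.
have /andP[r0 r1] := r01.
move=> z1; have := nrm_sqr z; rewrite z1 expr1n => n1; apply/slitD_eq0.
rewrite slitP_coord /= -n1; split; first by rewrite subrr mulr0.
have xb : -1 <= cRe z <= 1.
  by rewrite -ler_norml; have := normRe_le_nrm z; rewrite z1.
move: (cRe z) xb => x /andP[x1 x2].
have -> : r * (1 + 2 * x + 1) ^+ 2 - (1 + r) ^+ 2 * (x * (1 + 1) + 2 * 1) =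
  - (2 * (1 + x) * ((1 - r) ^+ 2 + 2 * r * (1 - x))) by ring.
have h1 : 0 <= 2 * (1 + x) by lra.
have h2 : 0 <= 2 * r * (1 - x) by rewrite mulr_ge0//; lra.
by rewrite oppr_le0 mulr_ge0// addr_ge0 ?sqr_ge0.
Qed.

(** On the circle |r - z| = |1 - r z|, and [slitN] becomes (1 + r)^2 (1 - Re z) / 2, which vanishes
    only at the corner. *)
Lemma slitN_circle z : nrm z = 1 -> z != 1 -> 0 < slitN r z.
Proof.
have /andP[r0 r1] := r01.
move=> z1 zN1; have := nrm_sqr z; rewrite z1 expr1n => n1.
rewrite /slitN.
have -> : nrm (slitQ r z) = 1 - 2 * r * cRe z + r ^+ 2.
  rewrite /slitQ nrmM.
  have -> : nrm (r%:C%C - z) = nrm (1 - r%:C%C * z).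
    apply: (pexpIrn (n := 2)) => //; rewrite ?nnegrE ?nrm_ge0//.
    rewrite !nrm_sqr; case: z n1 {z1 zN1} => x y /= n1; simpc => /=.
    have : (1 - r ^+ 2) * (x ^+ 2 + y ^+ 2 - 1) = 0 by rewrite -n1 subrr mulr0.
    move=> h; apply/eqP; rewrite -subr_eq0; apply/eqP; rewrite -[RHS]h; ring.
  rewrite -expr2 nrm_sqr; case: z n1 {z1 zN1} => x y /= n1; simpc => /=.
  have : r ^+ 2 * (x ^+ 2 + y ^+ 2 - 1) = 0 by rewrite -n1 subrr mulr0.
  move=> h; apply/eqP; rewrite -subr_eq0; apply/eqP; rewrite -[RHS]h; ring.
rewrite nrm_sqr; case: z n1 zN1 {z1} => x y /= n1 zN1; rewrite add0r.
have x1 : x < 1.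
  have xb : x <= 1 by rewrite leNgt; apply/negP => ?; have := sqr_ge0 y; nra.
  rewrite lt_neqAle xb andbT; apply: contra zN1 => /eqP xe.
  have y0 : y = 0 by apply/eqP; rewrite -sqrf_eq0; move: n1; rewrite xe; apply/contra_eqT => y0; rewrite expr1n -subr_eq0 -oppr_eq0 opprB addrAC subrr add0r.
  by rewrite eq_complex/= xe y0 !eqxx.
have -> : 1 - 2 * r * x + r ^+ 2 - (1 - r) ^+ 2 / 4 * ((1 + x) ^+ 2 + y ^+ 2) =
  (1 + r) ^+ 2 * (1 - x) / 2 - (1 - r) ^+ 2 / 4 * (x ^+ 2 + y ^+ 2 - 1) by field.
by rewrite -n1 subrr mulr0 subr0 divr_gt0// mulr_gt0 ?subr_gt0// exprn_gt0// addr_gt0.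
Qed.

Lemma slitD_slit (x : R) : r <= x < 1 -> slitD r x%:C%C = 0.
Proof.
have /andP[r0 r1] := r01; move=> /andP[rx x1]; apply/slitD_eq0.
rewrite slitP_coord /= !mulr0 mul0r; split => //.
have -> : r * (1 + 2 * x + (x ^+ 2 + 0 ^+ 2)) ^+ 2 - (1 + r) ^+ 2 *
   (x * (1 + (x ^+ 2 + 0 ^+ 2)) + 2 * (x ^+ 2 + 0 ^+ 2)) =
   - ((x - r) * (1 - r * x) * (1 + x) ^+ 2) by ring.
rewrite oppr_le0 mulr_ge0 ?sqr_ge0// mulr_ge0 ?subr_ge0//; nra.
Qed.

(** The value is -((1 + r)(1 - x))^2 / 4, which degenerates only at the corner x = 1. *)
Lemma slitN_slit (x : R) : r <= x < 1 -> slitN r x%:C%C < 0.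
Proof.
have /andP[r0 r1] := r01; move=> /andP[rx x1].
rewrite /slitN.
have -> : slitQ r x%:C%C = ((r - x) * (1 - r * x))%:C%C.
  by rewrite /slitQ rmorphM !rmorphB rmorph1 rmorphM.
have -> : 1 + x%:C%C = (1 + x)%:C%C :> R[i] by rewrite rmorphD rmorph1.
rewrite !nrm_real ler0_norm; last by rewrite mulr_le0_ge0 ?subr_le0 ?subr_ge0//; nra.
rewrite ger0_norm; last lra.
have -> : - ((r - x) * (1 - r * x)) - (1 - r) ^+ 2 / 4 * (1 + x) ^+ 2 =
  - (((1 + r) * (1 - x)) ^+ 2 / 4) by field.
by rewrite oppr_lt0 divr_gt0// exprn_gt0// mulr_gt0; lra.
Qed.

Lemma slitD_0 : slitD r 0 = Num.sqrt r.
Proof.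
have /andP[r0 r1] := r01.
rewrite /slitD slitP_coord /=; congr Num.sqrt.
by rewrite !expr0n !mulr0 !mul0r/= !(addr0, mul0r, mulr0, subr0, expr1n, mulr1) expr0n addr0 sqrtr_sqr ger0_norm ?(ltW r0)//; field.
Qed.

Lemma slit_harm_bound z : 0 <= slit_harm r z <= 1.
Proof.
rewrite /slit_harm; set X := _ / (_ * _).
have p0 := pi_gt0 R; have := atan_ltpi2 X; have := atan_gtNpi2 X => h1 h2.
have h3 : - 2^-1 <= atan X / pi by rewrite ler_pdivlMr//; lra.
have h4 : atan X / pi <= 2^-1 by rewrite ler_pdivrMr//; lra.
by apply/andP; lra.
Qed.

(** With sqrt r = tan th, the quotient inside [atan] at the origin is -cot(4 th) = tan(4 th - pi /
    2); r < 1 gives th < pi / 4, which keeps 4 th - pi / 2 in the range of [atan]. *)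
Lemma slit_harm_0 : slit_harm r 0 = 1 - 4 / pi * atan (Num.sqrt r).
Proof.
have /andP[r0 r1] := r01; have p0 := pi_gt0 R.
rewrite /slit_harm slitD_0 /slitN.
have -> : slitQ r 0 = r%:C%C by rewrite /slitQ mulr0 !subr0 mulr1.
rewrite addr0 Normc.normc1 expr1n mulr1 nrm_real ger0_norm ?ltW//.
set s := Num.sqrt r; have s0 : 0 < s by rewrite sqrtr_gt0.
have rs : r = s ^+ 2 by rewrite sqr_sqrtr// ltW.
have s1 : s < 1 by rewrite -sqrtr1 ltr_sqrt.
rewrite rs; set X := _ / (_ * _); set th := atan s.
have th0 : 0 < th by rewrite -atan0 lt_atan.
have th1 : th < pi / 4 by rewrite -atan1 lt_atan.
suff -> : atan X = 4 * th - pi / 2.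
  by move: p0; generalize (pi : R) => p p0; field; rewrite gt_eqF.
rewrite -[RHS]tanK ?in_itv/=; last by apply/andP; lra.
congr atan.
have c0 := cos_atan_gt0 s; have sc := sin_atan_cos s.
have sq : cos th ^+ 2 * (1 + s ^+ 2) = 1.
  by have := cos2Dsin2 th; rewrite sc -/th exprMn; lra.
have s12 : 0 < 1 + s ^+ 2 by rewrite ltr_wpDr ?sqr_ge0.
have csq : cos th ^+ 2 = (1 + s ^+ 2)^-1 by apply: (mulIf (lt0r_neq0 s12)); rewrite sq mulVf// gt_eqF.
have c2 : cos (2 * th) = (1 - s ^+ 2) / (1 + s ^+ 2).
  rewrite mulrDl mul1r cosD -!expr2 sc -/th exprMn csq; field.
  by rewrite gt_eqF.
have s2 : sin (2 * th) = 2 * s / (1 + s ^+ 2).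
  rewrite mulrDl mul1r sinD sc -/th.
  have -> : s * cos th * cos th + cos th * (s * cos th) = 2 * s * cos th ^+ 2 by ring.
  by rewrite csq.
have e4 : 4 * th = 2 * th + 2 * th by ring.
have c4 : cos (4 * th) = ((1 - s ^+ 2) ^+ 2 - (2 * s) ^+ 2) / (1 + s ^+ 2) ^+ 2.
  by rewrite e4 cosD c2 s2; field; rewrite gt_eqF.
have s4 : sin (4 * th) = 4 * s * (1 - s ^+ 2) / (1 + s ^+ 2) ^+ 2.
  by rewrite e4 sinD c2 s2; field; rewrite gt_eqF.
have -> : tan (4 * th - pi / 2) = - cos (4 * th) / sin (4 * th).
  rewrite /tan sinB cosB sin_pihalf cos_pihalf !mulr0 !mulr1 sub0r add0r.
  by [].
rewrite c4 s4 /X; field.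
have : 1 - s ^+ 2 != 0 by rewrite gt_eqF// -rs subr_gt0.
by move=> h; rewrite !gt_eqF//= ?h// subr_gt0 -rs.
Qed.

Lemma atan_large (e : R) : 0 < e -> exists2 M, 0 < M & forall x, M <= x -> pi / 2 - e <= atan x.
Proof.
move=> e0; have /cvgrPdist_le/(_ _ e0) := @cvgy_atan R.
move=> [M [Mr hM]]; exists (`|M| + 1); first by rewrite ltr_wpDl.
move=> x Mx; have : M < x.
  by rewrite (le_lt_trans (ler_norm M))// (lt_le_trans _ Mx)// ltrDl.
by move=> /hM /=; rewrite ler_norml => /andP[_]; lra.
Qed.

(** While [slitN] stays away from 0, the quotient inside [atan] blows up as [slitD] tends to 0.
    Neither bound covers the corner, where [slitN] vanishes too. *)
Lemma slit_harm_bnd (c e : R) : 0 < c -> 0 < e -> exists2 d, 0 < d &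
  forall z, 0 < slitD r z -> slitD r z < d ->
   (slitN r z <= - c -> 1 - e <= slit_harm r z) /\
   (c <= slitN r z -> slit_harm r z <= e).
Proof.
move=> c0 e0; have p0 := pi_gt0 R; have /andP[r0 r1] := r01.
have r10 : 0 < 1 - r by rewrite subr_gt0.
have [M M0 hM] := atan_large (mulr_gt0 e0 p0).
exists (c / ((1 - r) * M)); first by rewrite divr_gt0// mulr_gt0.
move=> z D0 Dd; have DM : M <= c / ((1 - r) * slitD r z).
  rewrite ler_pdivlMr ?mulr_gt0//; move: Dd; rewrite ltr_pdivlMr ?mulr_gt0//.
  by move=> /ltW; apply: le_trans; rewrite le_eqVlt; apply/orP; left; apply/eqP; ring.
have DD : 0 < (1 - r) * slitD r z by rewrite mulr_gt0.
rewrite /slit_harm; split => hN.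
- have : M <= - (slitN r z / ((1 - r) * slitD r z)).
    by apply: le_trans DM _; rewrite -mulNr ler_pM2r ?invr_gt0// lerNr.
  move=> /hM; rewrite atanN; set t := atan _ => h.
  have : t / pi <= - 2^-1 + e by rewrite ler_pdivrMr//; lra.
  lra.
- have : M <= slitN r z / ((1 - r) * slitD r z).
    by apply: le_trans DM _; rewrite ler_pM2r ?invr_gt0.
  move=> /hM; set t := atan _ => h.
  have : 2^-1 - e <= t / pi by rewrite ler_pdivlMr//; lra.
  lra.
Qed.

End SlitBoundary.

(** * Areas and Gaussian laws in the plane *)

Section Plane.
Context {R : realType}.
Local Notation RR := (measurableTypeR R * measurableTypeR R)%type.

Definition norm2 (x : RR) : R := Num.sqrt (x.1 ^+ 2 + x.2 ^+ 2).

Lemma measurable_norm2 : measurable_fun setT norm2.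
Proof.
apply: measurableT_comp => //.
  by apply: continuous_measurable_fun; exact: sqrt_continuous.
apply: measurable_funD; apply: measurable_funX; [exact: measurable_fst|exact: measurable_snd].
Qed.

Definition disk (rho : R) : set RR := [set x | norm2 x < rho].

Lemma measurable_disk rho : measurable (disk rho).
Proof.
rewrite (_ : disk rho = setT `&` norm2 @^-1` [set` `]-oo, rho[]).
  by apply: measurable_norm2.
by rewrite setTI; apply/seteqP; split => z /=; rewrite in_itv.
Qed.

End Plane.

(** * Area of a disk and the final integral *)

Section Integrals.
Context {R : realType}.
Local Notation RR := (measurableTypeR R * measurableTypeR R)%type.
Notation mu := (@lebesgue_measure R).

Lemma is_derive_FTC (f F : R -> R) (a b : R) : a < b ->
  {within `[a, b], continuous f} ->
  (forall x, a <= x <= b -> is_derive x 1 F (f x)) ->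
  (\int[mu]_(x in `[a, b]) (f x)%:E = (F b)%:E - (F a)%:E)%E.
Proof.
move=> ab cf dF.
have cF x : a <= x <= b -> {for x, continuous F}.
  move=> xab; have [Fx _] := dF _ xab.
  by apply: differentiable_continuous; exact/derivable1_diffP.
apply: continuous_FTC2 => //.
- split.
  + move=> x; rewrite in_itv/= => /andP[ax xb].
    have xab : a <= x <= b by rewrite !ltW.
    by have [] := dF _ xab.
  + by apply: cvg_at_right_filter; apply: cF; rewrite lexx ltW.
  + by apply: cvg_at_left_filter; apply: cF; rewrite lexx ltW.
- move=> x; rewrite in_itv/= => /andP[ax xb]; rewrite derive1E.
  have xab : a <= x <= b by rewrite !ltW.
  by have [_ ->] := dF _ xab.
Qed.

(** Valid for |x| >= rho as well: the square root of a nonpositive number is 0, and the interval is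
    empty. *)
Lemma disk_section (rho : R) (x : R) : 0 < rho ->
  xsection (disk rho : set RR) x =
  `]- Num.sqrt (rho ^+ 2 - x ^+ 2), Num.sqrt (rho ^+ 2 - x ^+ 2)[%classic.
Proof.
move=> r0; apply/seteqP; split => y; rewrite /xsection /= inE /disk /= in_itv/= -ltr_norml /norm2/=.
  move=> h; rewrite -sqrtr_sqr ltr_sqrt.
    rewrite ltrBrDl -ltr_sqrt ?exprn_gt0// [ltRHS]sqrtr_sqr ger0_norm//.
    exact: ltW.
  rewrite subr_gt0 -ltr_sqrt ?exprn_gt0// [ltRHS]sqrtr_sqr ger0_norm; last exact: ltW.
  by apply: le_lt_trans h; rewrite ler_wsqrtr// lerDl sqr_ge0.
rewrite -[X in _ < X]/(Num.sqrt _) => h.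
have y2 : y ^+ 2 < rho ^+ 2 - x ^+ 2.
  have s0 : 0 < Num.sqrt (rho ^+ 2 - x ^+ 2) by apply: le_lt_trans h.
  have p0 : 0 < rho ^+ 2 - x ^+ 2 by rewrite -sqrtr_gt0.
  by rewrite -ltr_sqrt// sqrtr_sqr.
have -> : rho = Num.sqrt (rho ^+ 2) by rewrite sqrtr_sqr ger0_norm// ltW.
by rewrite ltr_sqrt ?exprn_gt0// addrC -ltrBrDr.
Qed.

(** Sections have length 2 sqrt(rho^2 - x^2); the substitution x = rho sin t leaves 2 rho^2 cos^2 t,
    with primitive rho^2 (t + sin t cos t). *)
Lemma leb2_disk (rho : R) : 0 < rho -> leb2 (disk rho) = (pi * rho ^+ 2)%:E.
Proof.
move=> r0.
pose s (x : R) := 2 * Num.sqrt (rho ^+ 2 - x ^+ 2).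
have cs : continuous s.
  have c1 : continuous (fun x : R => Num.sqrt (rho ^+ 2 - x ^+ 2)).
    move=> x; apply: (@continuous_comp _ _ _ (fun x : R => rho ^+ 2 - x ^+ 2) Num.sqrt).
      by apply: cvgB; [exact: cvg_cst|exact: exprn_continuous].
    exact: sqrt_continuous.
  by move=> x; apply: cvgM; [exact: cvg_cst|exact: c1].
have -> : leb2 (disk rho) = (\int[mu]_x (s x)%:E)%E.
  apply: eq_integral => x _ /=; rewrite disk_section// lebesgue_measure_itv/= lte_fin.
  case: ifPn => h; first by rewrite -EFinD /s; congr (_%:E); ring.
  congr (_%:E); rewrite /s; have := sqrtr_ge0 (rho ^+ 2 - x ^+ 2); lra.
have -> : (\int[mu]_x (s x)%:E = \int[mu]_(x in `[(- rho)%R, rho]) (s x)%:E)%E.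
  rewrite [RHS]integral_mkcond; apply: eq_integral => x _; rewrite patchE.
  case: ifPn => //; rewrite notin_setE/= in_itv/= -ler_norml => /negP; rewrite -ltNge => h.
  congr (_%:E); rewrite /s ler0_sqrtr ?mulr0// subr_le0.
  by rewrite -(real_normK (num_real x)) lerXn2r ?nnegrE// ltW.
pose F (t : R) := rho * sin t.
have p0 := pi_gt0 R.
have dF (t : R) : is_derive t (1 : R) F (rho * cos t).
  by apply: is_derive_eq.
have F'E : F^`()%classic = (fun t => rho * cos t).
  by apply/funext => t; rewrite derive1E; have [_ ->] := dF t.
have cF' : continuous (fun t : R => rho * cos t).
  by move=> t; apply: cvgM; [exact: cvg_cst|exact: continuous_cos].
have cF : continuous F.
  by move=> t; apply: cvgM; [exact: cvg_cst|exact: continuous_sin].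
have Fa : F (- (pi / 2)) = - rho by rewrite /F sinN sin_pihalf mulrN1.
have Fb : F (pi / 2) = rho by rewrite /F sin_pihalf mulr1.
have ab : - (pi / 2) < pi / 2 :> R by lra.
have := @integration_by_substitution_increasing R F s (- (pi / 2)) (pi / 2).
rewrite Fa Fb => ->; first last.
- exact: continuous_subspaceT.
- split.
  + by move=> t _; have [] := dF t.
  + by apply: cvg_at_right_filter; exact: cF.
  + by apply: cvg_at_left_filter; exact: cF.
- by apply/cvg_ex; exists (F^`()%classic (pi / 2)); apply: cvg_at_left_filter; rewrite F'E; exact: cF'.
- by apply/cvg_ex; exists (F^`()%classic (- (pi / 2))); apply: cvg_at_right_filter; rewrite F'E; exact: cF'.
- by move=> t _; rewrite F'E; exact: cF'.
- by move=> x y xI yI xy; rewrite /F ltr_pM2l// ltr_sin.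
- exact: ltW.
pose H (t : R) := rho ^+ 2 * (t + sin t * cos t).
transitivity (\int[mu]_(t in `[(- (pi / 2))%R, (pi / 2)%R]) (2 * rho ^+ 2 * cos t ^+ 2)%:E)%E.
  apply: eq_integral => t; rewrite inE/= in_itv/= => tI; congr (_%:E).
  rewrite F'E -[LHS]/(2 * Num.sqrt (rho ^+ 2 - (rho * sin t) ^+ 2) * (rho * cos t)).
  have -> : rho ^+ 2 - (rho * sin t) ^+ 2 = (rho * cos t) ^+ 2.
    by rewrite !exprMn -[X in X - _]mulr1 -(cos2Dsin2 t); ring.
  rewrite sqrtr_sqr ger0_norm; last first.
    by rewrite mulr_ge0 ?cos_ge0_pihalf// ltW.
  by ring.
have c2 : continuous (fun t : R => cos t ^+ 2).
  move=> t; apply: (@continuous_comp _ _ _ cos (fun v : R => v ^+ 2)).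
    exact: continuous_cos.
  exact: exprn_continuous.
have c3 : {within `[- (pi / 2), pi / 2], continuous (fun t : R => 2 * rho ^+ 2 * cos t ^+ 2)}.
  by apply: continuous_subspaceT => t; apply: cvgM; [exact: cvg_cst|exact: c2].
have dH (t : R) : - (pi / 2) <= t <= pi / 2 -> is_derive t (1 : R) H (2 * rho ^+ 2 * cos t ^+ 2).
  move=> _; apply: is_derive_eq.
  have c := cos2Dsin2 t; rewrite -![_ *: _]/(_ * _).
  have -> : sin t * - sin t = cos t ^+ 2 - 1 by rewrite -c; ring.
  by ring.
rewrite (is_derive_FTC ab c3 dH) /H cosN sinN cos_pihalf !mulr0 !addr0 -EFinB; congr (_%:E).
by generalize (pi : R) => p; field.
Qed.

Lemma integral_tan4 :
  (\int[mu]_(t in `]0%R, 1%R[) (pi * tan ((1 - t) * (pi / 4)) ^+ 4)%:E = (pi - 8 / 3)%:E)%E.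
Proof.
have p0 := pi_gt0 R.
pose th (t : R) := (1 - t) * (pi / 4).
have c0 (t : R) : 0 <= t <= 1 -> 0 < cos (th t).
  move=> /andP[t0 t1]; apply: cos_gt0_pihalf; rewrite /th; apply/andP; split; nra.
have dth (t : R) : is_derive t (1 : R) th (- (pi / 4)).
  apply: is_derive_eq; rewrite -![_ *: _]/(_ * _).
  by generalize (pi : R) => p; field.
pose G (t : R) := tan (th t).
have dG (t : R) : 0 <= t <= 1 -> is_derive t (1 : R) G (- (pi / 4) * (1 + G t ^+ 2)).
  move=> tI; have ct := c0 _ tI; have cn0 : cos (th t) != 0 by rewrite gt_eqF.
  have dt := is_derive_tan cn0.
  apply: (@is_derive_eq _ _ _ _ _ _ _ _ (is_derive1_comp dt (dth t))).
  rewrite /G /tan mulrC; congr (_ * _).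
  have c := cos2Dsin2 (th t).
  rewrite expr_div_n; apply: (mulIf (expf_neq0 2 cn0)).
  by rewrite mulVf ?expf_neq0// mulrDl mul1r divfK ?expf_neq0.
(* From tan^4 = (tan^2 - 1)(tan^2 + 1) + 1 and th' = - pi / 4; F vanishes at 1 and equals 8 / 3 - pi
   at 0. *)
pose F (t : R) := - 4 * (3^-1 * G t ^+ 3 - G t + th t).
have dF (t : R) : 0 <= t <= 1 -> is_derive t (1 : R) F (pi * G t ^+ 4).
  move=> tI; have dg := dG _ tI; have dt := dth t.
  apply: is_derive_eq; rewrite -![_ *: _]/(_ * _).
  by move: (G t) => g; generalize (pi : R) => p; field.
have cf : {within `[0, 1], continuous (fun t : R => pi * G t ^+ 4)}.
  apply: continuous_in_subspaceT => t; rewrite inE/= in_itv/= => tI.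
  have [dGt _] := dG _ tI.
  have cG : {for t, continuous G}.
    by apply: differentiable_continuous; exact/derivable1_diffP.
  have cG4 : {for t, continuous (fun t => G t ^+ 4)}.
    apply: (@continuous_comp _ _ _ G (fun v : R => v ^+ 4)) => //.
    exact: exprn_continuous.
  by apply: cvgM; [exact: cvg_cst|exact: cG4].
have mf : measurable_fun (`]0, 1[%classic : set (measurableTypeR R)) (fun t : R => (pi * G t ^+ 4)%:E).
  apply/measurable_EFinP; have : measurable_fun (`[0, 1]%classic : set (measurableTypeR R)) (fun t : R => pi * G t ^+ 4).
    by apply: subspace_continuous_measurable_fun => //; exact: measurable_itv.
  by apply: measurable_funS => //; exact: subset_itv_oo_cc.
rewrite -(@integral_itv_bndoo _ _ _ _ true false mf) (is_derive_FTC ltr01 cf dF) /F /G /th subrr mul0r subr0 mul1r.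
have -> : tan (pi / 4 : R) = 1 by rewrite -atan1 atanK.
rewrite tan0 -EFinB; congr (_%:E).
by generalize (pi : R) => p; field.
Qed.

End Integrals.

(** * Integration against densities, Gaussian laws and their moments *)

Section Density.
Local Open Scope ereal_scope.
Import HBNNSimple.

Lemma ge0_integral_density d (T : measurableType d) (R : realType)
    (m nu : {measure set T -> \bar R}) (g : T -> R) (f : T -> \bar R) :
  measurable_fun setT g -> (forall x, (0 <= g x)%R) ->
  (forall A, measurable A -> nu A = \int[m]_(x in A) (g x)%:E) ->
  measurable_fun setT f -> (forall x, 0 <= f x) ->
  \int[nu]_x f x = \int[m]_x (f x * (g x)%:E).
Proof.
move=> mg g0 nug mf f0.
pose h := nnsfun_approx measurableT mf.
have mge : measurable_fun setT (EFin \o g) by exact/measurable_EFinP.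
have -> : \int[nu]_x f x = lim (\int[nu]_x (EFin \o h n) x @[n --> \oo]).
  have fE x : f x = lim ((EFin \o h n) x @[n --> \oo]).
    by apply/esym/cvg_lim => //; exact: cvg_nnsfun_approx.
  under eq_integral => x _ do rewrite fE.
  apply: monotone_convergence => //.
  - by move=> n; apply/measurable_EFinP; exact/measurable_funP.
  - by move=> n x Ex //=; rewrite lee_fin.
  - by move=> x Ex a b ab; rewrite lee_fin; exact/lefP/nd_nnsfun_approx.
have -> : \int[m]_x (f x * (g x)%:E) =
    lim (\int[m]_x ((EFin \o h n) x * (g x)%:E) @[n --> \oo]).
  have fg x : f x * (g x)%:E = lim (((EFin \o h n) x * (g x)%:E) @[n --> \oo]).
    apply/esym/cvg_lim; first exact: ereal_hausdorff.
    by apply: cvgeZr; [|exact: cvg_nnsfun_approx].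
  under eq_integral => x _ do rewrite fg.
  apply: monotone_convergence => //.
  - move=> n; apply: emeasurable_funM => //.
    exact/measurable_EFinP.
  - by move=> n x Ex /=; rewrite mule_ge0 ?lee_fin.
  - move=> x Ex a b ab/=; rewrite lee_wpmul2r ?lee_fin//.
    exact/lefP/nd_nnsfun_approx.
suff suf n : \int[nu]_x (EFin \o h n) x = \int[m]_x ((EFin \o h n) x * (g x)%:E).
  by under eq_fun do rewrite suf.
transitivity (\int[nu]_x
   (\sum_(y \in range (h n)) (y * \1_(h n @^-1` [set y]) x)%:E)).
  by apply: eq_integral => t tE; rewrite /= fimfunE -fsumEFin.
have indich k r : measurable_fun setT (fun x => (r * \1_(h k @^-1` [set r]) x)%:E).
  by apply: (measurable_comp measurableT) => //; exact: measurable_funM.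
rewrite ge0_integral_fsum//; last by move=> k y Ey; exact: nnfun_muleindic_ge0.
transitivity (\int[m]_x (\sum_(y \in range (h n))
    (y * \1_(h n @^-1` [set y]) x)%:E * (g x)%:E)); last first.
  apply: eq_integral => x _.
  rewrite -ge0_mule_fsuml => [|y]; last exact: nnfun_muleindic_ge0.
  by rewrite fsumEFin // -(fimfunE _ x).
rewrite ge0_integral_fsum//; last 2 first.
  - by move=> y; apply: emeasurable_funM.
  - by move=> k y Ey; apply: mule_ge0; rewrite ?lee_fin//; exact: nnfun_muleindic_ge0.
apply: eq_fsbigr => r; rewrite inE => ry.
have r0 : (0 <= r)%R by case: ry => t _ <-.
under eq_integral do rewrite EFinM.
have mi : measurable_fun setT (EFin \o (\1_(h n @^-1` [set r]) : T -> R)).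
  by apply/measurable_EFinP; exact: measurable_indic.
rewrite ge0_integralZl//.
under [RHS]eq_integral do rewrite EFinM -muleA.
rewrite ge0_integralZl//; first last.
- by move=> x _; rewrite mule_ge0 ?lee_fin.
- exact: emeasurable_funM.
congr (_ * _).
rewrite integral_indic// setIT nug// [in LHS]integral_mkcond.
apply: eq_integral => x _; rewrite /patch indicE.
by case: ifPn => _; rewrite ?mul1e ?mul0e.
Qed.

End Density.

Section Leb.
Context {R : realType}.
Notation mu := (@lebesgue_measure R).
Local Notation RR := (measurableTypeR R * measurableTypeR R)%type.
Local Open Scope ereal_scope.

Definition rot90 (y : RR) : RR := (- y.2, y.1)%R.

Lemma measurable_rot90 : measurable_fun setT rot90.
Proof.
apply/measurable_fun_pairP; split; last exact: measurable_fst.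
exact: measurableT_comp measurable_snd.
Qed.

(** By uniqueness of the product measure only rectangles matter: the preimage of X x Y is Y x (-X),
    and Lebesgue measure is invariant under reflection. *)
Lemma leb2_rot90 (A : set RR) : measurable A -> leb2 (rot90 @^-1` A) = leb2 A.
Proof.
move=> mA; apply/esym.
suff : leb2 A = pushforward (@leb2 R)
  rot90 A by [].
apply: product_measure_unique => //= [|mr X Y mX mY]; first exact: measurable_rot90.
rewrite /pushforward.
have -> : rot90 @^-1` (X `*` Y) = Y `*` (-%R @^-1` X).
  by apply/seteqP; split => [[a b] [? ?]|[a b] [? ?]].
rewrite /leb2 product_measure1E//; last first.
  rewrite -[X in measurable X]setTI.
  exact: (measurable_funN _ measurableT).
rewrite muleC; congr (_ * _); exact: lebesgue_measureN.
Qed.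

Lemma gauss2_rot90 (h : R) x : gauss2 h (rot90 x) = gauss2 h x.
Proof. by rewrite /gauss2 /= sqrrN [in LHS]addrC. Qed.

Lemma gauss2_ge0 (h : R) x : (0 < h -> 0 <= gauss2 h x)%R.
Proof.
move=> h0; rewrite /gauss2 divr_ge0 ?expR_ge0// mulr_ge0// 1?ltW//.
by rewrite mulrn_wgt0// pi_gt0.
Qed.

Lemma measurable_gauss2 (h : R) : measurable_fun setT (gauss2 h : RR -> R).
Proof.
rewrite /gauss2; apply: measurable_funM => //.
apply: measurableT_comp => //; apply: measurable_funM => //.
apply: measurableT_comp => //; apply: measurable_funD;
  apply: measurable_funX; [exact: measurable_fst|exact: measurable_snd].
Qed.

(** A property of a measure rather than a measure built from the density: instances are laws of
    values and increments of [W], whose total mass is 1 for free. *)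
Definition gauss_law (h : R) (m : {measure set RR -> \bar R}) :=
  forall A, measurable A -> m A = \int[leb2]_(x in A) (gauss2 h x)%:E.

Lemma gauss_law_integral h m (f : RR -> \bar R) : (0 < h)%R -> gauss_law h m ->
  measurable_fun setT f -> (forall x, 0 <= f x) ->
  \int[m]_x f x = \int[leb2]_x (f x * (gauss2 h x)%:E).
Proof.
move=> h0 hm mf f0; rewrite /leb2.
apply: ge0_integral_density => //.
- exact: measurable_gauss2.
- by move=> x; exact: gauss2_ge0.
Qed.

Lemma gauss_law_rot90 h m (f : RR -> \bar R) : (0 < h)%R -> gauss_law h m ->
  measurable_fun setT f -> (forall x, 0 <= f x) ->
  \int[m]_x f (rot90 x) = \int[m]_x f x.
Proof.
move=> h0 hm mf f0.
have mr := measurable_rot90.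
have mg : measurable_fun setT (fun x : RR => (gauss2 h x)%:E).
  by apply/measurable_EFinP; exact: measurable_gauss2.
have mfg : measurable_fun setT (fun x => f x * (gauss2 h x)%:E).
  exact: emeasurable_funM.
have fg0 x : 0 <= f x * (gauss2 h x)%:E by rewrite mule_ge0// lee_fin gauss2_ge0.
rewrite (gauss_law_integral h0 hm)//; last exact: measurableT_comp.
rewrite (gauss_law_integral h0 hm)//.
under eq_integral do rewrite -gauss2_rot90.
have := ge0_integral_pushforward mr leb2 measurableT mfg.
rewrite preimage_setT => <-; last by move=> y _; exact: fg0.
by apply: eq_measure_integral => //= A mA _; exact: leb2_rot90.
Qed.

(* |x|^3 times the density of variance h is at most a constant times the density
   of variance 2 h. *)
Lemma gauss_third_moment h (m m2 : {measure set RR -> \bar R}) :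
  (0 < h)%R -> gauss_law h m -> gauss_law (2 * h) m2 -> m2 setT = 1 ->
  \int[m]_x (norm2 x ^+ 3)%:E <= (64 * Num.sqrt h ^+ 3)%:E.
Proof.
move=> h0 hm hm2 m2T.
have n0 (x : RR) : (0 <= norm2 x)%R by exact: sqrtr_ge0.
have mn : measurable_fun setT (fun x : RR => norm2 x ^+ 3)%R.
  by apply: measurable_funX; exact: measurable_norm2.
have mn' : measurable_fun setT (fun x : RR => (norm2 x ^+ 3)%:E) by exact/measurable_EFinP.
have h20 : (0 < 2 * h)%R by rewrite mulr_gt0.
have s0 : (0 < Num.sqrt h)%R by rewrite sqrtr_gt0.
rewrite (gauss_law_integral h0 hm mn'); last first.
  by move=> x; rewrite lee_fin exprn_ge0.
have -> : (64 * Num.sqrt h ^+ 3)%:E = (64 * Num.sqrt h ^+ 3)%:E * m2 setT.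
  by rewrite m2T mule1.
rewrite hm2// -ge0_integralZl//; first last.
- by move=> x _; rewrite lee_fin gauss2_ge0.
- by apply/measurable_EFinP; exact: measurable_gauss2.
apply: ge0_le_integral => //.
- by move=> x _; rewrite mule_ge0// lee_fin ?gauss2_ge0 ?exprn_ge0.
- apply: emeasurable_funM => //; apply/measurable_EFinP; exact: measurable_gauss2.
- by apply: emeasurable_funM => //; apply/measurable_EFinP; exact: measurable_gauss2.
move=> x _; rewrite -!EFinM lee_fin /gauss2.
set q := (x.1 ^+ 2 + x.2 ^+ 2)%R.
have q0 : (0 <= q)%R by rewrite addr_ge0// sqr_ge0.
(* In terms of t the densities of variances h and 2 h are proportional to exp(-2 t^2) and exp(-t^2).
   The constant 64 is made of 8 from |x|^3, 2 from the normalisations and 4 from the bound on t^3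
   exp(-t^2). *)
pose t := (norm2 x / (2 * Num.sqrt h))%R.
have t0 : (0 <= t)%R by rewrite divr_ge0// mulr_ge0// ltW.
have hs : h = (Num.sqrt h ^+ 2)%R by rewrite sqr_sqrtr// ltW.
have nx : norm2 x = (2 * Num.sqrt h * t)%R by rewrite /t; field; rewrite gt_eqF.
have qt : q = (4 * h * t ^+ 2)%R.
  by rewrite -[LHS]sqr_sqrtr// -[Num.sqrt _]/(norm2 x) nx [in RHS]hs; ring.
have e1 : (- q / (h *+ 2) = - t ^+ 2 + - t ^+ 2)%R.
  by rewrite qt -mulr_natr; field; rewrite gt_eqF.
have e2 : (- q / ((2 * h) *+ 2) = - t ^+ 2)%R.
  by rewrite qt -mulr_natr; field; rewrite gt_eqF.
have E0 := expR_gt0 (- t ^+ 2).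
(* t^3 <= 4 (1 + t^2 / 2)^2 <= 4 exp(t^2). *)
have tE : (t ^+ 3 * expR (- t ^+ 2) <= 4)%R.
  rewrite expRN ler_pdivrMr ?expR_gt0//.
  have e3 : expR (t ^+ 2) = (expR (t ^+ 2 / 2) ^+ 2)%R.
    by rewrite (expr2 (expR _)) -expRD; congr expR; field.
  have h1 := expR_ge1Dx (t ^+ 2 / 2).
  have t20 : (0 <= t ^+ 2 / 2)%R by rewrite divr_ge0// sqr_ge0.
  have h2 : ((1 + t ^+ 2 / 2) ^+ 2 <= expR (t ^+ 2))%R.
    by rewrite e3 lerXn2r ?nnegrE ?expR_ge0// addr_ge0.
  apply: le_trans (_ : 4 * (1 + t ^+ 2 / 2) ^+ 2 <= _)%R; last by rewrite ler_pM2l.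
  have a1 : (0 <= t ^+ 4 - 2 * t ^+ 3 + t ^+ 2)%R.
    rewrite [leRHS](_ : _ = (t ^+ 2 - t) ^+ 2)%R ?sqr_ge0//; ring.
  have -> : (4 * (1 + t ^+ 2 / 2) ^+ 2 = 4 + 4 * t ^+ 2 + t ^+ 4)%R by field.
  have a2 : (0 <= t ^+ 4)%R by rewrite exprn_ge0.
  have a3 := sqr_ge0 t.
  by move: (t ^+ 4)%R (t ^+ 3)%R (t ^+ 2)%R a1 a2 a3 => a b c; lra.
rewrite e1 e2 expRD.
have p0 := pi_gt0 R.
have c0 : (0 < 8 * Num.sqrt h ^+ 3 * expR (- t ^+ 2) / (pi *+ 2 * h))%R.
  have p2 : (0 < pi *+ 2 * h)%R by rewrite mulr_gt0// mulrn_wgt0.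
  apply: divr_gt0 => //; apply: mulr_gt0 => //; apply: mulr_gt0 => //.
  exact: exprn_gt0.
have -> : (norm2 x ^+ 3 * (expR (- t ^+ 2) * expR (- t ^+ 2) / (pi *+ 2 * h)) =
  8 * Num.sqrt h ^+ 3 * expR (- t ^+ 2) / (pi *+ 2 * h) * (t ^+ 3 * expR (- t ^+ 2)))%R.
  by rewrite nx; ring.
have -> : (64 * Num.sqrt h ^+ 3 * (expR (- t ^+ 2) / (pi *+ 2 * (2 * h))) =
  8 * Num.sqrt h ^+ 3 * expR (- t ^+ 2) / (pi *+ 2 * h) * 4)%R.
  move: p0; generalize (pi : R) => p p0; rewrite -mulr_natr; field.
  by rewrite !gt_eqF.
by rewrite ler_pM2l.
Qed.

Lemma measurable_add2 (z : RR) : measurable_fun setT (fun y : RR => z + y : RR)%R.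
Proof.
apply/measurable_fun_pairP; split.
  apply: (measurable_funD (f := fun=> z.1)) => //; exact: measurable_fst.
apply: (measurable_funD (f := fun=> z.2)) => //; exact: measurable_snd.
Qed.

(* The Gaussian law is invariant under quarter turns, so the bound on the
   four-point sum may be integrated. *)
Lemma gauss_one_step h (m m2 : {measure set RR -> \bar R}) (f : RR -> R) (z : RR) (C : R) :
  (0 < h)%R -> gauss_law h m -> m setT = 1 -> gauss_law (2 * h) m2 -> m2 setT = 1 ->
  measurable_fun setT f -> (forall y, 0 <= f y)%R -> (0 <= C)%R ->
  (forall y, f (z + y) + f (z + rot90 y) + f (z - y) + f (z - rot90 y) <=
    4 * f z + C * norm2 y ^+ 3)%R ->
  \int[m]_y (f (z + y)%R)%:E <= (f z + 16 * C * Num.sqrt h ^+ 3)%:E.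
Proof.
move=> h0 hm mT hm2 m2T mf f0 C0 hf.
pose g y : \bar R := (f (z + y)%R)%:E.
have mg : measurable_fun setT g.
  by apply/measurable_EFinP; apply: measurableT_comp mf (measurable_add2 z).
have g0 y : 0 <= g y by rewrite lee_fin.
have mr := measurable_rot90.
have mg1 : measurable_fun setT (g \o rot90) by exact: measurableT_comp.
have mg2 : measurable_fun setT (g \o rot90 \o rot90) by exact: measurableT_comp.
have mg3 : measurable_fun setT (g \o rot90 \o rot90 \o rot90) by exact: measurableT_comp.
have e1 : \int[m]_y g (rot90 y) = \int[m]_y g y by exact: (gauss_law_rot90 h0 hm mg g0).
have e2 : \int[m]_y g (rot90 (rot90 y)) = \int[m]_y g y.
  by rewrite -[RHS]e1; exact: (gauss_law_rot90 h0 hm mg1 (fun=> g0 _)).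
have e3 : \int[m]_y g (rot90 (rot90 (rot90 y))) = \int[m]_y g y.
  by rewrite -[RHS]e2; exact: (gauss_law_rot90 h0 hm mg2 (fun=> g0 _)).
have e4 : 4%:E * \int[m]_y g y =
    \int[m]_y (g y + g (rot90 y) + g (rot90 (rot90 y)) + g (rot90 (rot90 (rot90 y)))).
  have mD2 : measurable_fun setT (fun y => g y + g (rot90 y)) by exact: emeasurable_funD.
  have mD3 : measurable_fun setT (fun y => g y + g (rot90 y) + g (rot90 (rot90 y))).
    exact: emeasurable_funD.
  rewrite !ge0_integralD//; try by move=> x _; rewrite !adde_ge0.
  rewrite e1 e2 e3 (_ : 4%:E = 1 + 1 + 1 + 1).
    rewrite (@ge0_muleDl _ _ (1 + 1 + 1)) ?adde_ge0 ?lee01//.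
    rewrite (@ge0_muleDl _ _ (1 + 1)) ?adde_ge0 ?lee01//.
    by rewrite ge0_muleDl ?lee01// !mul1e.
  by rewrite -!EFinD; congr (_%:E); ring.
have mn3 : measurable_fun setT (fun y : RR => (norm2 y ^+ 3)%:E).
  by apply/measurable_EFinP; apply: measurable_funX; exact: measurable_norm2.
have n30 (y : RR) : 0 <= (norm2 y ^+ 3)%:E by rewrite lee_fin exprn_ge0 ?sqrtr_ge0.
(* The four rotated integrals coincide; dividing by 4 will turn 64 into 16. *)
have le4 : 4%:E * \int[m]_y g y <= (4 * f z)%:E + C%:E * (64 * Num.sqrt h ^+ 3)%:E.
  rewrite e4; apply: (@le_trans _ _ (\int[m]_y ((4 * f z)%:E + C%:E * (norm2 y ^+ 3)%:E))).
    apply: ge0_le_integral => //.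
    - by move=> x _; rewrite !adde_ge0.
    - by do 3 (apply: emeasurable_funD => //).
    - by apply: emeasurable_funD => //; exact: emeasurable_funM.
    move=> y _; rewrite -!EFinM -!EFinD lee_fin; apply: le_trans (hf y).
    rewrite /g /=; have -> : rot90 (rot90 y) = (- y)%R by [].
    have -> : rot90 (- y)%R = (- rot90 y)%R by case: y => a b; rewrite /rot90 /=.
    by [].
  rewrite ge0_integralD//; first last.
  - exact: emeasurable_funM.
  - by move=> x _; rewrite mule_ge0.
  - by move=> x _; rewrite lee_fin mulr_ge0.
  rewrite integral_cst// mT mule1 leeD2l// ge0_integralZl//.
  apply: lee_wpmul2l; first by rewrite lee_fin.
  exact: (gauss_third_moment h0 hm hm2 m2T).
have i0 : 0 <= \int[m]_y g y by exact: integral_ge0.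
move: le4 i0; rewrite -/(g _); case: (\int[m]_y g y) => [x| |] //=.
  rewrite -!EFinM -EFinD !lee_fin => le4 _; lra.
by rewrite gt0_muley// lte_fin.
Qed.

End Leb.

(** * The random walk skeleton *)

Section Indep.
Local Open Scope ereal_scope.
Context d d1 d2 {T : measurableType d} {T1 : measurableType d1}
  {T2 : measurableType d2} {R : realType} (P : probability T R).

(** Independence makes the law of (S, X) a product, and Tonelli integrates X first with S frozen.
    The space of S is left free: it will be [T] itself with the sigma-algebra of the past. *)
Lemma indep_fubini (S : T -> T1) (X : T -> T2) (f : T1 * T2 -> \bar R) :
  measurable_fun setT S -> measurable_fun setT X ->
  (forall A B, measurable A -> measurable B ->
     P (S @^-1` A `&` X @^-1` B) = P (S @^-1` A) * P (X @^-1` B)) ->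
  measurable_fun setT f -> (forall x, 0 <= f x) ->
  \int[P]_w f (S w, X w) = \int[P]_w \int[P]_v f (S w, X v).
Proof.
move=> mS mX ind mf f0.
pose S' : {mfun T >-> T1} := mfun_Sub (mem_set mS).
pose X' : {mfun T >-> T2} := mfun_Sub (mem_set mX).
have mSX : measurable_fun setT (fun w => (S w, X w)) by exact: measurable_fun_pair.
pose SX : {mfun T >-> (T1 * T2)%type} := mfun_Sub (mem_set mSX).
have mfS x : measurable_fun setT (fun y => f (x, y)) by exact: measurable_fun_pair2.
transitivity (\int[distribution P SX]_z f z).
  by rewrite (ge0_integral_distribution SX mf f0).
transitivity (\int[distribution P S' \x distribution P X']_z f z).
  apply: eq_measure_integral => A mA _; apply/esym.
  exact: (@product_measure_unique _ _ _ _ _ (distribution P S') (distribution P X')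
     (distribution P SX)).
rewrite fubini_tonelli1//.
rewrite (ge0_integral_distribution S').
- apply: eq_integral => w _ /=; rewrite /fubini_F.
  by rewrite (ge0_integral_distribution X').
- exact: measurable_fun_fubini_tonelli_F.
- by move=> y; exact: integral_ge0.
Qed.

End Indep.

(** * Optional stopping for the Gaussian walk *)

Section Walk.
Local Open Scope ereal_scope.
Context d {T : measurableType d} {R : realType} (P : probability T R).
Variable W : R -> T -> R * R.
Hypothesis BM : is_planar_BM P W.
Local Notation RR := (measurableTypeR R * measurableTypeR R)%type.

(** The increment over [0, s] alone, that is, the joint law with n = 1. The measure comes as a
    probability, which normalises the Gaussian density. *)
Lemma BM_gauss (s : R) : (0 < s)%R -> exists2 m : probability RR R,
  gauss_law s m & forall A, measurable A -> m A = P (W s @^-1` A).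
Proof.
case: BM => W0 mW _ inc s0.
have ms : @measurable_fun _ _ T RR setT (W s) := mW _ (ltW s0).
pose X : {mfun T >-> RR} := @mfun_Sub _ _ T RR (W s) (mem_set ms).
exists (distribution P X) => // A mA.
have t0 : (0%:R * s = 0)%R by rewrite mul0r.
have ti i : (i < 1)%N -> (i%:R * s < i.+1%:R * s)%R by rewrite ltr_pM2r// ltr_nat.
have := inc 1%N (fun i => i%:R * s)%R (fun=> A) t0 ti (fun=> mA).
rewrite big_ord1 /= mul0r mul1r subr0 => <-.
congr (P _); apply/seteqP; split => w /=.
  move=> Aw [|//] _; rewrite inE mul0r mul1r W0 !subr0.
  by move: Aw; rewrite /= /preimage/=; case: (W s w).
move=> /(_ 0%N isT); rewrite inE mul0r mul1r W0 !subr0.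
by rewrite /preimage/=; case: (W s w).
Qed.

Variable h : R.
Hypothesis h0 : (0 < h)%R.

Definition skel (k : nat) (w : T) : RR := W (k%:R * h)%R w.
Definition incr (k : nat) (w : T) : RR := (skel k.+1 w - skel k w)%R.

Lemma skel0 w : skel 0 w = (0, 0)%R.
Proof. by case: BM => W0 _ _ _; rewrite /skel mul0r W0. Qed.

Lemma skelS k w : skel k.+1 w = (skel k w + incr k w)%R.
Proof. by rewrite /incr addrC subrK. Qed.

Lemma measurable_skel k : measurable_fun setT (skel k).
Proof.
case: BM => _ mW _ _; have k0 : (0 <= k%:R * h)%R by rewrite mulr_ge0 ?ler0n// ltW.
exact: mW k0.
Qed.

Lemma measurable_add_pair d' (T' : measurableType d') (f g : T' -> RR) :
  measurable_fun setT f -> measurable_fun setT g ->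
  measurable_fun setT (fun w => f w + g w : RR)%R.
Proof.
move=> /measurable_fun_pairP[f1 f2] /measurable_fun_pairP[g1 g2].
by apply/measurable_fun_pairP; split; apply: measurable_funD.
Qed.

Lemma measurable_opp_pair d' (T' : measurableType d') (f : T' -> RR) :
  measurable_fun setT f -> measurable_fun setT (fun w => - f w : RR)%R.
Proof.
move=> /measurable_fun_pairP[f1 f2].
apply/measurable_fun_pairP; split; [exact: measurable_funN f1|exact: measurable_funN f2].
Qed.

Lemma measurable_incr k : measurable_fun setT (incr k).
Proof.
apply: measurable_add_pair; first exact: measurable_skel.
by apply: measurable_opp_pair; exact: measurable_skel.
Qed.

Lemma incr_joint n (A : nat -> set RR) : (forall i, measurable (A i)) ->
  P [set w | forall i, (i < n)%N -> A i (incr i w)] =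
  \prod_(i < n) \int[leb2]_(x in A i) (gauss2 h x)%:E.
Proof.
move=> mA; case: BM => W0 mW _ inc.
have := inc n (fun i => i%:R * h)%R A; rewrite mul0r => /(_ erefl).
have lt i : (i < n)%N -> (i%:R * h < i.+1%:R * h)%R.
  by move=> _; rewrite ltr_pM2r// ltr_nat.
move=> /(_ lt mA) /= e.
have hh (i : nat) : (i.+1%:R * h - i%:R * h = h)%R.
  by rewrite -mulrBl -natrB// subSnn mul1r.
transitivity (\prod_(i < n) \int[leb2]_(x in A i)
    (gauss2 (i.+1%:R * h - i%:R * h) x)%:E); last first.
  by apply: eq_bigr => i _; rewrite hh.
rewrite -e; congr (P _); apply/seteqP; split => w /= hw i /hw; rewrite inE//.
Qed.

(** Product events form a pi-system on which the joint law of the increments factorises directly;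
    they generate the past. *)
Definition cyl (k : nat) : set (set T) :=
  [set E | exists A : nat -> set RR, (forall i, measurable (A i)) /\
     E = [set w | forall i, (i < k)%N -> A i (incr i w)]].

Lemma cyl_measurable k : cyl k `<=` measurable.
Proof.
move=> _ [A [mA ->]].
rewrite (_ : [set _ | _] = \bigcap_(i in [set i | (i < k)%N]) (incr i @^-1` A i)).
  apply: bigcap_measurableType => i _.
  by rewrite -[X in measurable X]setTI; exact: measurable_incr.
by apply/seteqP; split => w /= hw i /hw.
Qed.

Lemma cyl_setI k : setI_closed (cyl k).
Proof.
move=> _ _ [A [mA ->]] [B [mB ->]]; exists (fun i => A i `&` B i); split.
  by move=> i; exact: measurableI.
apply/seteqP; split => w /=.
  by move=> [hA hB] i ik; split; [exact: hA|exact: hB].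
by move=> hw; split => i /hw[].
Qed.

(** Both sides, as functions of E, are finite measures that agree on the pi-system [cyl k], hence on
    the sigma-algebra it generates. *)
Lemma cyl_indep k (E : set T) (B : set RR) : <<s cyl k >> E -> measurable B ->
  P (E `&` incr k @^-1` B) = P E * P (incr k @^-1` B).
Proof.
move=> sE mB.
have mX : measurable (incr k @^-1` B).
  by rewrite -[X in measurable X]setTI; exact: measurable_incr.
have PB : P (incr k @^-1` B) = \int[leb2]_(x in B) (gauss2 h x)%:E.
  (* Leaving the first k increments free contributes factors that are total masses of Gaussian laws,
     hence 1. *)
  have := @incr_joint k.+1 (fun i => if i == k then B else setT).
  rewrite big_ord_recr /= eqxx big1 ?mul1e; last first.
    move=> i _; rewrite ltn_eqF//.
    have [m mg _] := BM_gauss h0.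
    by have <- := mg setT measurableT; exact: probability_setT.
  move=> <-; last by move=> i; case: ifP.
  congr (P _); apply/seteqP; split => w /=.
    by move=> Bw i; rewrite ltnS leq_eqVlt; case: eqP => [->|].
  by move=> /(_ k (leqnn _)); rewrite eqxx.
have c0 : (0 <= fine (P (incr k @^-1` B)))%R by rewrite fine_ge0.
pose c := NngNum c0.
have cE : P (incr k @^-1` B) = (c%:num)%:E by rewrite fineK// fin_num_measure.
pose m1 := mrestr P mX.
pose m2 := mscale c P.
have m2E F : m2 F = P (incr k @^-1` B) * P F by rewrite /m2 /mscale cE.
suff : m1 E = m2 E by rewrite m2E /m1 /mrestr => ->; rewrite muleC.
apply: (@g_sigma_algebra_measure_unique _ R T (cyl k) (@cyl_measurable k) (fun=> setT)) => //.
- move=> _; exists (fun=> setT); split => //; apply/seteqP; split => w //=.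
- by rewrite bigcup_const.
- exact: cyl_setI.
- move=> _ [A [mA ->]]; rewrite -[RHS]/(m2 _) m2E PB -[LHS]/(m1 _) /m1 /mrestr.
  rewrite incr_joint//.
  have := @incr_joint k.+1 (fun i => if i == k then B else A i).
  rewrite big_ord_recr /= eqxx.
  under eq_bigr => i _ do rewrite ltn_eqF//.
  rewrite muleC => <-; last by move=> i; case: ifP.
  congr (P _); apply/seteqP; split => w /=.
    move=> [Aw Bw] i; rewrite ltnS leq_eqVlt; case: eqP => [->//|_ /=]; exact: Aw.
  move=> hw; split => [i ik|].
    by have := hw i; rewrite ltn_eqF// ltnS => /(_ (ltnW ik)).
  by have := hw k (ltnSn _); rewrite eqxx.
- move=> _; rewrite -[X in X < _]/(m1 _) /m1 /mrestr.
  by rewrite (le_lt_trans (probability_le1 _ _)) ?ltry//; exact: measurableI.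
Qed.

(** [T] with a coarser sigma-algebra, so that dependence on the past alone is expressed as
    measurability on this type. *)
Definition past (k : nat) := g_sigma_algebraType (cyl k).

Lemma past_sub k (E : set T) : <<s cyl k >> E -> measurable E.
Proof.
apply: smallest_sub; last exact: cyl_measurable.
exact: sigma_algebra_measurable.
Qed.

Lemma measurable_id_past k : measurable_fun setT (id : T -> past k).
Proof. by move=> _ E mE; rewrite setTI preimage_id; exact: past_sub mE. Qed.

Lemma past_incr k i : (i < k)%N -> measurable_fun setT (incr i : past k -> RR).
Proof.
move=> ik _ B mB; rewrite setTI; apply: sub_gen_smallest.
exists (fun j => if j == i then B else setT); split.
  by move=> j; case: ifP.
apply/seteqP; split => w /=.
  by move=> Bw j _; case: eqP => [->|].
by move=> /(_ i ik); rewrite eqxx.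
Qed.

Lemma past_skel k j : (j <= k)%N -> measurable_fun setT (skel j : past k -> RR).
Proof.
elim: j => [|j ih] jk.
  rewrite (_ : skel 0 = fun=> (0, 0)%R); first exact: measurable_cst.
  by apply/funext => w; exact: skel0.
rewrite (_ : skel j.+1 = fun w => (skel j w + incr j w)%R); last first.
  by apply/funext => w; exact: skelS.
apply: measurable_add_pair; first exact: ih (ltnW jk).
exact: past_incr.
Qed.

Variables (f : RR -> R) (K : set RR) (c : R).
Hypotheses (mf : measurable_fun setT f) (f0 : forall z, (0 <= f z)%R).
Hypotheses (mK : measurable K) (c0 : (0 <= c)%R).
Hypothesis step : forall k z, K z -> \int[P]_v (f (z + incr k v)%R)%:E <= (f z + c)%:E.

Definition alive (k : nat) : set T := [set w | forall j, (j <= k)%N -> K (skel j w)].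

Lemma past_alive k : measurable (alive k : set (past k)).
Proof.
rewrite (_ : alive k = \bigcap_(j in [set j | (j <= k)%N]) (skel j @^-1` K)).
  apply: bigcap_measurableType => j /= jk.
  by rewrite -[X in measurable X]setTI; exact: (past_skel jk).
by apply/seteqP; split => w /= hw i /hw.
Qed.

Lemma measurable_alive k : measurable (alive k).
Proof. by apply: (@past_sub k); exact: past_alive. Qed.

(** The value of [f] at the first skeleton point outside [K], or at step k if there is none before.
    The recursion tests an event of the past, which replaces the use of a stopping time. *)
Fixpoint stopped (k : nat) (w : T) : R :=
  if k is k'.+1 then if `[< alive k' w >] then f (skel k w) else stopped k' w
  else f (skel 0 w).

Lemma stopped_ge0 k w : (0 <= stopped k w)%R.
Proof. by elim: k => [|k ih] /=; [|case: ifP]. Qed.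

Lemma stopped_alive k w : alive k w -> stopped k w = f (skel k w).
Proof.
case: k => // k /= hw; case: asboolP => // hn; exfalso; apply: hn => j jk.
by apply: hw; exact: leq_trans jk _.
Qed.

Lemma stoppedS k w : stopped k.+1 w =
  (\1_(alive k) w * f (skel k.+1 w) + \1_(~` alive k) w * stopped k w)%R.
Proof.
rewrite /= !indicE in_setC; case: asboolP => hw.
  by rewrite mem_set//= mul1r mul0r addr0.
by rewrite memNset//= mul0r mul1r add0r.
Qed.

Lemma measurable_stopped k : measurable_fun setT (stopped k).
Proof.
elim: k => [|k ih]; first exact: measurableT_comp mf (measurable_skel 0).
rewrite (_ : stopped k.+1 = fun w => (\1_(alive k) w * f (skel k.+1 w) +
    \1_(~` alive k) w * stopped k w)%R); last by apply/funext => w; exact: stoppedS.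
apply: measurable_funD; apply: measurable_funM => //.
- exact: measurable_indic (measurable_alive k).
- exact: measurableT_comp mf (measurable_skel _).
- by apply: measurable_indic; apply: measurableC; exact: measurable_alive.
Qed.

(** On [alive k], an event of the past, the next increment is integrated first with the past frozen
    and [step] applies; elsewhere the value no longer changes. *)
Lemma stopped_step k :
  \int[P]_w (stopped k.+1 w)%:E <= \int[P]_w (stopped k w)%:E + c%:E.
Proof.
have mA := measurable_alive k.
have mi : measurable_fun setT (\1_(alive k) : T -> R) by exact: measurable_indic.
have mi' : measurable_fun setT (\1_(~` alive k) : T -> R).
  by apply: measurable_indic; exact: measurableC.
have mfk j : measurable_fun setT (fun w => f (skel j w)).
  exact: measurableT_comp mf (measurable_skel j).
pose rest w := (\1_(~` alive k) w * stopped k w)%R.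
have mrest : measurable_fun setT (EFin \o rest).
  by apply/measurable_EFinP; apply: measurable_funM => //; exact: measurable_stopped.
have rest0 w : 0 <= (EFin \o rest) w.
  by rewrite lee_fin mulr_ge0 ?stopped_ge0.
pose g j w := (\1_(alive k) w * f (skel j w))%R.
have mg j : measurable_fun setT (EFin \o g j).
  by apply/measurable_EFinP; apply: measurable_funM.
have g0 j w : 0 <= (EFin \o g j) w by rewrite lee_fin mulr_ge0.
have eS : \int[P]_w (stopped k.+1 w)%:E =
    \int[P]_w (g k.+1 w)%:E + \int[P]_w (rest w)%:E.
  rewrite -(ge0_integralD P measurableT (fun w _ => g0 _ w) (mg _) (fun w _ => rest0 w) mrest).
  by apply: eq_integral => w _; rewrite stoppedS EFinD.
have e : \int[P]_w (stopped k w)%:E = \int[P]_w (g k w)%:E + \int[P]_w (rest w)%:E.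
  rewrite -(ge0_integralD P measurableT (fun w _ => g0 _ w) (mg _) (fun w _ => rest0 w) mrest).
  apply: eq_integral => w _; rewrite -EFinD; congr (_%:E).
  rewrite /g /rest !indicE in_setC; have [hw|hw] := pselect (alive k w).
    by rewrite mem_set//= mul1r mul0r addr0 stopped_alive.
  by rewrite memNset//= mul0r mul1r add0r.
rewrite eS e addeAC leeD2r//.
pose phi (p : past k * RR) : \bar R := (\1_(alive k) p.1 * f (skel k p.1 + p.2)%R)%:E.
have mphi : measurable_fun setT phi.
  apply/measurable_EFinP; apply: measurable_funM.
    by apply: measurableT_comp measurable_fst; apply: measurable_indic; exact: past_alive.
  apply: measurableT_comp mf _; apply: measurable_add_pair; last exact: measurable_snd.
  by apply: measurableT_comp measurable_fst; exact: past_skel.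
have phi0 p : 0 <= phi p by rewrite lee_fin mulr_ge0.
have -> : \int[P]_w (g k.+1 w)%:E = \int[P]_w phi (w, incr k w).
  by apply: eq_integral => w _; rewrite /g /phi skelS.
rewrite (indep_fubini (S := id : T -> past k) (X := incr k) _ _ _ mphi phi0)//; first last.
- move=> A B mA' mB; rewrite preimage_id; exact: cyl_indep.
- exact: measurable_incr.
- exact: measurable_id_past.
apply: (@le_trans _ _ (\int[P]_w ((g k w)%:E + c%:E))); last first.
  rewrite (ge0_integralD P measurableT (fun w _ => g0 _ w) (mg _))//.
  rewrite integral_cst// leeD// -[leRHS]mule1 lee_wpmul2l//.
  exact: probability_le1.
apply: ge0_le_integral => //.
- by move=> w _; exact: integral_ge0.
- have mphi' : measurable_fun setT (fun p : T * T => phi (p.1, incr k p.2)).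
    have m1 : measurable_fun setT (fun p : T * T => p.1 : past k).
      by move=> _ E mE; apply: measurable_fst => //; exact: past_sub mE.
    have m2 : measurable_fun setT (fun p : T * T => incr k p.2).
      exact: measurableT_comp (measurable_incr k) measurable_snd.
    exact: measurableT_comp mphi (measurable_fun_pair m1 m2).
  exact: (@measurable_fun_fubini_tonelli_F _ _ _ _ _ P _ mphi').
- exact: emeasurable_funD (mg k) (measurable_cst _).
move=> w _; rewrite /phi /=; have [hw|hw] := pselect (alive k w); last first.
  rewrite integral0_eq; first by apply: adde_ge0; [exact: (g0 k w)|rewrite lee_fin].
  by move=> v _; rewrite indicE memNset// mul0r.
rewrite /g indicE mem_set//=; under eq_integral do rewrite mul1r.
rewrite mul1r -EFinD; apply: step; exact: hw.
Qed.

Lemma stopped_le k : \int[P]_w (stopped k w)%:E <= (f (0, 0)%R + k%:R * c)%:E.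
Proof.
elim: k => [|k ih].
  rewrite mul0r addr0; under eq_integral do rewrite /= skel0.
  rewrite integral_cst// -[leRHS]mule1 lee_wpmul2l ?lee_fin//.
  exact: probability_le1.
apply: le_trans (stopped_step k) _.
apply: le_trans (leeD2r _ ih) _.
by rewrite -EFinD lee_fin -addrA lerD2l -(natr1 k) mulrDl mul1r.
Qed.

End Walk.

(** * From the walk to the Brownian path *)

Section Liminf.
Local Open Scope ereal_scope.
Context d {T : measurableType d} {R : realType} (P : probability T R).

(** The lower limit of a sequence of events. *)
Definition eventually_in (B : nat -> set T) : set T :=
  \bigcup_n \bigcap_(j in [set j | (n <= j)%N]) B j.

Lemma measurable_eventually_in B : (forall n, measurable (B n)) ->
  measurable (eventually_in B).
Proof.
by move=> mB; apply: bigcup_measurable => n _; apply: bigcap_measurableType => j _.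
Qed.

(** Fatou's lemma for events: each tail intersection lies in every later [B n], and P is continuous
    along the increasing union of the tails. *)
Lemma eventually_in_le B (c : R) : (forall n, measurable (B n)) ->
  (forall e, (0 < e)%R -> exists N, forall n, (N <= n)%N -> P (B n) <= (c + e)%:E) ->
  P (eventually_in B) <= c%:E.
Proof.
move=> mB hB.
pose F n := \bigcap_(j in [set j | (n <= j)%N]) B j.
have mF n : measurable (F n) by apply: bigcap_measurableType => j _.
have Fle n : P (F n) <= c%:E.
  apply/lee_addgt0Pr => e e0; rewrite -EFinD; have [N hN] := hB _ e0.
  apply: le_trans (hN (maxn n N) (leq_maxr _ _)).
  by apply: le_measure; rewrite ?inE//; apply: bigcap_inf; exact: leq_maxl.
have cv : (P \o F) n @[n --> \oo] --> P (eventually_in B).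
  apply: nondecreasing_cvg_mu => //; first exact: measurable_eventually_in.
  move=> n m nm; apply/subsetPset => w /= hw j mj; apply: hw.
  exact: leq_trans nm mj.
rewrite -(cvg_lim _ cv)//; apply: lime_le; first by apply/cvg_ex; exists (P (eventually_in B)).
exact: nearW.
Qed.

End Liminf.

Section Path.
Context {R : realType}.

Lemma within_ray_eps {V : normedModType R} (g : R -> V) : {within `[0, +oo[, continuous g} ->
  forall t e, 0 <= t -> 0 < e ->
  exists2 d, 0 < d & forall s, 0 <= s -> `|s - t| < d -> `|g s - g t| < e.
Proof.
move=> /subspace_continuousP cg t e t0 e0.
have t1 : `[0, +oo[%classic t by rewrite /= in_itv/= t0.
have /cvgrPdist_lt/(_ _ e0) := cg t t1.
rewrite near_withinE => -[d /= d0 hd]; exists d => // s s0 st.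
rewrite distrC; apply: hd; last by rewrite /= in_itv/= s0.
by rewrite /ball_/= distrC.
Qed.

Lemma within_ray_comp {V W : topologicalType} (g : R -> V) (F : V -> W) :
  {within `[0, +oo[, continuous g} -> continuous F ->
  {within `[0, +oo[, continuous (F \o g)}.
Proof.
move=> cg cF; apply/subspace_continuousP => t t0.
have /subspace_continuousP := cg => /(_ t t0) gt.
exact: (cvg_comp _ _ gt (cF _)).
Qed.

Lemma positive_min (g : R -> R) (b : R) : {within `[0, +oo[, continuous g} ->
  (forall s, 0 <= s <= b -> 0 < g s) ->
  exists2 c, 0 < c & forall s, 0 <= s <= b -> c <= g s.
Proof.
move=> cg gp; have [b0|b0] := ltP b 0.
  by exists 1 => // s /andP[s0 sb]; have := lt_le_trans (le_lt_trans sb b0) s0; rewrite ltxx.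
have cg' : {within `[0, b], continuous g}.
  apply: continuous_subspaceW cg => s /=; rewrite !in_itv/= => /andP[->]//.
have [c cI hc] := EVT_min b0 cg'.
exists (g c); first by apply: gp; move: cI; rewrite in_itv.
by move=> s sI; apply: hc; rewrite in_itv.
Qed.

End Path.

(** * Hitting probabilities bounded by the value at the origin *)

Section Hit.
Context d {T : measurableType d} {R : realType} (P : probability T R).
Variable W : R -> T -> R * R.
Hypothesis BM : is_planar_BM P W.
Local Notation RR := (measurableTypeR R * measurableTypeR R)%type.

Lemma stopped_first (f : RR -> R) (K : set RR) h (k n : nat) (w : T) : (k <= n)%N ->
  (forall j, (j < k)%N -> K (skel W h j w)) -> ~ K (skel W h k w) ->
  stopped W h f K n w = f (skel W h k w).
Proof.
move=> kn hk hK; elim: n kn => [|n ih].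
  by rewrite leqn0 => /eqP k0; rewrite k0.
rewrite leq_eqVlt => /orP[/eqP kn|kn] /=.
  move: hk hK; rewrite kn => hk hK; case: asboolP => [_|na]; first by [].
  by exfalso; apply: na => j jk; apply: hk.
case: asboolP => [al|_]; last exact: ih.
by exfalso; apply: hK; apply: al.
Qed.

Lemma continuous_norm2 : continuous (@norm2 R : R * R -> R).
Proof.
have c1 : continuous (fun x : R * R => x.1 ^+ 2).
  by move=> y; apply: (@continuous_comp _ _ _ fst (fun t : R => t ^+ 2));
    [exact: cvg_fst|exact: exprn_continuous].
have c2 : continuous (fun x : R * R => x.2 ^+ 2).
  by move=> y; apply: (@continuous_comp _ _ _ snd (fun t : R => t ^+ 2));
    [exact: cvg_snd|exact: exprn_continuous].
move=> x.
apply: (@continuous_comp _ _ _ (fun x : R * R => x.1 ^+ 2 + x.2 ^+ 2) Num.sqrt).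
  exact: cvgD (c1 x) (c2 x).
exact: sqrt_continuous.
Qed.

(** To be instantiated with [f] equal to [slit_hit] and to [slit_miss], and with [D] the rescaled
    [slitD]. No continuity of [f] is asked; the constant of [fharm] may blow up as e tends to 0. *)
Variables (f D : RR -> R).
Hypotheses (mf : measurable_fun setT f) (f01 : forall z, 0 <= f z <= 1).
Hypotheses (mD : measurable_fun setT D) (cD : continuous (D : R * R -> R)).
Hypothesis fharm : forall e, 0 < e -> exists2 C, 0 <= C &
  forall z y : RR, norm2 z <= 2 -> e <= D z ->
    f (z + y) + f (z + rot90 y) + f (z - y) + f (z - rot90 y)
      <= 4 * f z + C * norm2 y ^+ 3.

(** Radius 2 leaves room around the closed unit disk, where the path runs, so for a fine mesh the
    walk leaves because [D] gets small. *)
Definition zone (n : nat) : set RR := [set z | norm2 z <= 2 /\ n.+1%:R^-1 <= D z].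
(** A square, so that sqrt([mesh m]) is 1 / (m + 1) and n (m + 1)^2 steps last exactly until time
    n. *)
Definition mesh (m : nat) : R := (m.+1%:R ^+ 2)^-1.
Definition stopval (n m : nat) : T -> R :=
  stopped W (mesh m) f (zone n) (n * m.+1 ^ 2).

Lemma mesh_gt0 m : 0 < mesh m.
Proof. by rewrite invr_gt0 exprn_gt0// ltr0n. Qed.

Lemma measurable_zone n : measurable (zone n).
Proof.
have -> : zone n = [set z | norm2 z <= 2] `&` [set z | n.+1%:R^-1 <= D z].
  by apply/seteqP; split.
apply: measurableI.
  rewrite (_ : [set _ | _] = setT `&` @norm2 R @^-1` [set` `]-oo, 2]]).
    by apply: measurable_norm2.
  by rewrite setTI; apply/seteqP; split => z /=; rewrite in_itv.
rewrite (_ : [set _ | _] = setT `&` D @^-1` [set` `[n.+1%:R^-1, +oo[]).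
  by apply: mD.
by rewrite setTI; apply/seteqP; split => z /=; rewrite in_itv/= andbT.
Qed.

(** Each of the n (m + 1)^2 steps costs 16 C / (m + 1)^3. [C] depends on n through the zone, so only
    m may vary here. *)
Lemma stopval_mean n : exists2 C, 0 <= C & forall m,
  (\int[P]_w (stopval n m w)%:E <= (f (0, 0) + n%:R * (16 * C) / m.+1%:R)%:E)%E.
Proof.
have n0 : (0 : R) < n.+1%:R^-1 by rewrite invr_gt0.
have [C C0 hC] := fharm n0; exists C => // m.
have h0 := mesh_gt0 m; have m0 : (0 : R) < m.+1%:R by [].
have hs : Num.sqrt (mesh m) = m.+1%:R^-1.
  by rewrite /mesh -exprVn sqrtr_sqr ger0_norm// invr_ge0 ltW.
have f0 z : 0 <= f z by case/andP: (f01 z).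
pose c := 16 * C * Num.sqrt (mesh m) ^+ 3.
have c0 : 0 <= c by rewrite mulr_ge0 ?mulr_ge0// exprn_ge0// sqrtr_ge0.
have step k z : zone n z -> (\int[P]_v (f (z + incr W (mesh m) k v))%:E <= (f z + c)%:E)%E.
  move=> [z2 zD].
  have mX := measurable_incr BM h0 k.
  pose X : {mfun T >-> RR} := mfun_Sub (mem_set mX).
  (* The law of variance 2 h needed for the third moment is that of [W] at time 2 h. *)
  have [m2 gm2 _] := BM_gauss BM (mulr_gt0 (ltr0n _ 2) h0).
  have gm : gauss_law (mesh m) (distribution P X).
    move=> A mA; rewrite /distribution /pushforward.
    have := @incr_joint _ _ _ P _ BM _ h0 k.+1 (fun i => if i == k then A else setT).
    rewrite big_ord_recr /= eqxx big1 ?mul1e; last first.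
      move=> i _; rewrite ltn_eqF//.
      have [m1 mg _] := BM_gauss BM h0.
      by have <- := mg setT measurableT; exact: probability_setT.
    move=> <-; last by move=> i; case: ifP.
    congr (P _); apply/seteqP; split => w /=.
      by move=> Bw i; rewrite ltnS leq_eqVlt; case: eqP => [->|].
    by move=> /(_ k (leqnn _)); rewrite eqxx.
  have := gauss_one_step h0 gm (probability_setT _) gm2 (probability_setT _) mf f0 C0 (fun y => hC z y z2 zD).
  apply: le_trans; rewrite ge0_integral_distribution//.
  - apply/measurable_EFinP; exact: measurableT_comp mf (measurable_add2 z).
  - by move=> y; rewrite lee_fin.
apply: le_trans (stopped_le BM h0 mf f0 (measurable_zone n) c0 step _) _.
rewrite lee_fin lerD2l /c hs natrM natrX le_eqVlt; apply/orP; left; apply/eqP.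
by field; rewrite gt_eqF.
Qed.

Lemma measurable_stopval n m : measurable_fun setT (stopval n m).
Proof. exact: (measurable_stopped BM (mesh_gt0 m) mf (measurable_zone n)). Qed.

(** Before t0 - a / 2 compactness keeps [D] above c, so the walk cannot leave the zone that early
    once 1 / (n + 1) < c; a skeleton time just after t0 has [D] below 1 / (n + 1), so it leaves by
    then. It is thus stopped close to [W t0 w] with [D] small, where [f] is at least 1 - e. *)
Lemma stopval_path (w : T) (t0 e : R) : 0 <= t0 -> 0 < e ->
  D (W t0 w) = 0 -> (forall s, 0 <= s < t0 -> 0 < D (W s w)) ->
  (forall s, 0 <= s <= t0 -> norm2 (W s w) < 2) ->
  (exists2 d, 0 < d & forall z : R * R, `|z - W t0 w| < d -> D z < d -> 1 - e <= f z) ->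
  exists n0, forall n, (n0 <= n)%N -> exists m0, forall m, (m0 <= m)%N ->
    1 - e <= stopval n m w.
Proof.
move=> t00 e0 D0 Dpos n2 [d0 d00 hd].
case: BM => _ _ cW _.
have cDW := within_ray_comp (cW w) cD.
have cNW := within_ray_comp (cW w) continuous_norm2.
have [a1 a10 ha1] := within_ray_eps (cW w) t00 d00.
have t00' : 0 <= t0 <= t0 by rewrite t00 lexx.
have g0 : 0 < 2 - norm2 (W t0 w) by rewrite subr_gt0 n2.
have [a2 a20 ha2] := within_ray_eps cNW t00 g0.
pose a := Num.min a1 a2; have a0 : 0 < a by rewrite lt_min a10.
have [c c0 hc] : exists2 c, 0 < c & forall s, 0 <= s <= t0 - a / 2 -> c <= (D \o W ^~ w) s.
  apply: positive_min cDW _ => s /andP[s0 st]; apply: Dpos; rewrite s0/=; lra.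
have cd0 : 0 < Num.min c d0 by rewrite lt_min c0.
pose n1 := (Num.bound (t0 + a)); pose n2' := (Num.bound (Num.min c d0)^-1).
exists (maxn n1 n2') => n; rewrite geq_max => /andP[n1n n2n].
(* The walk is run up to time n, which must exceed the time at which it leaves the zone. *)
have tn : t0 + a < n%:R.
  apply: lt_le_trans (_ : n1%:R <= _); last by rewrite ler_nat.
  by rewrite archi_boundP// addr_ge0// ltW.
have dn : n.+1%:R^-1 < Num.min c d0.
  rewrite -[ltRHS]invrK ltf_pV2 ?posrE ?invr_gt0//.
  apply: lt_le_trans (_ : n2'%:R <= _).
    by rewrite archi_boundP// invr_ge0 ltW.
  by rewrite ler_nat; exact: leq_trans n2n _.
have [dnc dnd] : n.+1%:R^-1 < c /\ n.+1%:R^-1 < d0.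
  by move: dn; rewrite lt_min => /andP.
have dn0 : (0 : R) < n.+1%:R^-1 by rewrite invr_gt0.
have [b1 b10 hb1] := within_ray_eps cDW t00 dn0.
pose b := Num.min b1 (a / 2); have b0 : 0 < b by rewrite lt_min b10 divr_gt0.
exists (Num.bound b^-1) => m hm.
have m0 : (0 : R) < m.+1%:R by [].
have hb : mesh m < b.
  rewrite -[ltRHS]invrK ltf_pV2 ?posrE ?invr_gt0 ?exprn_gt0//.
  apply: lt_le_trans (_ : m.+1%:R <= _).
    apply: lt_le_trans (archi_boundP _) _; first by rewrite invr_ge0 ltW.
    by rewrite ler_nat; exact: leq_trans hm _.
  by rewrite -natrX ler_nat expnS leq_pmulr// expn_gt0.
have h0 := mesh_gt0 m.
(* A grid time within one mesh after t0; by continuity [D] is below 1 / (n + 1) there. *)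
have [k0 /andP[k01 k02]] : exists k : nat, t0 <= k%:R * mesh m < t0 + b.
  pose q := t0 / mesh m.
  have q0 : 0 <= q by rewrite divr_ge0// ltW.
  exists (Num.truncn q).+1.
  have /andP[q1 q2] := truncn_itv q0.
  have tq : t0 = q * mesh m by rewrite /q divfK// gt_eqF.
  apply/andP; split.
    by rewrite {1}tq ler_pM2r// ltW.
  rewrite -natr1 mulrDl mul1r {1}tq; apply: ler_ltD => //.
  by rewrite ler_pM2r.
have nK : exists k, ~~ `[< zone n (skel W (mesh m) k w) >].
  exists k0; apply/asboolPn => -[_]; apply/negP; rewrite -ltNge.
  have k00 : 0 <= k0%:R * mesh m by rewrite mulr_ge0// ltW.
  have := hb1 _ k00; rewrite /= D0 subr0 => /(_ _)/(le_lt_trans (ler_norm _)); apply.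
  rewrite ger0_norm ?subr_ge0// ltrBlDl (lt_le_trans k02)// lerD2l.
  by rewrite ge_min lexx.
case: (ex_minnP nK) => k /asboolPn kK kmin.
have kk0 : (k <= k0)%N.
  apply: kmin; apply/asboolPn => -[_]; apply/negP; rewrite -ltNge.
  have k00 : 0 <= k0%:R * mesh m by rewrite mulr_ge0// ltW.
  have := hb1 _ k00; rewrite /= D0 subr0 => /(_ _)/(le_lt_trans (ler_norm _)); apply.
  rewrite ger0_norm ?subr_ge0// ltrBlDl (lt_le_trans k02)// lerD2l.
  by rewrite ge_min lexx.
have kh0 : 0 <= k%:R * mesh m by rewrite mulr_ge0// ltW.
have kb : k%:R * mesh m < t0 + a / 2.
  apply: le_lt_trans (_ : k0%:R * mesh m < _).
    by rewrite ler_pM2r// ler_nat.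
  by rewrite (lt_le_trans k02)// lerD2l ge_min lexx orbT.
have ka : t0 - a / 2 < k%:R * mesh m.
  rewrite ltNge; apply/negP => kle; apply: kK; split.
    by apply: ltW; apply: n2; rewrite kh0/=; lra.
  by apply: ltW; apply: lt_le_trans dnc _; apply: hc; rewrite kh0.
have near_t0 : `|k%:R * mesh m - t0| < a by rewrite ltr_norml; apply/andP; lra.
have kn2 : norm2 (W (k%:R * mesh m) w) < 2.
  have := ha2 _ kh0; rewrite /= => /(_ _)/(le_lt_trans (ler_norm _)).
  rewrite ltrBlDr subrK; apply; apply: lt_le_trans near_t0 _.
  by rewrite ge_min lexx orbT.
rewrite /stopval (@stopped_first _ _ _ k)//.
- apply: hd.
    by apply: ha1 => //; apply: lt_le_trans near_t0 _; rewrite ge_min lexx.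
  rewrite ltNge; apply/negP => dle; apply: kK; split; first exact: ltW.
  by apply: le_trans dle; exact: ltW.
- rewrite -(ler_nat R) natrM natrX -ler_pdivrMr ?exprn_gt0//.
  by apply: ltW; apply: lt_trans kb _; apply: lt_trans tn; rewrite ltrD2l; lra.
- move=> j jk; apply: contrapT => /asboolPn/kmin.
  by rewrite leqNgt jk.
Qed.

(** Markov's inequality bounds the probability that [stopval n m] is at least 1 - e by (f(0,0) +
    o(1)) / (1 - e). [A] is contained in the lower limit over n of the lower limits over m of these
    events, and e tends to 0 at the end. *)
Lemma hit_le (A : set T) : measurable A ->
  (forall w, A w -> exists t0, [/\ 0 <= t0, D (W t0 w) = 0,
    (forall s, 0 <= s < t0 -> 0 < D (W s w)),
    (forall s, 0 <= s <= t0 -> norm2 (W s w) < 2) &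
    forall e, 0 < e -> exists2 d, 0 < d &
      forall z : R * R, `|z - W t0 w| < d -> D z < d -> 1 - e <= f z]) ->
  (P A <= (f (0, 0))%:E)%E.
Proof.
move=> mA hA; have f00 : 0 <= f (0, 0) by case/andP: (f01 (0, 0)).
have key e : 0 < e < 1 -> (P A <= (f (0, 0) / (1 - e))%:E)%E.
  move=> /andP[e0 e1]; have e10 : 0 < 1 - e by rewrite subr_gt0.
  pose B n m := [set w | 1 - e <= stopval n m w].
  have mB n m : measurable (B n m).
    rewrite (_ : B n m = setT `&` stopval n m @^-1` [set` `[1 - e, +oo[]).
      by apply: measurable_stopval.
    by rewrite setTI; apply/seteqP; split => z /=; rewrite in_itv/= andbT.
  pose C n := eventually_in (B n).
  have mC n : measurable (C n) by exact: measurable_eventually_in.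
  have PC n : (P (C n) <= (f (0, 0) / (1 - e))%:E)%E.
    apply: eventually_in_le => // x x0.
    have [c c0 hc] := stopval_mean n.
    pose y := n%:R * (16 * c) / (1 - e) / x.
    have y0 : 0 <= y by rewrite !divr_ge0 ?mulr_ge0// ltW.
    exists (Num.bound y) => m ym.
    have ym' : y < m.+1%:R.
      by apply: lt_le_trans (archi_boundP y0) _; rewrite ler_nat; exact: leq_trans ym _.
    have mkv : ((1 - e)%:E * P (B n m) <= \int[P]_w (stopval n m w)%:E)%E.
      have -> : (P (B n m) = \int[P]_x (\1_(B n m) x)%:E)%E by rewrite integral_indic// setIT.
      have mi : measurable_fun setT (fun x => (\1_(B n m) x : R)%:E).
        by apply/measurable_EFinP; exact: measurable_indic.
      rewrite -ge0_integralZl//; last by rewrite lee_fin ltW.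
      apply: ge0_le_integral => //.
      - by move=> w _; rewrite -EFinM lee_fin mulr_ge0// ltW.
      - exact: emeasurable_funM.
      - by apply/measurable_EFinP; exact: measurable_stopval.
      move=> w _; rewrite -EFinM lee_fin indicE.
      case: (boolP (w \in B n m)) => [|_]; first by rewrite inE mulr1.
      by rewrite mulr0; apply: stopped_ge0 => z; case/andP: (f01 z).
    have := le_trans mkv (hc m).
    rewrite -lee_pdivlMl// muleC => /le_trans; apply.
    rewrite lee_fin mulrDl lerD2l mulrAC ler_pdivrMr//.
    by rewrite [leRHS]mulrC -ler_pdivrMr// ltW.
  apply: le_trans (eventually_in_le mC _); last first.
    by move=> x x0; exists 0%N => n _; apply: le_trans (PC n) _; rewrite lee_fin lerDl ltW.
  apply: le_measure; rewrite ?inE//; first exact: measurable_eventually_in.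
  move=> w Aw; have [t0 [t00 D0 Dpos n2 hd]] := hA _ Aw.
  have [n0 hn0] := stopval_path t00 e0 D0 Dpos n2 (hd _ e0).
  exists n0 => // n /= /hn0[m0 hm0]; exists m0 => // m /= /hm0.
have PA1 := probability_le1 P mA.
apply/lee_addgt0Pr => x x0.
have : P A \is a fin_num by exact: fin_num_measure.
move: key PA1; case: (P A) => [p| |] // key; rewrite -EFinD !lee_fin => p1 _.
(* From p (1 - e) <= f(0,0) and p <= 1 one gets p <= f(0,0) + e. *)
pose e := Num.min (2^-1) x.
have e0 : 0 < e by rewrite lt_min x0 andbT invr_gt0.
have e1 : e <= 2^-1 by rewrite ge_min lexx.
have ex : e <= x by rewrite ge_min lexx orbT.
have e01 : 0 < e < 1 by rewrite e0/=; lra.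
have := key _ e01; rewrite lee_fin ler_pdivlMr; last lra.
nra.
Qed.

End Hit.

(** * Continuity and measurability of the slit functions *)

Section Regular.
Context {R : realType}.
Local Notation RR := (measurableTypeR R * measurableTypeR R)%type.
Implicit Types (f g : RR -> R) (F G : RR -> R[i]).

(** Continuity is needed along paths and measurability for integration; both pass through the same
    operations, so they are carried as a pair. *)
Definition reg f := continuous (f : R * R -> R) /\ measurable_fun setT f.

Lemma reg_cst a : reg (fun=> a).
Proof. by split; [move=> x; exact: cvg_cst|exact: measurable_cst]. Qed.

Lemma reg_fst : reg fst.
Proof. by split; [move=> x; exact: cvg_fst|exact: measurable_fst]. Qed.

Lemma reg_snd : reg snd.
Proof. by split; [move=> x; exact: cvg_snd|exact: measurable_snd]. Qed.

Lemma regD f g : reg f -> reg g -> reg (fun x => f x + g x).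
Proof.
move=> [cf mf] [cg mg]; split; last exact: measurable_funD.
by move=> x; apply: cvgD; [exact: cf|exact: cg].
Qed.

Lemma regM f g : reg f -> reg g -> reg (fun x => f x * g x).
Proof.
move=> [cf mf] [cg mg]; split; last exact: measurable_funM.
by move=> x; apply: cvgM; [exact: cf|exact: cg].
Qed.

Lemma regN f : reg f -> reg (fun x => - f x).
Proof.
move=> [cf mf]; split; last exact: measurable_funN.
by move=> x; apply: cvgN; exact: cf.
Qed.

Lemma regB f g : reg f -> reg g -> reg (fun x => f x - g x).
Proof. by move=> rf rg; exact: regD rf (regN rg). Qed.

Lemma reg_comp (h : R -> R) f : continuous h -> reg f -> reg (fun x => h (f x)).
Proof.
move=> ch [cf mf]; split.
  by move=> x; apply: (@continuous_comp _ _ _ (f : R * R -> R) h); [exact: cf|exact: ch].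
by apply: measurableT_comp mf; exact: continuous_measurable_fun.
Qed.

Definition creg F := reg (fun x => cRe (F x)) /\ reg (fun x => cIm (F x)).

Lemma creg_cst a : creg (fun=> a).
Proof. by split; exact: reg_cst. Qed.

Lemma eq_reg f g : f =1 g -> reg f -> reg g.
Proof. by move=> /funext ->. Qed.

Lemma cregD F G : creg F -> creg G -> creg (fun x => F x + G x).
Proof.
move=> [f1 f2] [g1 g2]; split.
  by apply: eq_reg (regD f1 g1) => x; rewrite raddfD.
by apply: eq_reg (regD f2 g2) => x; rewrite raddfD.
Qed.

Lemma cregN F : creg F -> creg (fun x => - F x).
Proof.
move=> [f1 f2]; split.
  by apply: eq_reg (regN f1) => x; rewrite raddfN.
by apply: eq_reg (regN f2) => x; rewrite raddfN.
Qed.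

Lemma cregM F G : creg F -> creg G -> creg (fun x => F x * G x).
Proof.
move=> [f1 f2] [g1 g2]; split.
  apply: eq_reg (regB (regM f1 g1) (regM f2 g2)) => x.
  by case: (F x) => a b; case: (G x) => c d.
apply: eq_reg (regD (regM f1 g2) (regM f2 g1)) => x.
by case: (F x) => a b; case: (G x) => c d /=.
Qed.

Lemma cregJ F : creg F -> creg (fun x => (F x)^*%C).
Proof.
move=> [f1 f2]; split; first by apply: eq_reg f1 => x; case: (F x).
by apply: eq_reg (regN f2) => x; case: (F x).
Qed.

Lemma creg_nrm F : creg F -> reg (fun x => nrm (F x)).
Proof.
move=> [f1 f2]; apply: eq_reg (reg_comp (@sqrt_continuous R) (regD (regM f1 f1) (regM f2 f2))) => x.
by case: (F x) => a b /=; rewrite !expr2.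
Qed.

Definition cplx (x : RR) : R[i] := Complex x.1 x.2.

Lemma creg_cplx : creg cplx.
Proof. by split; [exact: reg_fst|exact: reg_snd]. Qed.

Lemma nrm_cplx x : nrm (cplx x) = norm2 x. Proof. by []. Qed.

Lemma cplxD (x y : RR) : cplx (x + y) = cplx x + cplx y. Proof. by []. Qed.
Lemma cplxN (x : RR) : cplx (- x) = - cplx x. Proof. by []. Qed.
Lemma cplx_rot90 (x : RR) : cplx (rot90 x) = 'i%C * cplx x.
Proof. by rewrite /cplx /rot90; simpc. Qed.

End Regular.

Section SlitPlane.
Context {R : realType} (r : R) (k : R[i]).
Hypotheses (r01 : 0 < r < 1) (k1 : nrm k <= 1).
Local Notation RR := (measurableTypeR R * measurableTypeR R)%type.
(** [k] will be r / x: the plane is turned and scaled so that x lands on the tip r of the slit. *)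
Let Z (x : RR) : R[i] := k * cplx x.

Let cregZ : creg Z. Proof. exact: cregM (creg_cst _) creg_cplx. Qed.

Let cregQ : creg (fun x => slitQ r (Z x)).
Proof.
apply: cregM; first exact: cregD (creg_cst _) (cregN cregZ).
exact: cregD (creg_cst _) (cregN (cregM (creg_cst _) cregZ)).
Qed.

Lemma reg_slitD : reg (fun x => slitD r (Z x)).
Proof.
have c1J : creg (fun x => 1 + (Z x)^*%C).
  by apply: cregD (creg_cst _) _; exact: cregJ cregZ.
have cP : creg (fun x => slitP r (Z x)).
  exact: (cregM cregQ (cregM c1J c1J)).
apply: (reg_comp (@sqrt_continuous R)).
by apply: regM (reg_cst _); exact: regD (creg_nrm cP) (proj1 cP).
Qed.

Lemma reg_slitN : reg (fun x => slitN r (Z x)).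
Proof.
apply: regB (creg_nrm cregQ) (regM (reg_cst _) _).
have c1 := creg_nrm (cregD (creg_cst 1) cregZ).
by apply: eq_reg (regM c1 c1) => x; rewrite expr2.
Qed.

(* The value 1 where [slitD] = 0 is right near the target (the slit, resp. the
   circle) and harmless elsewhere, as only upper bounds are derived from it. *)
Definition slit_hit (x : RR) : R :=
  if slitD r (Z x) == 0 then 1 else slit_harm r (Z x).

Definition slit_miss (x : RR) : R :=
  if slitD r (Z x) == 0 then 1 else 1 - slit_harm r (Z x).

Lemma slit_hit_bound x : 0 <= slit_hit x <= 1.
Proof.
by rewrite /slit_hit; case: ifP => _; [rewrite ler01 lexx|exact: slit_harm_bound].
Qed.

Lemma slit_miss_bound x : 0 <= slit_miss x <= 1.
Proof.
rewrite /slit_miss; case: ifP => _; first by rewrite ler01 lexx.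
by have := slit_harm_bound r (Z x); lra.
Qed.

(** The reciprocal of [slitD] is rewritten as exp(- ln [slitD]), which agrees with it where [slitD]
    is positive; the test covers the zeros. *)
Lemma measurable_slit (a b : R) : measurable_fun setT
  (fun x : RR => if slitD r (Z x) == 0 then 1 else a + b * slit_harm r (Z x)).
Proof.
have [_ mD] := reg_slitD; have [_ mN] := reg_slitN.
rewrite (_ : (fun _ => _) = (fun x => if slitD r (Z x) == 0 then 1 else
   a + b * (2^-1 - atan (slitN r (Z x) * ((1 - r)^-1 * expR (- ln (slitD r (Z x))))) / pi))).
  apply: measurable_fun_ifT => //; first exact: measurable_fun_eqr.
  apply: measurable_funD => //; apply: measurable_funM => //.
  apply: measurable_funB => //; apply: measurable_funM => //.
  apply: measurableT_comp; first by apply: continuous_measurable_fun => x; exact: continuous_atan.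
  apply: measurable_funM => //; apply: measurable_funM => //.
  apply: measurableT_comp => //; apply: measurable_funN.
  by apply: measurableT_comp => //; exact: measurable_ln.
apply/funext => x; case: eqP => // /eqP D0; rewrite /slit_harm.
by rewrite expRN lnK ?posrE ?lt0r ?D0 ?slitD_ge0// invfM.
Qed.

Lemma measurable_slit_hit : measurable_fun setT slit_hit.
Proof.
have := measurable_slit 0 1; congr (measurable_fun _ _); apply/funext => x.
by rewrite /slit_hit add0r mul1r.
Qed.

Lemma measurable_slit_miss : measurable_fun setT slit_miss.
Proof.
have := measurable_slit 1 (-1); congr (measurable_fun _ _); apply/funext => x.
by rewrite /slit_miss mulN1r.
Qed.

(** The sign s = 1 gives the probability of hitting and s = -1 that of missing; [g] is the argument
    of the conformal image, with any value in [-pi/2, pi/2] at zeros of [slitD]. *)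
Lemma slit_sum4_plane (s : R) (g : R[i] -> R) (e : R) : `|s| = 1 -> 0 < e ->
  (forall z, `|g z| <= pi / 2) ->
  (forall z, 0 < slitD r z -> g z = (slit_harm r z - 2^-1) * pi) ->
  let f x := 2^-1 + s * g (Z x) / pi in
  exists2 C, 0 <= C & forall x y : RR, norm2 x <= 2 -> e <= slitD r (Z x) ->
    f (x + y) + f (x + rot90 y) + f (x - y) + f (x - rot90 y)
      <= 4 * f x + C * norm2 y ^+ 3.
Proof.
move=> s1 e0 gb gD f; have [C C0 hC] := slit_sum4 r01 e0 gb gD.
have p0 := pi_gt0 R; exists (C / pi); first by rewrite divr_ge0// ltW.
move=> x y x2 xe.
have Zx2 : nrm (Z x) <= 2.
  by rewrite /Z nrmM; apply: le_trans x2; rewrite nrm_cplx ler_piMl ?sqrtr_ge0.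
have := hC (Z x) (Z y) Zx2 xe; rewrite /sum4.
have -> : Z x + Z y = Z (x + y) by rewrite /Z cplxD mulrDr.
have -> : Z x - Z y = Z (x - y) by rewrite /Z cplxD cplxN mulrDr mulrN.
have -> : Z x + 'i%C * Z y = Z (x + rot90 y).
  by rewrite /Z cplxD cplx_rot90 mulrDr (mulrCA 'i%C).
have -> : Z x - 'i%C * Z y = Z (x - rot90 y).
  by rewrite /Z cplxD cplxN cplx_rot90 mulrDr mulrN (mulrCA 'i%C).
move=> h.
have y3 : nrm (Z y) ^+ 3 <= norm2 y ^+ 3.
  rewrite lerXn2r ?nnegrE ?nrm_ge0 ?sqrtr_ge0// /Z nrmM nrm_cplx.
  by rewrite ler_piMl ?sqrtr_ge0.
set S := g (Z (x + y)) + _ + _ + _ - _ in h.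
have sS : s * S <= C * norm2 y ^+ 3.
  apply: le_trans (ler_norm _) _; rewrite normrM s1 mul1r.
  by apply: le_trans h _; rewrite ler_wpM2l.
have -> : f (x + y) + f (x + rot90 y) + f (x - y) + f (x - rot90 y) = 4 * f x + s * S / pi.
  rewrite /f /S; move: p0; generalize (pi : R) => p p0; field.
  by rewrite gt_eqF.
by rewrite lerD2l (mulrAC C) ler_wpM2r// invr_ge0 ltW.
Qed.

Lemma slit_hit_sum4 e : 0 < e ->
  exists2 C, 0 <= C & forall x y : RR, norm2 x <= 2 -> e <= slitD r (Z x) ->
    slit_hit (x + y) + slit_hit (x + rot90 y) + slit_hit (x - y) + slit_hit (x - rot90 y)
      <= 4 * slit_hit x + C * norm2 y ^+ 3.
Proof.
move=> e0; have p0 := pi_gt0 R.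
(* The extreme value pi / 2 makes 1/2 + g / pi equal to 1 at zeros of [slitD]. *)
pose g z := if slitD r z == 0 then pi / 2 else (slit_harm r z - 2^-1) * pi.
have gb z : `|g z| <= pi / 2.
  rewrite /g; case: ifP => _; first by rewrite ger0_norm// divr_ge0// ltW.
  by have /andP[? ?] := slit_harm_bound r z; rewrite ler_norml; apply/andP; nra.
have gD z : 0 < slitD r z -> g z = (slit_harm r z - 2^-1) * pi.
  by rewrite /g => /gt_eqF ->.
have := slit_sum4_plane (normr1 _) e0 gb gD.
have -> : (fun x => 2^-1 + 1 * g (Z x) / pi) = slit_hit; last by [].
apply/funext => x; rewrite /slit_hit /g mul1r; case: ifP => _.
  by move: p0; generalize (pi : R) => p p0; field; rewrite gt_eqF.
by rewrite mulfK ?gt_eqF// addrC subrK.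
Qed.

Lemma slit_miss_sum4 e : 0 < e ->
  exists2 C, 0 <= C & forall x y : RR, norm2 x <= 2 -> e <= slitD r (Z x) ->
    slit_miss (x + y) + slit_miss (x + rot90 y) + slit_miss (x - y) + slit_miss (x - rot90 y)
      <= 4 * slit_miss x + C * norm2 y ^+ 3.
Proof.
move=> e0; have p0 := pi_gt0 R.
(* With the sign s = -1, the value 1 at zeros of [slitD] requires - pi / 2. *)
pose g z := if slitD r z == 0 then - (pi / 2) else (slit_harm r z - 2^-1) * pi.
have gb z : `|g z| <= pi / 2.
  rewrite /g; case: ifP => _; first by rewrite normrN ger0_norm// divr_ge0// ltW.
  by have /andP[? ?] := slit_harm_bound r z; rewrite ler_norml; apply/andP; nra.
have gD z : 0 < slitD r z -> g z = (slit_harm r z - 2^-1) * pi.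
  by rewrite /g => /gt_eqF ->.
have := slit_sum4_plane (normrN1 _) e0 gb gD.
have -> : (fun x => 2^-1 + -1 * g (Z x) / pi) = slit_miss; last by [].
apply/funext => x; rewrite /slit_miss /g mulN1r; case: ifP => _.
  by move: p0; generalize (pi : R) => p p0; field; rewrite gt_eqF.
by rewrite mulNr mulfK ?gt_eqF//; field.
Qed.

Lemma reg_near (f : RR -> R) (x : RR) e : reg f -> 0 < e ->
  exists2 d, 0 < d & forall y : R * R, `|y - (x : R * R)| < d -> `|f y - f x| < e.
Proof.
move=> [cf _] e0; have /cvgrPdist_lt/(_ _ e0) := cf x.
move=> /nbhs_ballP[d /= d0 hd]; exists d => // y yd; rewrite distrC; apply: hd.
by rewrite -ball_normE /ball_/= distrC.
Qed.

Lemma slit_hit_bnd (x : RR) e : slitN r (Z x) < 0 -> 0 < e ->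
  exists2 d, 0 < d & forall y : R * R, `|y - (x : R * R)| < d -> slitD r (Z y) < d ->
    1 - e <= slit_hit y.
Proof.
move=> Nx e0; pose c := - slitN r (Z x) / 2.
have c0 : 0 < c by rewrite divr_gt0// oppr_gt0.
have [d1 d10 h1] := reg_near x reg_slitN c0.
have [d2 d20 h2] := slit_harm_bnd r01 c0 e0.
exists (Num.min d1 d2); first by rewrite lt_min d10.
move=> y; rewrite !lt_min => /andP[/h1 yd _] /andP[_ Dy].
rewrite /slit_hit; case: eqP => [_|/eqP D0]; first by lra.
have Dp : 0 < slitD r (Z y) by rewrite lt0r D0 slitD_ge0.
apply: (proj1 (h2 _ Dp Dy)).
by move: yd; rewrite ltr_norml /c => /andP[_]; lra.
Qed.

Lemma slit_miss_bnd (x : RR) e : 0 < slitN r (Z x) -> 0 < e ->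
  exists2 d, 0 < d & forall y : R * R, `|y - (x : R * R)| < d -> slitD r (Z y) < d ->
    1 - e <= slit_miss y.
Proof.
move=> Nx e0; pose c := slitN r (Z x) / 2.
have c0 : 0 < c by rewrite divr_gt0.
have [d1 d10 h1] := reg_near x reg_slitN c0.
have [d2 d20 h2] := slit_harm_bnd r01 c0 e0.
exists (Num.min d1 d2); first by rewrite lt_min d10.
move=> y; rewrite !lt_min => /andP[/h1 yd _] /andP[_ Dy].
rewrite /slit_miss; case: eqP => [_|/eqP D0]; first by lra.
have Dp : 0 < slitD r (Z y) by rewrite lt0r D0 slitD_ge0.
have := proj2 (h2 _ Dp Dy).
move: yd; rewrite ltr_norml /c => /andP[? _].
have -> : slitN r (Z x) / 2 <= slitN r (Z y) by lra.
by move=> /(_ isT); lra.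
Qed.

Let Z0 : Z (0, 0) = 0.
Proof. by rewrite /Z (_ : cplx (0, 0) = 0) ?mulr0. Qed.

Lemma slit_hit0 : slit_hit (0, 0) = 1 - 4 / pi * atan (Num.sqrt r).
Proof.
rewrite /slit_hit Z0 slitD_0// gt_eqF ?sqrtr_gt0; last by case/andP: r01.
exact: slit_harm_0.
Qed.

Lemma slit_miss0 : slit_miss (0, 0) = 4 / pi * atan (Num.sqrt r).
Proof.
rewrite /slit_miss Z0 slitD_0// gt_eqF ?sqrtr_gt0; last by case/andP: r01.
by rewrite slit_harm_0// opprB addrC subrK.
Qed.

End SlitPlane.

(** * Exit time and hull of a single path *)

Section Paths.
Context {R : realType} {T : Type} (W : R -> T -> R * R) (w : T).
Hypothesis W0 : W 0 w = (0, 0).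
Hypothesis cW : {within `[0, +oo[, continuous (fun t => W t w)}.
Local Notation RR := (measurableTypeR R * measurableTypeR R)%type.

(** Trades the extended-real infimum for a statement on earlier times, whether or not the path ever
    exits. *)
Lemma exit_timeP (t : R) :
  (t%:E <= exit_time W w)%E <-> forall s, 0 <= s < t -> unit_disk (W s w).
Proof.
split.
  move=> te s /andP[s0 st]; apply: contrapT => ns.
  have : (exit_time W w <= s%:E)%E by apply: ereal_inf_lbound; exists s.
  by move=> /(le_trans te); rewrite lee_fin leNgt st.
move=> h; apply: le_ereal_inf_tmp => _ [s [s0 ns] <-].
by rewrite lee_fin leNgt; apply/negP => st; apply: ns; apply: h; rewrite s0.
Qed.

Lemma unit_diskE (p : R * R) : unit_disk p <-> norm2 (p : RR) < 1.
Proof.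
rewrite /unit_disk /norm2 /=; split => h.
  by rewrite -[ltRHS]sqrtr1 ltr_sqrt.
by rewrite -ltr_sqrt ?sqrtr1.
Qed.

(** The infimum of the zeros is a zero by continuity. Serves for the first meeting with slit or
    circle and, applied to 1 - |[W]| truncated at 0, for the exit from the disk. *)
Lemma first_zero (g : R -> R) (t : R) : {within `[0, +oo[, continuous g} ->
  (forall s, 0 <= g s) -> 0 <= t -> g t = 0 ->
  exists t0, [/\ 0 <= t0, t0 <= t, g t0 = 0 & forall s, 0 <= s < t0 -> 0 < g s].
Proof.
move=> cg g0 t0 gt.
pose A := [set s | 0 <= s /\ g s = 0].
have At : A t by [].
have infA : has_inf A by split; [exists t|exists 0 => s []].
have i0 : 0 <= inf A by apply: lb_le_inf; [exists t|move=> s []].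
exists (inf A); split => //.
- by apply: ge_inf => //; case: infA.
- apply/eqP; rewrite eq_le g0 andbT leNgt; apply/negP => gi.
  have [d d0 hd] := within_ray_eps cg i0 gi.
  have [s [s0 gs] sd] := inf_adherent d0 infA.
  have les : inf A <= s by apply: ge_inf => //; case: infA.
  have : `|s - inf A| < d by rewrite ger0_norm ?subr_ge0// ltrBlDl.
  by move=> /(hd _ s0); rewrite gs sub0r normrN ger0_norm ?ltxx// ltW.
- move=> s /andP[s0 si]; rewrite lt0r g0 andbT; apply/eqP => gs.
  have : inf A <= s by apply: ge_inf; [case: infA|split].
  by rewrite leNgt si.
Qed.

Lemma alive_norm (t : R) : 0 <= t -> (t%:E <= exit_time W w)%E -> norm2 (W t w : RR) <= 1.
Proof.
rewrite le_eqVlt => /orP[/eqP <- _|t0 /exit_timeP h].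
  by rewrite W0 /norm2 /= expr0n addr0 sqrtr0.
rewrite leNgt; apply/negP => n1.
have cN := within_ray_comp cW (@continuous_norm2 R).
have e0 : 0 < norm2 (W t w : RR) - 1 by rewrite subr_gt0.
have [d d0 hd] := within_ray_eps cN (ltW t0) e0.
pose s := Num.max (t / 2) (t - d / 2).
have s0 : 0 <= s by rewrite le_max divr_ge0// ltW.
have st : s < t by rewrite gt_max; apply/andP; lra.
have sd : `|s - t| < d.
  by rewrite distrC ger0_norm ?subr_ge0 1?ltW// ltrBlDr -ltrBlDl lt_max; apply/orP; right; lra.
have := hd _ s0 sd; rewrite /= ltr_norml => /andP[+ _].
have /unit_diskE : unit_disk (W s w) by apply: h; rewrite s0.
lra.
Qed.

(** With l = 1 / rho, membership becomes hitting the radial half-line that starts at x; x != 0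
    excludes rho = 0. *)
Lemma hullP (x : RR) : x != (0, 0) :> R * R ->
  star_hull (trace_until_exit W w) x <->
  exists t l, [/\ 0 <= t, (t%:E <= exit_time W w)%E, 1 <= l & W t w = (l * x.1, l * x.2)].
Proof.
move=> x0; split.
  move=> [rho [p [/andP[r0 r1] [t [t0 te] <-] xE]]].
  have rp : 0 < rho.
    rewrite lt0r r0 andbT; apply: contra x0 => /eqP rz.
    by rewrite xE rz !mul0r.
  exists t, rho^-1; split => //; first by rewrite invf_ge1.
  by rewrite xE /= !mulrA mulVf ?gt_eqF// !mul1r -surjective_pairing.
move=> [t [l [t0 te l1 Wt]]]; have l0 : 0 < l := lt_le_trans ltr01 l1.
exists l^-1, (W t w); split.
- by rewrite invr_ge0 ltW//= invf_le1.
- by exists t.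
- by rewrite Wt /= !mulrA mulVf ?gt_eqF// !mul1r -surjective_pairing.
Qed.

End Paths.

(** * Probability that a given point belongs to the hull *)

Section HullProb.
Context d {T : measurableType d} {R : realType} (P : probability T R).
Variable W : R -> T -> R * R.
Hypothesis BM : is_planar_BM P W.
Local Notation RR := (measurableTypeR R * measurableTypeR R)%type.
Implicit Types x : RR.

(* Negligible and, unlike {exit_time = +oo}, measurable by construction. *)
Definition never_exit : set T := \bigcap_(n in [set n : nat | (0 < n)%N]) (W n%:R @^-1` disk 1).

Lemma measurable_W_preimage t (A : set RR) : 0 <= t -> measurable A -> measurable (W t @^-1` A).
Proof.
case: BM => _ mW _ _ t0 mA; rewrite -[X in measurable X]setTI.
exact: (mW t t0).
Qed.

Lemma measurable_never_exit : measurable never_exit.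
Proof.
apply: bigcap_measurableType => n _; apply: measurable_W_preimage => //.
exact: measurable_disk.
Qed.

(** The density at time n is at most 1 / (2 pi n), so |[W] n| < 1 has probability at most 1 / (2
    n). *)
Lemma never_exit0 : P never_exit = 0%E.
Proof.
apply/eqP; rewrite eq_le measure_ge0 andbT.
apply/lee_addgt0Pr => e e0; rewrite add0e.
have p0 := pi_gt0 R.
have [n n0 hn] : exists2 n : nat, (0 : R) < n%:R & e^-1 <= n%:R.
  exists (Num.bound e^-1).+1; first by rewrite ltr0n.
  apply: ltW; apply: lt_le_trans (archi_boundP _) _; last by rewrite ler_nat.
  by rewrite invr_ge0 ltW.
have [m gm mE] := BM_gauss BM n0.
apply: (@le_trans _ _ (P (W n%:R @^-1` disk 1))).
  apply: le_measure; rewrite ?inE; [exact: measurable_never_exit| |by apply: bigcap_inf; rewrite /= -(ltr0n R)].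
  by apply: measurable_W_preimage => //; exact: measurable_disk.
rewrite -mE; last exact: measurable_disk.
rewrite gm; last exact: measurable_disk.
have b0 : 0 < pi *+ 2 * n%:R :> R by rewrite mulr_gt0// mulrn_wgt0.
apply: (@le_trans _ _ (\int[leb2]_(x in disk 1) ((pi *+ 2 * n%:R)^-1)%:E)%E).
  apply: ge0_le_integral => //.
  - exact: measurable_disk.
  - by move=> x _; rewrite lee_fin gauss2_ge0.
  - by apply/measurable_EFinP; apply: measurable_funTS; exact: measurable_gauss2.
  move=> x _; rewrite lee_fin /gauss2 ler_pdivrMr// mulVf ?gt_eqF//.
  rewrite -[leRHS]expR0 ler_expR mulNr oppr_le0.
  by rewrite divr_ge0 ?addr_ge0 ?sqr_ge0// mulrn_wge0// ltW.
rewrite integral_cst; last exact: measurable_disk.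
rewrite -[X in (_ * X)%E]/(leb2 (disk 1)) leb2_disk// expr1n mulr1 -EFinM lee_fin.
rewrite mulrC ler_pdivrMr//.
have en : 1 <= n%:R * e by rewrite -ler_pdivrMr// div1r.
have -> : e * (pi *+ 2 * n%:R) = pi * (2 * (n%:R * e)).
  by move: p0; generalize (pi : R) => p _; rewrite -mulr_natr; ring.
by rewrite ler_peMr ?(ltW p0)//; lra.
Qed.

Definition hull_event x : set T := [set w | star_hull (trace_until_exit W w) x].

Let W0 w : W 0 w = (0, 0). Proof. by case: BM. Qed.
Let cW w : {within `[0, +oo[, continuous (fun t => W t w)}. Proof. by case: BM. Qed.
Arguments cW : clear implicits.

Section Direction.
Variables (x : RR) (r : R).
Hypotheses (x0 : 0 < norm2 x) (r0 : 0 < r).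
Let k : R[i] := r%:C%C / cplx x.
Let Z (p : RR) : R[i] := k * cplx p.

Let cx0 : cplx x != 0. Proof. by rewrite -nrm_gt0 nrm_cplx. Qed.

Lemma dir_neq0 : x != (0, 0) :> R * R.
Proof.
by apply: contraTneq x0 => ->; rewrite /norm2 /= expr0n addr0 sqrtr0 ltxx.
Qed.

Lemma nrm_dir : nrm k = r / norm2 x.
Proof. by rewrite /k nrmM nrmV nrm_real gtr0_norm. Qed.

Lemma nrm_dirM p : nrm (Z p) = r / norm2 x * norm2 p.
Proof. by rewrite /Z nrmM nrm_dir. Qed.

Lemma dir_scale l : Z ((l * x.1, l * x.2) : R * R) = (l * r)%:C%C.
Proof.
rewrite /Z (_ : cplx _ = l%:C%C * cplx x); last first.
  by rewrite /cplx; simpc.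
by rewrite /k mulrCA divfK// rmorphM mulrC.
Qed.

Lemma dir_real p : cIm (Z p) = 0 -> r <= cRe (Z p) ->
  exists2 l, 1 <= l & p = (l * x.1, l * x.2) :> R * R.
Proof.
move=> i0 rle; exists (cRe (Z p) / r); first by rewrite ler_pdivlMr// mul1r.
set l := _ / r.
have Zl : Z p = (l * r)%:C%C.
  by rewrite /l divfK ?gt_eqF//; move: i0; case: (Z p) => a b /= ->.
have k0 : k != 0 by rewrite -nrm_gt0 nrm_dir divr_gt0.
move: Zl; rewrite -dir_scale => /(mulfI k0) [e1 e2].
by rewrite [LHS]surjective_pairing e1 e2.
Qed.

End Direction.

(* The slit is started at r < |x|, which keeps the rescaled path away from the
   unit circle, where the slit and the circle meet. *)
Lemma hull_event_le x r : 0 < r -> r < norm2 x -> norm2 x < 1 ->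
  measurable (hull_event x) ->
  (P (hull_event x) <= (1 - 4 / pi * atan (Num.sqrt r))%:E)%E.
Proof.
move=> r0 rx x1 mA.
have x0 : 0 < norm2 x := lt_trans r0 rx.
have r01 : 0 < r < 1 by rewrite r0 (lt_trans rx).
pose k : R[i] := r%:C%C / cplx x.
have k1 : nrm k <= 1 by rewrite nrm_dir// ler_pdivrMr// mul1r ltW.
have [cD mD] := reg_slitD r k.
rewrite -(slit_hit0 k r01).
apply: (hit_le BM (measurable_slit_hit r k) (slit_hit_bound r k) mD cD
  (@slit_hit_sum4 _ _ _ r01 k1) mA).
move=> w /(hullP W w (dir_neq0 x0)) [t [l [t0 te l1 Wt]]].
have Zlt s : 0 <= s <= t -> nrm (k * cplx (W s w)) < 1.
  move=> /andP[s0 st]; rewrite nrm_dirM//.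
  have := alive_norm (W0 w) (cW w) s0 (le_trans _ te); rewrite lee_fin => /(_ st) n1.
  have n0 : 0 <= norm2 (W s w : RR) by rewrite sqrtr_ge0.
  apply: le_lt_trans (_ : r / norm2 x < 1); last by rewrite ltr_pdivrMr// mul1r.
  by rewrite ler_piMr// divr_ge0 ?ltW.
have tt : 0 <= t <= t by rewrite t0 lexx.
have ZWt : k * cplx (W t w) = (l * r)%:C%C by rewrite Wt dir_scale.
have lr1 : l * r < 1.
  have := Zlt _ tt; rewrite ZWt nrm_real; apply: le_lt_trans; exact: ler_norm.
have Dt : slitD r (k * cplx (W t w)) = 0.
  rewrite ZWt slitD_slit// lr1 andbT ler_peMl// ltW//.
have cDW := within_ray_comp (cW w) cD.
(* The first zero of [slitD] may precede t; it still lies on the slit, because the rescaled path is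
   strictly inside the disk. *)
have [t1 [t10 t1t D1 Dp]] := first_zero cDW (fun s => slitD_ge0 _ _) t0 Dt.
exists t1; split => //.
- move=> s /andP[s0 st1]; apply: le_lt_trans (_ : 1 < 2); last by rewrite ltr1n.
  apply: (alive_norm (W0 w) (cW w) s0); apply: le_trans te.
  by rewrite lee_fin (le_trans st1).
- move=> e e0; apply: slit_hit_bnd => //.
  have Z1 : nrm (k * cplx (W t1 w)) < 1 by apply: Zlt; rewrite t10.
  have [i0 rle] := slitD_eq0_in r01 Z1 D1.
  have : cRe (k * cplx (W t1 w)) < 1.
    by apply: le_lt_trans Z1; apply: le_trans (normRe_le_nrm _); exact: ler_norm.
  move: i0 rle; case: (k * cplx _) => a b /= -> ra a1.
  by apply: slitN_slit => //; rewrite ra.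
Qed.

(** Here r = |x|, so the rescaling is a rotation. A path that avoids the half-line from x meets the
    zeros of [slitD] only on leaving the disk, at a point of the circle other than the corner; paths
    that never leave form a null set. *)
Lemma hull_event_compl_le x : 0 < norm2 x -> norm2 x < 1 ->
  measurable (hull_event x) ->
  (P (~` hull_event x) <= (4 / pi * atan (Num.sqrt (norm2 x)))%:E)%E.
Proof.
move=> x0 x1 mA.
pose r := norm2 x; have r01 : 0 < r < 1 by rewrite x0.
pose k : R[i] := r%:C%C / cplx x.
have k1 : nrm k = 1 by rewrite nrm_dir// divff// gt_eqF.
have k1' : nrm k <= 1 by rewrite k1.
have [cD mD] := reg_slitD r k.
have mN := measurable_never_exit.
have mB : measurable (~` hull_event x `\` never_exit).
  by apply: measurableD => //; exact: measurableC.
apply: (@le_trans _ _ (P (~` hull_event x `\` never_exit))).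
  apply: le_trans (_ : (P (~` hull_event x `\` never_exit) + P never_exit <= _)%E); last first.
    by rewrite never_exit0 adde0.
  rewrite -measureU//; last by rewrite setDKI.
  apply: le_measure; rewrite ?inE//; first exact: measurableC.
    exact: measurableU.
  by move=> w hw; have [|] := pselect (never_exit w); [right|left].
rewrite -(slit_miss0 k r01).
apply: (hit_le BM (measurable_slit_miss r k) (slit_miss_bound r k) mD cD
  (@slit_miss_sum4 _ _ _ r01 k1') mB).
move=> w [nh]; rewrite /never_exit /= => /existsNP[n] /not_implyP[n0 ndisk].
have Zn s : nrm (k * cplx (W s w)) = norm2 (W s w : RR).
  by rewrite nrmM k1 mul1r.
have cNW := within_ray_comp (cW w) (@continuous_norm2 R).
(* Truncated at 0 so that its first zero is the exit time. *)
pose g s := Num.max 0 (1 - norm2 (W s w : RR)).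
have cg : {within `[0, +oo[, continuous g}.
  apply: (within_ray_comp (g := (@norm2 R : R * R -> R) \o (fun t => W t w)) (F := fun v : R => Num.max 0 (1 - v))) => //.
  move=> v; apply: (@continuous_max _ _ (fun=> 0 : R) (fun v : R => 1 - v)).
    exact: cvg_cst.
  by apply: cvgB; [exact: cvg_cst|exact: cvg_id].
have g0 s : 0 <= g s by rewrite le_max lexx.
have gn : g n%:R = 0.
  by rewrite /g; apply/max_idPl; rewrite subr_le0 leNgt; apply/negP.
have [t [t0 _ gt gp]] := first_zero cg g0 (ler0n R n) gn.
have te : (t%:E <= exit_time W w)%E.
  apply/exit_timeP => s /gp; rewrite /g lt_max ltxx subr_gt0 => s1.
  exact/unit_diskE.
have nt : norm2 (W t w : RR) = 1.
  apply/eqP; rewrite eq_le (alive_norm (W0 w) (cW w) t0 te)/=.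
  by rewrite -subr_le0; apply/max_idPl.
have notl t' l : 0 <= t' <= t -> 1 <= l -> W t' w <> (l * x.1, l * x.2).
  move=> /andP[t'0 t't] l1 e; apply: nh; apply/(hullP W w (dir_neq0 x0)).
  exists t', l; split => //; apply: le_trans te; by rewrite lee_fin.
have Dt : slitD r (k * cplx (W t w)) = 0 by apply: slitD_circle => //; rewrite Zn.
have cDW := within_ray_comp (cW w) cD.
have [t1 [t10 t1t D1 Dp]] := first_zero cDW (fun s => slitD_ge0 _ _) t0 Dt.
have t1E : t1 = t.
  apply/eqP; rewrite eq_le t1t leNgt; apply/negP => tlt.
  have Z1 : nrm (k * cplx (W t1 w)) < 1.
    rewrite Zn -subr_gt0; have : 0 < g t1 by apply: gp; rewrite t10.
    by rewrite /g lt_max ltxx.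
  have [i0 rle] := slitD_eq0_in r01 Z1 D1.
  have [l l1 e] := dir_real x0 x0 i0 rle.
  by apply: (notl t1 l) => //; rewrite t10.
exists t1; split => //.
- move=> s /andP[s0 st1]; apply: le_lt_trans (_ : 1 < 2); last by rewrite ltr1n.
  apply: (alive_norm (W0 w) (cW w) s0); apply: le_trans te.
  by rewrite lee_fin (le_trans st1).
- move=> e e0; apply: slit_miss_bnd => //.
  rewrite t1E; apply: slitN_circle => //; first by rewrite Zn.
  apply/eqP => Z1.
  have i0 : cIm (k * cplx (W t w)) = 0 by rewrite Z1.
  have rle : r <= cRe (k * cplx (W t w)) by rewrite Z1 /= ltW.
  have [l l1 e'] := dir_real x0 x0 i0 rle.
  by apply: (notl t l) => //; rewrite t0 lexx.
Qed.

(** Missing is bounded with the slit starting at |x|, hitting with r < |x|; as r tends to |x| the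
    two bounds meet by continuity. *)
Lemma hull_event_prob x : 0 < norm2 x -> norm2 x < 1 -> measurable (hull_event x) ->
  P (hull_event x) = (1 - 4 / pi * atan (Num.sqrt (norm2 x)))%:E.
Proof.
move=> x0 x1 mA; have p0 := pi_gt0 R.
have lo := hull_event_compl_le x0 x1 mA.
have up r := @hull_event_le x r.
rewrite probability_setC// in lo.
have : P (hull_event x) \is a fin_num by exact: fin_num_measure.
move: lo up; case: (P (hull_event x)) => [p| |]// lo up _; congr (_%:E).
rewrite -EFinB lee_fin in lo.
apply/eqP; rewrite eq_le; apply/andP; split; last by lra.
apply/ler_addgt0Pr => e e0.
have e1 : 0 < e / 4 * pi by rewrite mulr_gt0// divr_gt0.
have /cvgrPdist_lt/(_ _ e1) : {for norm2 x, continuous (fun v => atan (Num.sqrt v))}.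
  by apply: continuous_comp; [exact: sqrt_continuous|exact: continuous_atan].
move=> /nbhs_ballP[dl /= dl0 hd].
pose r := Num.max (norm2 x / 2) (norm2 x - dl / 2).
have r0 : 0 < r by rewrite lt_max divr_gt0.
have rx : r < norm2 x by rewrite gt_max; apply/andP; lra.
have rd : `|norm2 x - r| < dl.
  by rewrite ger0_norm ?subr_ge0 1?ltW// ltrBlDr -ltrBlDl lt_max; apply/orP; right; lra.
have := hd _ rd; rewrite ltr_norml => /andP[_ h].
have := up r r0 rx x1 mA; rewrite lee_fin => h2.
set a := atan _ in h h2 *; set b := atan _ in h h2 *.
have : 4 / pi * (a - b) <= e.
  by rewrite mulrAC ler_pdivrMr//; lra.
lra.
Qed.

End HullProb.

(** * Measurability and expected area of the hull *)

Section MeasurableQuantifiers.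
Context d {T : measurableType d}.

Lemma measurable_ex_nat (F : nat -> set T) : (forall n, measurable (F n)) ->
  measurable [set p | exists n, F n p].
Proof.
move=> mF; rewrite (_ : [set _ | _] = \bigcup_n F n); first exact: bigcupT_measurable.
by apply/seteqP; split => p [n]; [exists n|exists n].
Qed.

Lemma measurable_ex_rat (F : rat -> set T) : (forall n, measurable (F n)) ->
  measurable [set p | exists n, F n p].
Proof.
move=> mF; rewrite (_ : [set _ | _] = \bigcup_n F n); first exact: bigcupT_measurable_rat.
by apply/seteqP; split => p [n]; [exists n|exists n].
Qed.

Lemma measurable_all_nat (F : nat -> set T) : (forall n, measurable (F n)) ->
  measurable [set p | forall n, F n p].
Proof.
move=> mF; rewrite (_ : [set _ | _] = ~` [set p | exists n, (~` F n) p]).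
  by apply: measurableC; apply: measurable_ex_nat => n; exact: measurableC.
apply/seteqP; split => p /= h; first by case=> n; apply; exact: h.
by move=> n; apply: contrapT => hn; apply: h; exists n.
Qed.

Lemma measurable_all_rat (F : rat -> set T) : (forall n, measurable (F n)) ->
  measurable [set p | forall n, F n p].
Proof.
move=> mF; rewrite (_ : [set _ | _] = ~` [set p | exists n, (~` F n) p]).
  by apply: measurableC; apply: measurable_ex_rat => n; exact: measurableC.
apply/seteqP; split => p /= h; first by case=> n; apply; exact: h.
by move=> n; apply: contrapT => hn; apply: h; exists n.
Qed.

(** [C] will restrict times only. It may be assumed for the measurability of [A], where it provides
    nonnegative times, the only ones at which [W] is known to be measurable. *)
Lemma measurable_and_cst (C : Prop) (A : set T) : (C -> measurable A) ->
  measurable [set p | C /\ A p].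
Proof.
move=> mA; have [c|nc] := pselect C.
  by rewrite (_ : [set _ | _] = A); [exact: mA|apply/seteqP; split => p //= []].
by rewrite (_ : [set _ | _] = set0)//; apply/seteqP; split => p //= [].
Qed.

Lemma measurable_imp_cst (C : Prop) (A : set T) : (C -> measurable A) ->
  measurable [set p | C -> A p].
Proof.
move=> mA; have [c|nc] := pselect C.
  rewrite (_ : [set _ | _] = A); first exact: mA.
  by apply/seteqP; split => p /=; first exact.
by rewrite (_ : [set _ | _] = setT)//; apply/seteqP; split => p //= _ c; case: (nc c).
Qed.

Lemma measurable_le_cst {R : realType} (f : T -> R) c : measurable_fun setT f ->
  measurable [set p | f p <= c].
Proof.
move=> mf; rewrite (_ : [set _ | _] = setT `&` f @^-1` [set` `]-oo, c]]).
  exact: mf.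
by rewrite setTI; apply/seteqP; split => z /=; rewrite in_itv.
Qed.

Lemma measurable_lt_cst {R : realType} (f : T -> R) c : measurable_fun setT f ->
  measurable [set p | f p < c].
Proof.
move=> mf; rewrite (_ : [set _ | _] = setT `&` f @^-1` [set` `]-oo, c[]).
  exact: mf.
by rewrite setTI; apply/seteqP; split => z /=; rewrite in_itv.
Qed.

End MeasurableQuantifiers.

Section Ray.
Context {R : realType}.
Local Notation RR := (measurableTypeR R * measurableTypeR R)%type.

(* For x != 0, vanishes exactly on the ray {l x : l >= 1}. *)
Definition ray (x z : RR) : R := `|x.1 * z.2 - x.2 * z.1| +
  Num.max 0 (x.1 ^+ 2 + x.2 ^+ 2 - (x.1 * z.1 + x.2 * z.2)).

Lemma ray_ge0 x z : 0 <= ray x z.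
Proof. by rewrite addr_ge0// le_max lexx. Qed.

Lemma ray_scale (x : RR) l : 1 <= l -> ray x ((l * x.1, l * x.2) : R * R) = 0.
Proof.
move=> l1; rewrite /ray /= (_ : _ - _ = 0); last by ring.
rewrite normr0 add0r; apply/max_idPl; rewrite subr_le0.
have -> : x.1 * (l * x.1) + x.2 * (l * x.2) = l * (x.1 ^+ 2 + x.2 ^+ 2) by ring.
by rewrite ler_peMl// addr_ge0 ?sqr_ge0.
Qed.

(** A zero cross product makes z a multiple l x, and an inner product of at least |x|^2 makes l >=
    1. *)
Lemma ray_eq0 (x z : RR) : x != (0, 0) :> R * R -> ray x z = 0 ->
  exists2 l, 1 <= l & z = (l * x.1, l * x.2) :> R * R.
Proof.
move=> x0; rewrite /ray => /eqP; rewrite paddr_eq0 ?normr_ge0 ?le_max ?lexx//.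
move=> /andP[]; rewrite normr_eq0 => /eqP c /eqP/max_idPl; rewrite subr_le0 => h.
have n0 : 0 < x.1 ^+ 2 + x.2 ^+ 2.
  rewrite lt0r addr_ge0 ?sqr_ge0// andbT; apply: contra x0.
  rewrite paddr_eq0 ?sqr_ge0// !sqrf_eq0 => /andP[/eqP a /eqP b].
  by rewrite [x]surjective_pairing a b.
exists ((x.1 * z.1 + x.2 * z.2) / (x.1 ^+ 2 + x.2 ^+ 2)); first by rewrite ler_pdivlMr// mul1r.
have c' : x.1 * z.2 = x.2 * z.1 by apply/eqP; rewrite -subr_eq0 c.
rewrite [LHS]surjective_pairing; congr pair; apply: (mulIf (lt0r_neq0 n0)).
  rewrite mulrAC divfK ?gt_eqF//.
  transitivity (x.1 ^+ 2 * z.1 + x.2 * (x.2 * z.1)); first by ring.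
  by rewrite -c'; ring.
rewrite mulrAC divfK ?gt_eqF//.
transitivity (x.2 ^+ 2 * z.2 + x.1 * (x.1 * z.2)); first by ring.
by rewrite c'; ring.
Qed.

Lemma max0_continuous : continuous (fun v : R => Num.max 0 v).
Proof.
move=> v; apply: (@continuous_max _ _ (fun=> 0 : R) id); first exact: cvg_cst.
exact: cvg_id.
Qed.

Lemma reg_ray (x : RR) : reg (ray x).
Proof.
apply: regD.
  apply: (reg_comp (@norm_continuous _ R)); apply: regB; apply: regM;
    by [exact: reg_cst|exact: reg_snd|exact: reg_fst].
apply: (reg_comp max0_continuous); apply: regB; first exact: reg_cst.
by apply: regD; apply: regM; [exact: reg_cst|exact: reg_fst|exact: reg_cst|exact: reg_snd].
Qed.

Lemma measurable_ray d (T : measurableType d) (f g : T -> RR) :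
  measurable_fun setT f -> measurable_fun setT g ->
  measurable_fun setT (fun w => ray (f w) (g w)).
Proof.
move=> /measurable_fun_pairP[f1 f2] /measurable_fun_pairP[g1 g2].
apply: measurable_funD.
  apply: measurableT_comp; first by apply: continuous_measurable_fun; exact: norm_continuous.
  by apply: measurable_funB; apply: measurable_funM.
apply: measurable_maxr; first exact: measurable_cst.
apply: measurable_funB; apply: measurable_funD; exact: measurable_funM.
Qed.

End Ray.

(** * The hull of a path through rational times *)

Section HullPath.
Context {R : realType} {T : Type} (W : R -> T -> R * R) (w : T).
Hypothesis W0 : W 0 w = (0, 0).
Hypothesis cW : {within `[0, +oo[, continuous (fun t => W t w)}.
Local Notation RR := (measurableTypeR R * measurableTypeR R)%type.

(* Membership in the hull in terms of countable quantifiers over rational times,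
   which makes it jointly measurable in the path and the point. *)
Definition inside_upto (q : rat) : Prop := exists k : nat, forall s : rat,
  (0 : R) <= ratr s <= (ratr q : R) -> norm2 (W (ratr s) w : RR) <= 1 - k.+1%:R^-1.

Definition near_ray (x : RR) : Prop := exists N : nat, forall n : nat, exists q : rat,
  (0 : R) <= ratr q <= (N%:R : R) /\
  (inside_upto q /\ ray x (W (ratr q) w) < n.+1%:R^-1).

Let cN := within_ray_comp cW (@continuous_norm2 R).

(** The margin 1 / (k + 1) is what survives the passage from rational to real times. *)
Lemma inside_uptoP q s : inside_upto q -> 0 <= s <= ratr q -> norm2 (W s w : RR) < 1.
Proof.
move=> [k hk] /andP[s0 sq].
have k0 : (0 : R) < k.+1%:R^-1 by rewrite invr_gt0.
apply: le_lt_trans (_ : 1 - k.+1%:R^-1 < 1); last by rewrite ltrBlDr ltrDl.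
rewrite leNgt; apply/negP => h.
have e0 : 0 < norm2 (W s w : RR) - (1 - k.+1%:R^-1) by rewrite subr_gt0.
have [d d0 hd] := within_ray_eps cN s0 e0.
have [u /andP[u0 uq] us] : exists2 u : rat, (0 : R) <= ratr u <= (ratr q : R) & `|ratr u - s| < d.
  have [q0|q0] := leP (ratr q) (0 : R).
    have s00 : s = 0 by apply/eqP; rewrite eq_le s0 (le_trans sq q0).
    by exists 0; rewrite rmorph0 ?lexx ?(le_trans s0 sq)// s00 subrr normr0.
  have ab : Num.max 0 (s - d) < Num.min (ratr q) (s + d).
    by rewrite gt_max !lt_min q0/=; apply/andP; split; [|apply/andP; split]; lra.
  have [u] := rat_in_itvoo ab; rewrite in_itv/= gt_max lt_min.
  move=> /andP[/andP[u0 us] /andP[uq us']]; exists u; first by rewrite !ltW.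
  by rewrite ltr_norml; apply/andP; lra.
have := hd _ u0 us; rewrite /= ltr_norml => /andP[+ _].
have : norm2 (W (ratr u) w : RR) <= 1 - k.+1%:R^-1 by apply: hk; rewrite u0.
by move: (k.+1%:R^-1) (norm2 _) (norm2 _) => v a b; lra.
Qed.

(** The maximum of |[W]| on the compact interval is attained inside the open disk, which supplies
    the margin. *)
Lemma inside_upto_lt q t : (0 : R) <= ratr q -> ratr q < t ->
  (t%:E <= exit_time W w)%E -> inside_upto q.
Proof.
move=> q0 qt /exit_timeP te.
have cN' : {within `[0, ratr q], continuous ((@norm2 R : R * R -> R) \o (fun t => W t w))}.
  by apply: continuous_subspaceW cN => s /=; rewrite !in_itv/= => /andP[->].
have [c + hc] := EVT_max q0 cN'; rewrite in_itv/= => /andP[c0 cq].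
have /unit_diskE n1 : unit_disk (W c w) by apply: te; rewrite c0 (le_lt_trans cq).
pose e := 1 - norm2 (W c w : RR); have e0 : 0 < e by rewrite subr_gt0.
exists (Num.bound e^-1) => s hs.
have := hc (ratr s); rewrite in_itv/= => /(_ hs) /le_trans; apply.
have : (Num.bound e^-1).+1%:R^-1 <= e.
  rewrite -[leRHS]invrK lef_pV2 ?posrE ?invr_gt0//.
  apply: ltW; apply: lt_le_trans (archi_boundP _) _; first by rewrite invr_ge0 ltW.
  by rewrite ler_nat.
by rewrite /e !lerBrDr addrC.
Qed.

(** The cap N confines times to a compact interval. Rational times at which [ray] gets small lie
    below sup A, so the minimum of [ray] over [0, sup A] is 0 and is attained at a hit. Conversely,
    rational times just before a hit bring [ray] close to 0 while the path is still inside. *)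
Lemma near_rayP (x : RR) : x != (0, 0) :> R * R ->
  near_ray x <-> star_hull (trace_until_exit W w) x.
Proof.
move=> x0; have cR := within_ray_comp cW (proj1 (reg_ray x)).
split=> [[N hN]|/(hullP W w x0) [t [l [t0 te l1 Wt]]]].
  pose A := [set s | 0 <= s <= N%:R /\ forall u, 0 <= u <= s -> norm2 (W u w : RR) < 1].
  have A0 : A 0.
    split; first by rewrite lexx ler0n.
    move=> u; rewrite -eq_le => /eqP <-; rewrite W0 /norm2 /= expr0n addr0 sqrtr0.
    exact: ltr01.
  have supA : has_sup A by split; [exists 0|exists N%:R => s [/andP[_ ->]]].
  have ubA s : A s -> s <= sup A by move=> As; apply: ub_le_sup => //; case: supA.
  have s0 : 0 <= sup A by exact: ubA.
  have sE : ((sup A)%:E <= exit_time W w)%E.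
    apply/exit_timeP => s /andP[ss0 sA]; apply/unit_diskE.
    have e0 : 0 < sup A - s by rewrite subr_gt0.
    have [a [_ ha] sa] := sup_adherent e0 supA.
    by apply: ha; rewrite ss0/= ltW//; move: sa; rewrite opprB addrCA subrr addr0.
  have cR' : {within `[0, sup A], continuous ((ray x : R * R -> R) \o (fun t => W t w))}.
    by apply: continuous_subspaceW cR => s /=; rewrite !in_itv/= => /andP[->].
  have [c + hc] := EVT_min s0 cR'; rewrite in_itv/= => /andP[c0 cA].
  have rc : ray x (W c w) = 0.
    apply/eqP; rewrite eq_le ray_ge0 andbT; apply/ler_addgt0Pr => e e0; rewrite add0r.
    have [q [/andP[q0 qN] [qi qr]]] := hN (Num.bound e^-1).
    have qA : A (ratr q).
      by split; [rewrite q0|move=> u; exact: inside_uptoP qi].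
    have := hc (ratr q); rewrite in_itv/= q0 ubA// => /(_ isT) /le_trans; apply.
    apply: le_trans (ltW qr) _.
    rewrite -[leRHS]invrK lef_pV2 ?posrE ?invr_gt0//.
    apply: ltW; apply: lt_le_trans (archi_boundP _) _; first by rewrite invr_ge0 ltW.
    by rewrite ler_nat.
  have [l l1 Wc] := ray_eq0 x0 rc.
  apply/(hullP W w x0); exists c, l; split => //.
  by apply: le_trans sE; rewrite lee_fin.
have tp : 0 < t.
  rewrite lt0r t0 andbT; apply: contra x0 => /eqP tz; move: Wt; rewrite tz W0.
  have l0 : l != 0 by rewrite gt_eqF// (lt_le_trans ltr01).
  move=> [/esym/eqP + /esym/eqP]; rewrite !mulf_eq0 (negbTE l0)/= => /eqP a /eqP b.
  by rewrite [x]surjective_pairing a b.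
exists (Num.bound t) => n.
have n0 : (0 : R) < n.+1%:R^-1 by rewrite invr_gt0.
have [d d0 hd] := within_ray_eps cR t0 n0.
have ab : Num.max 0 (t - d) < t by rewrite gt_max tp/= ltrBlDr ltrDl.
have [q] := rat_in_itvoo ab; rewrite in_itv/= gt_max => /andP[/andP[q0 qd] qt].
exists q; split.
  rewrite (ltW q0)/=; apply: le_trans (ltW qt) _.
  by apply: ltW; exact: archi_boundP.
split; first exact: inside_upto_lt (ltW q0) qt te.
have := hd _ (ltW q0); rewrite /= Wt ray_scale// subr0 => /(_ _)/(le_lt_trans (ler_norm _)).
by apply; rewrite distrC ger0_norm ?subr_ge0 1?ltW// ltrBlDr -ltrBlDl.
Qed.

Lemma hull_norm_le1 (x : RR) : star_hull (trace_until_exit W w) x -> norm2 x <= 1.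
Proof.
move=> [rho [p [/andP[r0 r1] [t [t0 te] <-] ->]]].
have n1 := alive_norm W0 cW t0 te.
rewrite -nrm_cplx (_ : cplx _ = rho%:C%C * cplx (W t w)); last by rewrite /cplx; simpc.
rewrite nrmM nrm_real ger0_norm// nrm_cplx.
have := sqrtr_ge0 ((W t w).1 ^+ 2 + (W t w).2 ^+ 2); rewrite -/(norm2 _); nra.
Qed.

(** Norm 1 forces rho = 1, so such a point is [W t w] with t at most the exit time; strictly before
    the exit the norm is below 1, so the two times coincide. *)
Lemma hull_circle (x y : RR) : star_hull (trace_until_exit W w) x ->
  star_hull (trace_until_exit W w) y -> norm2 x = 1 -> norm2 y = 1 -> x = y.
Proof.
have key (z : RR) : star_hull (trace_until_exit W w) z -> norm2 z = 1 ->
    exists t, [/\ 0 <= t, (t%:E <= exit_time W w)%E & W t w = z].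
  move=> [rho [p [/andP[r0 r1] [t [t0 te] <-] zE]]] z1.
  have n1 := alive_norm W0 cW t0 te.
  have e : norm2 z = rho * norm2 (W t w : RR).
    rewrite -nrm_cplx (_ : cplx z = rho%:C%C * cplx (W t w)); last by rewrite zE /cplx; simpc.
    by rewrite nrmM nrm_real ger0_norm// nrm_cplx.
  have n0 : 0 <= norm2 (W t w : RR) by exact: sqrtr_ge0.
  have rho1 : rho = 1 by rewrite z1 in e; nra.
  by exists t; split => //; rewrite zE rho1 !mul1r -surjective_pairing.
move=> /key hx /key hy x1 y1; have [t [t0 te tx]] := hx x1; have [s [s0 se sy]] := hy y1.
have [st|ts|st] := ltgtP s t.
- have /exit_timeP/(_ s) := te; rewrite s0 st => /(_ isT)/unit_diskE.
  by rewrite sy y1 ltxx.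
- have /exit_timeP/(_ t) := se; rewrite t0 ts => /(_ isT)/unit_diskE.
  by rewrite tx x1 ltxx.
- by rewrite -tx -sy st.
Qed.

End HullPath.

Section Tonelli.
Local Open Scope ereal_scope.

(** Tonelli's theorem for an indicator; sigma-finiteness enters as a proposition, so that it applies
    to [leb2] through the next lemma. *)
Lemma tonelli_sections d1 d2 (T1 : measurableType d1) (T2 : measurableType d2) (R : realType)
  (m1 : {measure set T1 -> \bar R}) (m2 : {measure set T2 -> \bar R})
  (A : set (T1 * T2)) : sigma_finite setT m1 -> sigma_finite setT m2 -> measurable A ->
  \int[m1]_x m2 (xsection A x) = \int[m2]_y m1 (ysection A y).
Proof.
move=> s1 s2 mA.
pose i1 := isSFinite.Build _ _ _ _ (sfinite_measure_sigma_finite s1).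
pose j1 := isSigmaFinite.Build _ _ _ _ s1.
pose i2 := isSFinite.Build _ _ _ _ (sfinite_measure_sigma_finite s2).
pose j2 := isSigmaFinite.Build _ _ _ _ s2.
pose n1 := HB.pack_for {sigma_finite_measure set T1 -> \bar R} (Measure.sort m1) i1 j1.
pose n2 := HB.pack_for {sigma_finite_measure set T2 -> \bar R} (Measure.sort m2) i2 j2.
have := indic_fubini_tonelli n1 n2 mA.
by rewrite indic_fubini_tonelli_FE// indic_fubini_tonelli_GE.
Qed.

Lemma sigma_finite_leb2 (R : realType) : sigma_finite setT (leb2 : set (measurableTypeR R * measurableTypeR R)%type -> \bar R).
Proof.
have /sigma_finiteP[F [TF ndF Foo]] := sigma_finiteT (@lebesgue_measure R).
exists (fun n => F n `*` F n).
  rewrite -setXTT TF predeqE => -[x y]; split.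
    move=> [/= [n _ Fnx] [k _ Gky]]; exists (maxn n k) => //; split.
    - by move: x Fnx; exact/subsetPset/ndF/leq_maxl.
    - by move: y Gky; exact/subsetPset/ndF/leq_maxr.
  by move=> [n _ []/= ? ?]; split; exists n.
move=> k; have [? ?] := Foo k; split; first exact: measurableX.
have -> : leb2 (F k `*` F k) = lebesgue_measure (F k) * lebesgue_measure (F k).
  exact: product_measure1E.
by rewrite lte_mul_pinfty// ge0_fin_numE.
Qed.

End Tonelli.

(** * Expected area by integration over points and levels *)

Section Main.
Context d {T : measurableType d} {R : realType} (P : probability T R).
Variable W : R -> T -> R * R.
Hypothesis BM : is_planar_BM P W.
Local Notation RR := (measurableTypeR R * measurableTypeR R)%type.
Notation mu := (@lebesgue_measure R).

Let W0 w : W 0 w = (0, 0). Proof. by case: BM. Qed.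
Let cW w : {within `[0, +oo[, continuous (fun t => W t w)}. Proof. by case: BM. Qed.
Arguments cW : clear implicits.

Let mW (t : R) : 0 <= t -> measurable_fun setT (W t : T -> RR).
Proof. by case: BM => _ m _ _ /m. Qed.

(** The joint set of paths and points to which Tonelli is applied. The strict inequality discards
    the hull points on the circle. *)
Definition core : set (T * RR) := [set p | norm2 p.2 < 1 /\ near_ray W p.1 p.2].

Lemma measurable_core : measurable core.
Proof.
have m2 : measurable_fun setT (fun p : T * RR => norm2 p.2).
  by apply: measurableT_comp measurable_snd; exact: measurable_norm2.
have mWq (t : R) : 0 <= t -> measurable_fun setT (fun p : T * RR => W t p.1 : RR).
  by move=> t0; exact: measurableT_comp (mW t0) measurable_fst.
apply: measurableI; first exact: measurable_lt_cst.
apply: measurable_ex_nat => N; apply: measurable_all_nat => n.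
apply: measurable_ex_rat => q.
apply: measurable_and_cst => /andP[q0 _]; apply: measurableI.
  apply: measurable_ex_nat => k; apply: measurable_all_rat => s.
  apply: measurable_imp_cst => /andP[s0 _]; apply: measurable_le_cst.
  by apply: measurableT_comp; [exact: measurable_norm2|exact: mWq].
apply: measurable_lt_cst; apply: measurable_ray; first exact: measurable_snd.
exact: mWq.
Qed.

Lemma near_ray0 w : near_ray W w (0, 0).
Proof.
exists 0%N => n; exists 0; rewrite rmorph0 lexx; split => //; split.
  exists 0%N => s; rewrite rmorph0 -eq_le => /eqP <-.
  by rewrite W0 /norm2 /= expr0n addr0 sqrtr0 invr1 subrr.
rewrite W0 /ray /= !mulr0 !subr0 normr0 add0r expr0n !addr0 subrr maxxx.
by rewrite invr_gt0.
Qed.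

Lemma norm2_0 : norm2 ((0, 0) : RR) = 0.
Proof. by rewrite /norm2 /= expr0n addr0 sqrtr0. Qed.

Lemma norm2_gt0 (x : RR) : x != (0, 0) :> R * R -> 0 < norm2 x.
Proof.
move=> x0; rewrite -nrm_cplx nrm_gt0; apply: contra x0 => /eqP [a b].
by rewrite [x]surjective_pairing a b.
Qed.

Lemma hull0 w : star_hull (trace_until_exit W w) (0, 0).
Proof.
exists 0, (W 0 w); split; rewrite ?lexx ?ler01 ?mul0r//.
exists 0 => //; split => //; apply/exit_timeP => s /andP[s0 /(le_lt_trans s0)].
by rewrite ltxx.
Qed.

Lemma hull_core w : star_hull (trace_until_exit W w) `&` disk 1 = xsection core w.
Proof.
apply/seteqP; split => x; rewrite /xsection /= inE /core /disk /=.
  move=> [hx x1]; split => //; have [->|x0] := eqVneq (x : R * R) (0, 0).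
    exact: near_ray0.
  exact/(near_rayP (W0 w) (cW w) x0).
move=> [x1 hx]; split => //; have [->|x0] := eqVneq (x : R * R) (0, 0).
  exact: hull0.
exact/(near_rayP (W0 w) (cW w) x0).
Qed.

(** The part of the hull on the circle has at most one point, hence area 0. *)
Lemma Area_hull w : Area (star_hull (trace_until_exit W w)) = leb2 (xsection core w).
Proof.
set H := star_hull _; pose B := [set x : RR | H x /\ norm2 x = 1].
have HE : H = xsection core w `|` B.
  rewrite -hull_core -/H; apply/seteqP; split => x.
    move=> hx; have := hull_norm_le1 (W0 w) (cW w) hx; rewrite le_eqVlt => /orP[/eqP x1|x1].
      by right.
    by left.
  by case=> [[]|[]].
have mc : measurable (xsection core w) by apply: measurable_xsection; exact: measurable_core.
have B0 : measurable B /\ leb2 B = 0%E.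
  have [Be|] := pselect (exists x, B x); last first.
    move=> nB; have -> : B = set0 by apply/seteqP; split => x // Bx; apply: nB; exists x.
    by split => //; exact: measure0.
  case: Be => x [hx x1].
  have -> : B = [set x.1] `*` [set x.2].
    apply/seteqP; split => y.
      by move=> [hy y1]; rewrite (hull_circle (W0 w) (cW w) hx hy x1 y1).
    case: y => a b /= [-> ->]; rewrite -surjective_pairing; split => //.
  split; first exact: measurableX.
  transitivity (mu [set x.1] * mu [set x.2])%E; first exact: product_measure1E.
  by rewrite lebesgue_measure_set1 mul0e.
have [mB lB] := B0.
rewrite /Area HE; exact: (measureU0 mc mB lB).
Qed.

(** Used on the whole plane: it is positive exactly on the open disk, so its positive part is the
    probability of the section of [core] at every x, the origin included. *)
Definition hit_prob (x : RR) : R := 1 - 4 / pi * atan (Num.sqrt (norm2 x)).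

Lemma hit_prob_gt0 x : (0 < hit_prob x) = (norm2 x < 1).
Proof.
have p0 := pi_gt0 R.
rewrite /hit_prob subr_gt0 mulrAC ltr_pdivrMr// mul1r mulrC -ltr_pdivlMr//.
rewrite -atan1 -[X in _ < atan X]sqrtr1.
have mono (u v : R) : (atan u < atan v) = (u < v).
  apply/idP/idP; last exact: lt_atan.
  by apply: contraTT; rewrite -!leNgt; exact: le_atan.
rewrite mono; apply/idP/idP => [|h]; last by rewrite ltr_sqrt.
by apply: contraTT; rewrite -!leNgt; exact: ler_wsqrtr.
Qed.

Lemma core_prob (x : RR) : P (ysection core x) = (Num.max 0 (hit_prob x))%:E.
Proof.
have [x1|x1] := ltP (norm2 x) 1; last first.
  have -> : ysection core x = set0.
    apply/seteqP; split => w //; rewrite /ysection /= inE /core /= => -[].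
    by rewrite ltNge x1.
  rewrite measure0 (_ : Num.max _ _ = 0)//; apply/max_idPl.
  by rewrite leNgt hit_prob_gt0 -leNgt.
rewrite (_ : Num.max _ _ = hit_prob x); last by apply/max_idPr; rewrite ltW// hit_prob_gt0.
have ycE : ysection core x = hull_event W x.
  apply/seteqP; split => w; rewrite /ysection /= inE /hull_event /=.
    move=> cx; suff : (star_hull (trace_until_exit W w) `&` disk 1) x by case.
    by rewrite hull_core /xsection /= inE.
  move=> hx; have : (star_hull (trace_until_exit W w) `&` disk 1) x by [].
  by rewrite hull_core /xsection /= inE.
have mh : measurable (hull_event W x).
  by rewrite -ycE; apply: measurable_ysection; exact: measurable_core.
rewrite ycE; have [xz|x0] := eqVneq (x : R * R) (0, 0).
  rewrite /hit_prob xz norm2_0 sqrtr0 atan0 mulr0 subr0.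
  rewrite (_ : hull_event W _ = setT) ?probability_setT//.
  by apply/seteqP; split => w // _; exact: hull0.
exact: (hull_event_prob BM (norm2_gt0 x0) x1 mh).
Qed.

(* The horizontal slices of this subgraph are disks. *)
Definition subgraph : set (RR * measurableTypeR R) :=
  [set p | - p.2 < 0 /\ p.2 - hit_prob p.1 < 0].

Lemma measurable_subgraph : measurable subgraph.
Proof.
apply: measurableI.
  by apply: measurable_lt_cst; apply: measurable_funN; exact: measurable_snd.
apply: measurable_lt_cst; apply: measurable_funB; first exact: measurable_snd.
apply: measurable_funB => //; apply: measurable_funM => //.
apply: measurableT_comp; first by apply: continuous_measurable_fun => v; exact: continuous_atan.
apply: measurableT_comp; first by apply: continuous_measurable_fun; exact: sqrt_continuous.
by apply: measurableT_comp measurable_fst; exact: measurable_norm2.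
Qed.

Lemma subgraph_vertical (x : RR) : mu (xsection subgraph x) = (Num.max 0 (hit_prob x))%:E.
Proof.
have -> : xsection subgraph x = [set` `]0, hit_prob x[].
  apply/seteqP; split => t; rewrite /xsection /= inE /subgraph /= in_itv/= subr_lt0 oppr_lt0.
    by move=> [-> ->].
  by move=> /andP[].
rewrite lebesgue_measure_itv/= lte_fin -EFinD subr0.
by rewrite /Num.max; case: ifP.
Qed.

Lemma subgraph_horizontal (t : R) : leb2 (ysection subgraph t) =
  ((fun t => (pi * tan ((1 - t) * (pi / 4)) ^+ 4)%:E) \_ `]0%R, 1%R[) t.
Proof.
have p0 := pi_gt0 R.
rewrite patchE; have [tI|tI] := pselect (0 < t < 1); last first.
  rewrite memNset /= ?in_itv//.
  (* Levels t <= 0 are excluded by definition, levels t >= 1 because [hit_prob] is at most 1. *)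
  rewrite (_ : ysection _ _ = set0); first exact: measure0.
  apply/seteqP; split => x //; rewrite /ysection /= inE /subgraph /= subr_lt0 oppr_lt0 => -[t0 tp].
  exfalso; apply: tI; rewrite t0/=; apply: lt_le_trans tp _; rewrite /hit_prob gerBl.
  by rewrite mulr_ge0 ?divr_ge0 ?(ltW p0)// -atan0 le_atan// sqrtr_ge0.
rewrite mem_set /= ?in_itv//; move: tI => /andP[t0 t1]; pose th : R := (1 - t) * (pi / 4).
have th0 : 0 < th by rewrite /th; nra.
have th1 : th < pi / 2 by rewrite /th; nra.
have thI : th \in `]- (pi / 2), pi / 2[ by rewrite in_itv/=; apply/andP; lra.
have tanp : 0 < tan th.
  by rewrite /tan divr_gt0 ?sin_gt0_pihalf ?cos_gt0_pihalf ?th0//; apply/andP; lra.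
have -> : ysection subgraph t = disk (tan th ^+ 2).
  apply/seteqP; split => x; rewrite /ysection /= inE /subgraph /= subr_lt0 oppr_lt0 /hit_prob /disk /=.
    move=> [_ h].
    have h2 : atan (Num.sqrt (norm2 x)) < th.
      have : 4 / pi * atan (Num.sqrt (norm2 x)) < 1 - t by lra.
      by rewrite mulrAC ltr_pdivrMr// /th => ?; lra.
    rewrite ltNge; apply/negP => le1.
    have : tan th <= Num.sqrt (norm2 x).
      by rewrite -[leLHS]ger0_norm ?(ltW tanp)// -sqrtr_sqr ler_wsqrtr.
    by move=> /le_atan; rewrite tanK// leNgt h2.
  move=> h; split => //.
  have h2 : atan (Num.sqrt (norm2 x)) < th.
    rewrite -[ltRHS]tanK//; apply: lt_atan.
    by rewrite -[ltRHS]ger0_norm ?(ltW tanp)// -sqrtr_sqr ltr_sqrt// exprn_gt0.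
  have : 4 / pi * atan (Num.sqrt (norm2 x)) < 1 - t.
    by rewrite mulrAC ltr_pdivrMr//; rewrite /th in h2; lra.
  lra.
rewrite leb2_disk ?exprn_gt0//; congr (_%:E).
by rewrite -exprM.
Qed.

(** Tonelli is applied twice: path against point, then, with the probability read as a height, point
    against level. *)
Lemma expected_area :
  (\int[P]_w Area (star_hull (trace_until_exit W w)) = (pi - 8 / 3)%:E)%E.
Proof.
have mc := measurable_core; have ms := measurable_subgraph.
transitivity (\int[P]_w leb2 (xsection core w))%E.
  by apply: eq_integral => w _; exact: Area_hull.
transitivity (\int[leb2]_x P (ysection core x))%E.
  exact: (tonelli_sections (sigma_finiteT P) (@sigma_finite_leb2 R) mc).
transitivity (\int[leb2]_x mu (xsection subgraph x))%E.
  by apply: eq_integral => x _; rewrite core_prob subgraph_vertical.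
transitivity (\int[mu]_t leb2 (ysection subgraph t))%E.
  exact: (tonelli_sections (@sigma_finite_leb2 R) (sigma_finiteT mu) ms).
rewrite -integral_tan4 [RHS]integral_mkcond; apply: eq_integral => t _.
exact: subgraph_horizontal.
Qed.

End Main.

Theorem theorem5p1 (R : realType) (d : measure_display) (T : measurableType d)
  (P : probability T R) (W : R -> T -> R * R) :
  is_planar_BM P W ->
  (\int[P]_w Area (star_hull (trace_until_exit W w)) = (pi - 8 / 3)%:E)%E.
Proof. exact: expected_area. Qed.
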